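(* Let $p \in L^2(0,T_{\mathrm{end}};Q)$ with $\partial_t p \in L^2(0,T_{\mathrm{end}};Q')$ be the solution of the abstract parabolic problem $$\langle \partial_t p(t), q\rangle + b(p(t),q) = (f,q)\quad\text{for all } q\in Q,\qquad p(0)=p_0,$$ and let $\tilde p \in L^2(0,T_{\mathrm{end}};\widetilde Q)$ with $\partial_t\tilde p\in L^2(0,T_{\mathrm{end}};\widetilde Q)$ be a solution of the $\widetilde Q$-Galerkin approximation $$(\partial_t\tilde p(t),\tilde q)+b(\tilde p(t),\tilde q)=(f,\tilde q)\quad\text{for all }\tilde q\in\widetilde Q.$$ Let $\tilde p(t)=\tilde p^c(t)+\tilde p^d(t)$ be a decomposition with $\tilde p^c(t)\in Q$, $\tilde p^d(t)\in\widetilde Q$ for each $t$ (not necessarily unique), with $\tilde p^d,\partial_t\tilde p^d\in L^2(0,T_{\mathrm{end}};\widetilde Q)$. Put $e(t):=p(t)-\tilde p(t)$, $e^c(t):=p(t)-\tilde p^c(t)$ and $\varepsilon(t):=\mathcal E(\tilde p(t))-\tilde p(t)$, where $\mathcal E$ is the elliptic reconstruction. Let $C:=(2|||b|||^2+1)^{1/2}$, where $|||b|||$ denotes the continuity constant of $b$ on $Q$ with respect to $|||\cdot|||$. Then $$\|e\|_{L^2(0,T_{\mathrm{end}};|||\cdot|||)}\le \|e^c(0)\|+\sqrt3\,\|\partial_t\tilde p^d\|_{L^2(0,T_{\mathrm{end}};|||\cdot|||_{Q,-1})}+(C+1)\,\|\varepsilon\|_{L^2(0,T_{\mathrm{end}};|||\cdot|||)}+C\,\|\tilde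 p^d\|_{L^2(0,T_{\mathrm{end}};|||\cdot|||)}.$$
   Context: Setting. $Q$ is a real Hilbert space densely (and continuously) embedded in another real Hilbert space $H$ (possibly $Q=H$), and $\widetilde Q\subseteq H$ is a finite dimensional subspace, not necessarily contained in $Q$. $(\cdot,\cdot)$ and $\|\cdot\|$ denote the $H$-inner product and the induced norm. $T_{\mathrm{end}}>0$, $f\in H$, $p_0\in Q$. The duality pairing $\langle\cdot,\cdot\rangle$ between $Q'$ and $Q$ is induced by the $H$-inner product via the Gelfand triple $Q\subseteq H=H'\subseteq Q'$. $b:(Q+\widetilde Q)\times(Q+\widetilde Q)\to\mathbb R$ is a bilinear form (not necessarily symmetric) which is continuous and coercive on $Q$. $|||\cdot|||$ is a norm on $Q+\widetilde Q$ which coincides on $Q$ with the square root of the symmetric part of $b$, i.e. $|||q|||^2=b(q,q)$ for $q\in Q$. The continuity constant $|||b|||$ of $b$ on $Q$ is the smallest constant with $|b(q,q')|\le|||b|||\,|||q|||\,|||q'|||$ for all $q,q'\in Q$. $|||\cdot|||_{Q,-1}$ is the dual norm on $Q$: for $g\in H$, $|||g|||_{Q,-1}:=\sup_{0\ne q\in Q}(g,q)/|||q|||$. For a norm $N$, $\|v\|_{L^2(0,T_{\mathrm{end}};N)}:=\big(\int_0^{T_{\mathrm{end}}}N(v(t))^2\,dt\big)^{1/2}$. Time derivatives are weak derivatives, and the time-dependent variational equations hold for almost every $t\in(0,T_{\mathrm{end}})$. Elliptic reconstruction. Let $\widetilde\Pi$ be the $H$-orthogonal projection onto $\widetilde Q$.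 For $\tilde q\in\widetilde Q$ let $B(\tilde q)\in\widetilde Q$ be the $H$-Riesz representative of $b(\tilde q,\cdot)$ on $\widetilde Q$, i.e. $(B(\tilde q),\tilde q')=b(\tilde q,\tilde q')$ for all $\tilde q'\in\widetilde Q$. The elliptic reconstruction $\mathcal E(\tilde q)\in Q$ is the unique solution of $b(\mathcal E(\tilde q),q')=(B(\tilde q)-\widetilde\Pi(f)+f,\,q')$ for all $q'\in Q$. *)

(* Defs.v *)
From HB Require Import structures.
From mathcomp Require Import all_boot all_order all_algebra.
From mathcomp Require Import all_classical all_reals all_analysis.

Set Implicit Arguments.
Unset Strict Implicit.
Unset Printing Implicit Defensive.

Import Order.TTheory GRing.Theory Num.Theory.
Import numFieldNormedType.Exports.

Local Open Scope classical_set_scope.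
Local Open Scope ring_scope.

(* A real Hilbert space is a complete normed module together with a positive
   definite symmetric bilinear form that induces its norm. *)
Definition hilbert (R : realType) (H : completeNormedModType R)
    (ip : {dot H for (@idfun R)}) : Prop :=
  forall x : H, `|x| ^+ 2 = ip x x.

Definition dense_embedding (R : realType) (Q H : completeNormedModType R)
    (j : {linear Q -> H}) : Prop :=
  [/\ injective j, continuous j & dense (range j)].

Definition finite_dim_subspace (R : realType) (V : lmodType R) (S : set V) :
    Prop :=
  exists (n : nat) (v : 'I_n -> V),
    S = [set x | exists c : 'I_n -> R, x = \sum_(i < n) c i *: v i].

Definition Qsum (R : realType) (Q H : completeNormedModType R)
    (j : {linear Q -> H}) (Qt : set H) : set H :=
  [set x | exists q y, Qt y /\ x = j q + y].

(* In the next definitions the values of b and N outside S are irrelevant. *)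
Definition bilinear_on (R : realType) (V : lmodType R) (S : set V)
    (b : V -> V -> R) : Prop :=
  (forall (a : R) x y z, S x -> S y -> S z ->
     b (a *: x + y) z = a * b x z + b y z) /\
  (forall (a : R) x y z, S x -> S y -> S z ->
     b z (a *: x + y) = a * b z x + b z y).

Definition norm_on (R : realType) (V : lmodType R) (S : set V) (N : V -> R) :
    Prop :=
  [/\ forall x, S x -> 0 <= N x,
      forall x, S x -> N x = 0 -> x = 0,
      forall (a : R) x, S x -> N (a *: x) = `|a| * N x
    & forall x y, S x -> S y -> N (x + y) <= N x + N y].

Definition continuous_form (R : realType) (Q H : completeNormedModType R)
    (j : {linear Q -> H}) (b : H -> H -> R) : Prop :=
  exists M : R, forall q q' : Q, `|b (j q) (j q')| <= M * `|q| * `|q'|.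

Definition coercive_form (R : realType) (Q H : completeNormedModType R)
    (j : {linear Q -> H}) (b : H -> H -> R) : Prop :=
  exists2 alpha : R, 0 < alpha &
    forall q : Q, alpha * `|q| ^+ 2 <= b (j q) (j q).

Definition continuity_constant (R : realType) (Q H : completeNormedModType R)
    (j : {linear Q -> H}) (b : H -> H -> R) (N : H -> R) : R :=
  inf [set M : R | 0 <= M /\
    forall q q' : Q, `|b (j q) (j q')| <= M * N (j q) * N (j q')].

Definition norm_Qm1 (R : realType) (Q H : completeNormedModType R)
    (ip : {dot H for (@idfun R)}) (j : {linear Q -> H}) (N : H -> R) (g : H) :
    R :=
  sup [set r : R | exists2 q : Q, q != 0 & r = ip g (j q) / N (j q)].

(* The topological dual Q', as a subspace of the space of all functions. *)
Definition dual (R : realType) (Q : completeNormedModType R) :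
    set (Q -> R^o) :=
  [set l | linear l /\ continuous l].

Definition dual_norm (R : realType) (Q : completeNormedModType R)
    (l : Q -> R^o) : R :=
  sup [set r : R | exists2 q : Q, q != 0 & r = `|l q| / `|q|].

(* H -> Q' in the Gelfand triple. *)
Definition gelfand (R : realType) (Q H : completeNormedModType R)
    (ip : {dot H for (@idfun R)}) (j : {linear Q -> H}) (x : H) : Q -> R^o :=
  fun q => ip x (j q).

(* Bochner spaces on ]0, T[, for functions with values in a subspace S of V
   that is normed by N.  The sequence [:: (A1, x1); ...; (An, xn)] stands for
   the simple function \1_A1 x1 + ... + \1_An xn. *)
Definition simple (R : realType) (V : lmodType R) : Type :=
  seq (set (measurableTypeR R) * V).

Definition simple_in (R : realType) (V : lmodType R) (S : set V)
    (s : simple V) : Prop :=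
  forall i, (i < size s)%N ->
    measurable (nth (set0, 0) s i).1 /\ S (nth (set0, 0) s i).2.

Definition simple_val (R : realType) (V : lmodType R) (s : simple V)
    (t : R) : V :=
  \sum_(a <- s) (\1_(a.1) t : R) *: a.2.

Definition simple_int (R : realType) (V : lmodType R) (T : R)
    (s : simple V) : V :=
  \sum_(a <- s)
    fine (lebesgue_measure (a.1 `&` (`]0, T[ : set (measurableTypeR R)))) *: a.2.

Definition approx (R : realType) (V : lmodType R) (T : R) (S : set V)
    (N : V -> R) (v : R -> V) (s : nat -> simple V) : Prop :=
  [/\ forall t, 0 < t < T -> S (v t),
      forall n, simple_in S (s n)
    & {ae @lebesgue_measure R, forall t, 0 < t < T ->
        (fun n => N (simple_val (s n) t - v t)) @ \oo --> (0 : R)}].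

Definition strongly_measurable (R : realType) (V : lmodType R) (T : R)
    (S : set V) (N : V -> R) (v : R -> V) : Prop :=
  exists s : nat -> simple V, approx T S N v s.

Definition bochner_integral (R : realType) (V : lmodType R) (T : R)
    (S : set V) (N : V -> R) (v : R -> V) (x : V) : Prop :=
  S x /\ exists s : nat -> simple V,
    [/\ approx T S N v s,
        (fun n => \int[@lebesgue_measure R]_(t in `]0%R, T[)
           (N (simple_val (s n) t - v t))%:E)%E @ \oo --> 0%E
      & (fun n => N (simple_int T (s n) - x)) @ \oo --> (0 : R)].

Definition L2norm (R : realType) (V : lmodType R) (T : R) (N : V -> R)
    (v : R -> V) : \bar R :=
  poweR (\int[@lebesgue_measure R]_(t in `]0%R, T[) ((N (v t)) ^+ 2)%:E)%E 2^-1.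

Definition in_L2 (R : realType) (V : lmodType R) (T : R) (S : set V)
    (N : V -> R) (v : R -> V) : Prop :=
  strongly_measurable T S N v /\ (L2norm T N v < +oo)%E.

Definition test_function (R : realType) (T : R) (phi : R -> R) : Prop :=
  [/\ forall n t, derivable (derive1n n phi) t 1,
      compact (closure [set t | phi t != 0])
    & closure [set t | phi t != 0] `<=` `]0, T[].

Definition weak_derivative (R : realType) (V : lmodType R) (T : R) (S : set V)
    (N : V -> R) (u g : R -> V) : Prop :=
  forall phi : R -> R, test_function T phi ->
    exists x : V, bochner_integral T S N (fun t => derive1 phi t *: u t) x /\
                  bochner_integral T S N (fun t => phi t *: g t) (- x).

(* The value at 0 of a function defined almost everywhere on ]0, T[ is the one
   of its representative that is continuous from [0, T] to H. *)
Definition is_initial_value (R : realType) (H : completeNormedModType R)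
    (T : R) (u : R -> H) (h : H) : Prop :=
  exists c : R -> H,
    [/\ {within `[0, T], continuous c},
        {ae @lebesgue_measure R, forall t, 0 < t < T -> c t = u t}
      & c 0 = h].

Definition initial_value (R : realType) (H : completeNormedModType R)
    (T : R) (u : R -> H) : H :=
  xget 0 [set h | is_initial_value T u h].

Definition is_orthogonal_projection (R : realType)
    (H : completeNormedModType R) (ip : {dot H for (@idfun R)}) (S : set H)
    (Pi : H -> H) : Prop :=
  forall x, S (Pi x) /\ forall y, S y -> ip (x - Pi x) y = 0.

Definition is_riesz_representative (R : realType)
    (H : completeNormedModType R) (ip : {dot H for (@idfun R)}) (S : set H)
    (b : H -> H -> R) (B : H -> H) : Prop :=
  forall x, S x -> S (B x) /\ forall y, S y -> ip (B x) y = b x y.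

Definition is_elliptic_reconstruction (R : realType)
    (Q H : completeNormedModType R) (ip : {dot H for (@idfun R)})
    (j : {linear Q -> H}) (Qt : set H) (b : H -> H -> R) (f : H)
    (Pi B : H -> H) (E : H -> Q) : Prop :=
  forall x, Qt x -> forall q, b (j (E x)) (j q) = ip (B x - Pi f + f) (j q).

(* Main.v *)
(** Put r = p - E(pt), s = E(pt) - pc and w = p - pc = r + s, which takes values
in Q.  By the definition of the elliptic reconstruction, the Galerkin equation
extends to all test functions of Q, so that the time derivative of ec = j w is
the functional g(q) = (dpd, q) - b(r, q).  Formally d/dt |ec|^2 = 2 g(w), hence
0 <= |ec(0)|^2 + 2 \int g(w), while Young's inequality gives the pointwise bound
2 g(w) <= C^2 N(s)^2 + 3 D^2 - N(r)^2, where D is the dual norm of dpd.  Since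
s = eps + pd and e = r + eps, Minkowski's inequality concludes.

The chain rule for |ec|^2 is avoided by testing with J ec instead of w, where
J = J_lam : H -> Q solves (J x, q) + lam (J x, q)_Q = (x, q).  As J is Lipschitz
from H to Q and symmetric, the increments of (ec, J ec) are controlled on a fine
subdivision of [0, T] by uniform continuity of ec alone; then lam tends to 0 by
dominated convergence, because J j contracts Q and tends strongly to the identity.

Vector-valued weak derivatives are only used after applying a linear functional:
a scalar function with an integrable weak derivative is almost everywhere a
constant plus a primitive, by testing with smooth plateau functions between
Lebesgue points.  As Qt is finite dimensional, this already gives the continuous
representative of pc, hence the initial value of ec. *)

Require Import Defs.
From HB Require Import structures.
From mathcomp Require Import all_boot all_order all_algebra.
From mathcomp Require Import all_classical all_reals all_analysis.
From mathcomp Require Import measurable_realfun ring lra.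

Set Implicit Arguments.
Unset Strict Implicit.
Unset Printing Implicit Defensive.

Import Order.TTheory GRing.Theory Num.Theory.
Import numFieldNormedType.Exports.

Local Open Scope classical_set_scope.
Local Open Scope ring_scope.

(** Two features of the setting shape the proof. First, [pt] leaves [Q], and no bound of [b] is
    assumed on mixed pairs from [Q] and [Qt]. Comparing [p] with [E pt] rather than with [pt] avoids
    such pairs: the form only acts on [r], inside [Q], and the sole nonconforming term left is
    [dpd], paired in [H] with elements of [Q], which is why its dual norm appears. Second, [pc] is
    only given pointwise, with no measurability in [Q] and no time derivative. What is regular is
    [j (pc t) = pt t - pd t], which stays in the intersection of [Qt] with the range of [j]. That
    space is finite dimensional, so [j] has a Lipschitz left inverse on it, and [w] becomes a
    continuous function of [p], [pt] and [pd]. The increments of [ec] are known against a fixed test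
    vector of [Q], whereas an energy argument needs one that moves with time. [w] may jump in [Q],
    being continuous only as a function into [H]; [J] turns continuity in [H] into continuity in
    [Q], so that freezing the test vector on a short interval costs little. *)

(** * Inner products and the Cauchy-Schwarz inequality *)

Section inner_product.
Context {R : realType} {H : completeNormedModType R}.
Variable ip : {dot H for (@idfun R)}.

Lemma ipC x y : ip x y = ip y x.
Proof. by have := hermC ip x y; rewrite expr0 mul1r. Qed.

Lemma ipPr a x y z : ip z (a *: x + y) = a * ip z x + ip z y.
Proof. by rewrite linearP. Qed.

Lemma ipPl a x y z : ip (a *: x + y) z = a * ip x z + ip y z.
Proof. by rewrite ipC ipPr !(ipC z). Qed.

Lemma ipDl x y z : ip (x + y) z = ip x z + ip y z.
Proof. by rewrite -[x]scale1r ipPl mul1r scale1r. Qed.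

Lemma ip0l z : ip 0 z = 0.
Proof. by have := ipDl 0 0 z; rewrite addr0 => h; lra. Qed.

Lemma ipZl a x z : ip (a *: x) z = a * ip x z.
Proof. by rewrite -[a *: x]addr0 ipPl ip0l addr0. Qed.

Lemma ipNl x z : ip (- x) z = - ip x z.
Proof. by rewrite -scaleN1r ipZl mulN1r. Qed.

Lemma ipBl x y z : ip (x - y) z = ip x z - ip y z.
Proof. by rewrite ipDl ipNl. Qed.

Lemma ipDr x y z : ip z (x + y) = ip z x + ip z y.
Proof. by rewrite !(ipC z) ipDl. Qed.

Lemma ip0r z : ip z 0 = 0.
Proof. by rewrite ipC ip0l. Qed.

Lemma ipZr a x z : ip z (a *: x) = a * ip z x.
Proof. by rewrite !(ipC z) ipZl. Qed.

Lemma ipNr x z : ip z (- x) = - ip z x.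
Proof. by rewrite !(ipC z) ipNl. Qed.

Lemma ipBr x y z : ip z (x - y) = ip z x - ip z y.
Proof. by rewrite !(ipC z) ipBl. Qed.

Definition ipE := (ipDl, ipBl, ipNl, ipZl, ip0l, ipDr, ipBr, ipNr, ipZr, ip0r).

Lemma ip_suml (I : Type) (r : seq I) (F : I -> H) z :
  ip (\sum_(i <- r) F i) z = \sum_(i <- r) ip (F i) z.
Proof. by elim/big_rec2: _ => [|i x y _ <-]; rewrite ?ip0l// ipDl. Qed.

Hypothesis hilb : hilbert ip.

Lemma ip_ge0 x : 0 <= ip x x.
Proof. by rewrite -hilb exprn_ge0. Qed.

Lemma ip_eq0 x : ip x x = 0 -> x = 0.
Proof. by rewrite -hilb => /eqP; rewrite expf_eq0/= normr_eq0 => /eqP. Qed.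

Lemma cauchy_schwarz x y : `|ip x y| <= `|x| * `|y|.
Proof.
have [->|y0] := eqVneq y 0; first by rewrite ip0r !normr0 mulr0.
have yy : 0 < ip y y by rewrite -hilb exprn_gt0// normr_gt0.
(* This is [ip y y] times the component of [x] orthogonal to [y]; the scaling avoids a division. *)
have := ip_ge0 (ip y y *: x - ip x y *: y).
rewrite !ipE (ipC y x) => h.
have {}h : 0 <= ip y y * (ip x x * ip y y - ip x y ^+ 2).
  by move: h; congr (0 <= _); ring.
move: h; rewrite pmulr_rge0// subr_ge0 -!hilb -exprMn.
rewrite -(ger0_norm (mulr_ge0 (normr_ge0 x) (normr_ge0 y))).
by rewrite -[ip x y ^+ 2]real_normK ?num_real// ler_pXn2r ?nnegrE// ger0_norm ?mulr_ge0.
Qed.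

End inner_product.

(** * Finite dimensional subspaces and orthonormal expansions *)

Section finite_dimension.
Context {R : realType} {H : completeNormedModType R}.
Variable ip : {dot H for (@idfun R)}.
Hypothesis hilb : hilbert ip.

Definition is_subspace (V : lmodType R) (S : set V) :=
  S 0 /\ forall (a : R) x y, S x -> S y -> S (a *: x + y).

(** The recursion on the list of generators lets Gram-Schmidt remove one generator at a time. *)
Fixpoint in_span (V : lmodType R) (vs : seq V) (x : V) : Prop :=
  if vs is v :: vs' then exists a : R, in_span vs' (x - a *: v) else x = 0.

Lemma in_span_subspace (V : lmodType R) (vs : seq V) :
  is_subspace [set x | in_span vs x].
Proof.
elim: vs => [|v vs [IH0 IH]]; split => //=.
- by move=> a x y -> ->; rewrite scaler0 addr0.
- by exists 0; rewrite scale0r subr0.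
- move=> a x y [c hx] [d hy]; exists (a * c + d).
  have := IH a _ _ hx hy; congr in_span.
  by rewrite scalerBr scalerDl scalerA opprD addrACA.
Qed.

Section Subspace_theory.
Variables (V : lmodType R) (S : set V).
Hypothesis hS : is_subspace S.

Lemma subspace0 : S 0. Proof. by case: hS. Qed.

Lemma subspaceD x y : S x -> S y -> S (x + y).
Proof. by move=> Sx Sy; rewrite -[x]scale1r; apply: hS.2. Qed.

Lemma subspaceZ a x : S x -> S (a *: x).
Proof. by move=> Sx; rewrite -[_ *: _]addr0; apply: hS.2 => //; apply: subspace0. Qed.

Lemma subspaceB x y : S x -> S y -> S (x - y).
Proof. by move=> Sx Sy; rewrite addrC -scaleN1r; apply: hS.2. Qed.

Lemma subspace_sum (I : eqType) (r : seq I) (F : I -> V) :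
  (forall i, i \in r -> S (F i)) -> S (\sum_(i <- r) F i).
Proof.
move=> SF; rewrite big_seq; apply: (big_ind S) => //.
- exact: subspace0.
- exact: subspaceD.
Qed.

End Subspace_theory.

Lemma finite_dim_subspace_subspace (V : lmodType R) (S : set V) :
  finite_dim_subspace S -> is_subspace S.
Proof.
case=> n [v ->]; split.
  by exists (fun=> 0); rewrite big1// => i _; rewrite scale0r.
move=> a x y [c ->] [d ->]; exists (fun i => a * c i + d i).
rewrite scaler_sumr -big_split/=; apply: eq_bigr => i _.
by rewrite scalerDl scalerA.
Qed.

Lemma finite_dim_subspace_span (V : lmodType R) (S : set V) :
  finite_dim_subspace S -> exists vs, S `<=` in_span vs.
Proof.
case=> n [v ->]; exists [seq v i | i <- index_enum 'I_n] => x [c ->].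
elim: (index_enum 'I_n) => [|i s IH]/=; first by rewrite big_nil.
by exists (c i); rewrite big_cons addrC addKr.
Qed.

(* Gram-Schmidt: the vectors produced are orthonormal, but only the resulting
   expansion is used. *)
Lemma frame_exists (vs : seq H) (S : set H) : is_subspace S ->
  S `<=` in_span vs ->
  exists fs : seq H, (forall g, g \in fs -> S g) /\
    forall x, S x -> x = \sum_(g <- fs) ip x g *: g.
Proof.
elim: vs S => [|v vs IH] S sS hS.
  by exists [::]; split => // x /hS ->; rewrite big_nil.
(* The generators need not lie in [S], so the induction runs over all subspaces of the span. [S']
   has codimension at most one in [S]: either it is all of [S] and its expansion serves, or one
   vector must be added. *)
pose S' := S `&` in_span vs.
have sS' : is_subspace S'.
  split; first by split; [exact: subspace0|exact: (in_span_subspace vs).1].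
  move=> a x y [? ?] [? ?]; split; first exact: sS.2.
  exact: (in_span_subspace vs).2.
have [fs [fsS' fsE]] := IH S' sS' (@subIsetr _ _ _).
have [SS'|] := pselect (S `<=` S').
  exists fs; split; first by move=> g /fsS'[].
  by move=> x /SS'; exact: fsE.
move=> /existsNP[x /not_implyP[Sx S'x]].
pose P y := \sum_(g <- fs) ip y g *: g.
have S'P y : S' (P y).
  by apply: subspace_sum => // g gfs; apply: subspaceZ => //; exact: fsS'.
have ortho y z : S' z -> ip (y - P y) z = 0.
  move=> S'z; rewrite ipBl {1}(fsE _ S'z) /P (ipC ip y) !ip_suml.
  apply/eqP; rewrite subr_eq0; apply/eqP; apply: eq_bigr => g _.
  by rewrite !ipZl !(ipC ip g) mulrC.
pose x' := x - P x.
have x'0 : x' != 0.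
  by apply: contra_notN S'x; rewrite subr_eq0 => /eqP ->.
have Sx' : S x' by apply: subspaceB => //; exact: (S'P x).1.
pose e := `|x'|^-1 *: x'.
have e1 : ip e e = 1.
  by rewrite ipZl ipZr -hilb; field; rewrite normr_eq0.
have eS' z : S' z -> ip e z = 0 by move=> S'z; rewrite ipZl ortho ?mulr0.
have Se : S e by exact: subspaceZ.
exists (e :: fs); split.
  by move=> g; rewrite in_cons => /predU1P[->//|/fsS'[]].
move=> y Sy.
(* [x] has a nonzero coefficient [c] on [v], otherwise it would lie in [S']. Subtracting [d / c]
   times [x] from [y] removes [v], and [x] is a multiple of [e] up to [P x] in [S']. *)
have [a [u [S'u ->]]] : exists a u, S' u /\ y = a *: e + u.
  have [c hx] := hS _ Sx; have [d hy] := hS _ Sy.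
  have c0 : c != 0.
    apply: contra_notN S'x => /eqP c0; split => //.
    by move: hx; rewrite c0 scale0r subr0.
  pose u := y - (d / c) *: x.
  have S'u : S' u.
    split; first by apply: subspaceB => //; exact: subspaceZ.
    have := (in_span_subspace vs).2 (- (d / c)) _ _ hx hy; congr in_span.
    rewrite scalerBr scalerA mulNr divfK// !scaleNr opprK /u.
    by rewrite addrC addrA addrAC subrK.
  exists (d / c * `|x'|), (u + (d / c) *: P x); split.
    by apply: subspaceD => //; apply: subspaceZ.
  rewrite /e scalerA mulfK ?normr_eq0// /x' scalerBr /u.
  by rewrite addrC -addrA [_ + (_ - _)]addrC !subrK.
rewrite big_cons ipDl ipZl e1 mulr1 (ipC ip u) eS'// addr0; congr (_ + _).
rewrite {1}(fsE u)//; apply: eq_big_seq => g /fsS' S'g.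
by rewrite ipDl ipZl eS'// mulr0 add0r.
Qed.

End finite_dimension.

(** * Cauchy sequences and squeezed limits *)

Lemma cvgn_sq (R : realType) (V : completeNormedModType R) (u : nat -> V)
    (w : nat -> R) :
  w @ \oo --> (0 : R) ->
  (forall n m, (n <= m)%N -> `|u n - u m| ^+ 2 <= w n) ->
  cvgn u.
Proof.
move=> w0 uw; apply: cauchy_cvg; apply/cauchy_exP => e e0.
have e20 : 0 < e ^+ 2 by rewrite exprn_gt0.
have /cvgrPdist_lt/(_ _ e20)[N _ hN] := w0.
exists (u N); exists N => // n /= Nn.
rewrite -ball_normE/= -(ltr_pXn2r (n := 2)) ?nnegrE// ?ltW//.
apply: le_lt_trans (uw _ _ Nn) _.
have /= := hN N (leqnn N); rewrite sub0r normrN.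
exact/le_lt_trans/ler_norm.
Qed.

Lemma cvg_squeeze0 (R : realType) (u w : nat -> R) :
  (forall n, `|u n| <= w n) -> w @ \oo --> (0 : R) -> u @ \oo --> (0 : R).
Proof.
move=> uw w0; apply/norm_cvg0P.
apply: squeeze_cvgr w0; last exact: cvg_cst.
by near=> n; rewrite normr_ge0 uw.
Unshelve. all: by end_near. Qed.

Lemma cvg_dist0 (R : realType) (V : normedModType R) (u : nat -> V) (l : V) :
  (fun n => `|u n - l|) @ \oo --> (0 : R) -> u @ \oo --> l.
Proof.
move=> h; apply/cvgrPdist_lt => e e0; have /cvgrPdist_lt/(_ _ e0) := h.
by apply: filterS => n /=; rewrite sub0r normrN normr_id distrC.
Qed.

Lemma dist_cvg0 (R : realType) (V : normedModType R) (u : nat -> V) (l : V) :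
  u @ \oo --> l -> (fun n => `|u n - l|) @ \oo --> (0 : R).
Proof.
move=> h; apply/cvgrPdist_lt => e e0; have /cvgrPdist_lt/(_ _ e0) := h.
by apply: filterS => n /=; rewrite sub0r normrN normr_id distrC.
Qed.

(** * The Lax-Milgram theorem for symmetric forms *)

Section lax_milgram.
Context {R : realType} {Q : completeNormedModType R}.
Variables (a : Q -> Q -> R) (l : Q -> R) (lam M L : R).
Hypothesis lam0 : 0 < lam.
Hypothesis aC : forall x y, a x y = a y x.
Hypothesis aP : forall c x y z, a (c *: x + y) z = c * a x z + a y z.
Hypothesis acoer : forall x, lam * `|x| ^+ 2 <= a x x.
Hypothesis abnd : forall x y, `|a x y| <= M * `|x| * `|y|.
Hypothesis lP : forall c x y, l (c *: x + y) = c * l x + l y.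
Hypothesis lbnd : forall x, `|l x| <= L * `|x|.

Let F q := a q q - 2 * l q.

Let aPr c x y z : a z (c *: x + y) = c * a z x + a z y.
Proof. by rewrite !(aC z) aP. Qed.

Let F_line x q t : F (t *: q + x) = F x + 2 * t * (a x q - l q) + t ^+ 2 * a q q.
Proof. by rewrite /F lP aP !aPr (aC q x); ring. Qed.

Let aB x y z : a (x - y) z = a x z - a y z.
Proof. by rewrite addrC -scaleN1r aP mulN1r addrC. Qed.

Let F_ge q : - (L ^+ 2 / lam) <= F q.
Proof.
rewrite /F; apply: (@le_trans _ _ (lam * `|q| ^+ 2 - 2 * (L * `|q|))).
  rewrite -subr_ge0.
  have -> : lam * `|q| ^+ 2 - 2 * (L * `|q|) - - (L ^+ 2 / lam) =
    lam * (`|q| - L / lam) ^+ 2 by field; rewrite gt_eqF.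
  by rewrite mulr_ge0 ?sqr_ge0// ltW.
by have := acoer q; have := lbnd q; rewrite ler_norml => /andP[]; lra.
Qed.

(** Direct method: [F] is the energy whose minimiser solves the equation. Coercivity bounds [F]
    below and makes a minimising sequence Cauchy; near-minimality along each line then forces the
    equation in the limit. *)
Lemma lax_milgram_sym : exists y, forall q, a y q = l q.
Proof.
pose m := inf (range F).
have hF : has_inf (range F).
  split; first by exists (F 0), 0.
  by exists (- (L ^+ 2 / lam)) => _ [q _ <-]; exact: F_ge.
have Fm q : m <= F q by apply: ge_inf; [exact: hF.2|exists q].
have /choice[u hu] : forall n : nat, exists q, F q < m + n.+1%:R^-1.
  move=> n; have [|_ [q _ <-] ?] := @inf_adherent _ (range F) n.+1%:R^-1 _ hF.
    by rewrite invr_gt0.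
  by exists q.
have inv0 : (fun n => (n.+1%:R : R)^-1) @ \oo --> (0 : R) := @cvg_harmonic R.
have /cvg_ex[/= y uy] : cvgn u.
  apply: (@cvgn_sq _ _ _ (fun n => 4 / lam * n.+1%:R^-1)).
    by rewrite -(mulr0 (4 / lam)); apply: cvgMr.
  move=> n k nk.
  (* Parallelogram argument: [F (u n) + F (u k)] minus twice the value at the midpoint is half of
     [a (u n - u k) (u n - u k)]. Both values exceed [m] by at most [n.+1%:R^-1], whence the factor
     4. *)
  have Fmid := Fm (2^-1 *: (u n - u k) + u k).
  have [hn hk] := (hu n, hu k).
  have kn : (k.+1%:R : R)^-1 <= n.+1%:R^-1.
    by rewrite lef_pV2 ?posrE// ler_nat.
  have hc := acoer (u n - u k).
  have Fn : F (u n) = F (1 *: (u n - u k) + u k) by rewrite scale1r subrK.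
  rewrite mulrAC ler_pdivlMr// mulrC.
  move: Fn Fmid; rewrite !F_line => Fn Fmid.
  set A := a (u n - u k) (u n - u k) in Fn Fmid hc *.
  move: hn hk kn hc Fn Fmid; rewrite (_ : (2^-1 : R) ^+ 2 = 4^-1); last by field.
  have aux (F0 F1 d B i1 i2 X : R) : F0 < m + i1 -> F1 < m + i2 -> i2 <= i1 ->
      X <= B -> F0 = F1 + 2 * 1 * d + 1 ^+ 2 * B ->
      m <= F1 + 2 / 2 * d + 4^-1 * B -> X <= 4 * i1 by lra.
  exact: aux.
exists y => q; apply/eqP; rewrite -subr_eq0; apply/eqP.
have [->|q0] := eqVneq q 0.
  have a0 z : a z 0 = 0.
    apply/eqP; rewrite -normr_le0.
    by apply: le_trans (abnd _ _) _; rewrite normr0 mulr0.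
  have l0 : l 0 = 0.
    by apply/eqP; rewrite -normr_le0; apply: le_trans (lbnd _) _; rewrite normr0 mulr0.
  by rewrite a0 l0 subr0.
have A0 : 0 < a q q.
  by apply: lt_le_trans (acoer q); rewrite mulr_gt0// exprn_gt0// normr_gt0.
have d0 : (fun n => (a (u n) q - l q) ^+ 2) @ \oo --> (0 : R).
  apply: (@cvg_squeeze0 _ _ (fun n => a q q * n.+1%:R^-1)); last first.
    by rewrite -(mulr0 (a q q)); apply: cvgMr.
  move=> n; rewrite ger0_norm ?sqr_ge0//.
  set d := a (u n) q - l q.
  (* The coefficient minimises [F] on the line through [u n] in direction [q]. The gain
     [d ^+ 2 / a q q] cannot exceed the distance of [F (u n)] from the infimum. *)
  have := Fm ((- (d / a q q)) *: q + u n); rewrite F_line -/d.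
  have -> : F (u n) + 2 * - (d / a q q) * d + (- (d / a q q)) ^+ 2 * a q q
    = F (u n) - d ^+ 2 / a q q by field; rewrite gt_eqF.
  move=> h; rewrite mulrC -ler_pdivrMr// -(lerD2l m).
  by rewrite lerBrDr in h; exact: le_trans h (ltW (hu n)).
have d1 : (fun n => a (u n) q - l q) @ \oo --> a y q - l q.
  apply: cvgB; last exact: cvg_cst.
  apply: cvg_dist0.
  apply: (@cvg_squeeze0 _ _ (fun n => M * `|u n - y| * `|q|)).
    by move=> n; rewrite normr_id -aB.
  rewrite -(mul0r `|q|); apply: cvgMl.
  by rewrite -(mulr0 M); apply: cvgMr; exact: dist_cvg0.
have d2 : (fun n => (a (u n) q - l q) ^+ 2) @ \oo --> (a y q - l q) ^+ 2.
  exact: (cvgM d1 d1).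
have : (a y q - l q) ^+ 2 = 0 by exact: (@norm_cvg_unique _ _ _ _ _ _ d2 d0).
by move/eqP; rewrite sqrf_eq0 => /eqP.
Qed.

End lax_milgram.

Lemma continuous_linear_lipschitz (R : realType) (V W : normedModType R)
    (g : {linear V -> W}) : continuous g ->
  exists2 K, 0 < K & forall x, `|g x| <= K * `|x|.
Proof.
move=> /(_ 0)/continuous_linear_bounded/linear_boundedP[K [Kreal hK]].
exists (`|K| + 1); first by rewrite ltr_wpDl.
move=> x; apply: hK.
by rewrite (le_lt_trans (ler_norm _))// ltrDl.
Qed.

(** * The resolvents of the Gelfand triple *)

Section resolvent.
Context {R : realType} {Q H : completeNormedModType R}.
Variables (ipQ : {dot Q for (@idfun R)}) (ip : {dot H for (@idfun R)}).
Hypothesis (hilbQ : hilbert ipQ) (hilbH : hilbert ip).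
Variables (j : {linear Q -> H}) (K : R).
Hypotheses (K0 : 0 < K) (jK : forall q, `|j q| <= K * `|q|).

(** The term with [lam] makes the symmetric form coercive on [Q], so Lax-Milgram applies. *)
Lemma resolvent_exists : exists J : R -> H -> Q, forall lam x q, 0 < lam ->
  ip (j (J lam x)) (j q) + lam * ipQ (J lam x) q = ip x (j q).
Proof.
(* A single choice over the pairs [(lam, x)]; for [lam <= 0] the value 0 is a dummy. *)
have ex (lx : R * H) : exists y : Q, forall q, 0 < lx.1 ->
    ip (j y) (j q) + lx.1 * ipQ y q = ip lx.2 (j q).
  case: lx => lam x /=; have [lam0|lam0] := ltP 0 lam; last by exists 0.
  have [||||||y hy] := @lax_milgram_sym R Q
    (fun y q => ip (j y) (j q) + lam * ipQ y q) (fun q => ip x (j q))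
    lam (K ^+ 2 + lam) (`|x| * K) lam0.
  - by move=> y z; rewrite ipC (ipC ipQ).
  - by move=> c y z u; rewrite linearP !ipPl; ring.
  - by move=> y; rewrite hilbQ lerDr ip_ge0.
  - move=> y z; apply: le_trans (ler_normD _ _) _.
    rewrite 2!mulrDl; apply: lerD; last first.
      rewrite normrM (gtr0_norm lam0) -mulrA ler_wpM2l ?(ltW lam0)//.
      exact: cauchy_schwarz.
    apply: le_trans (cauchy_schwarz hilbH _ _) _.
    rewrite (_ : _ * _ = (K * `|y|) * (K * `|z|)); last by ring.
    by rewrite ler_pM.
  - by move=> c y z; rewrite linearP ipPr.
  - move=> y; apply: le_trans (cauchy_schwarz hilbH _ _) _.
    by rewrite -mulrA ler_wpM2l.
  - by exists y.
have /choice[J hJ] := ex.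
by exists (fun lam x => J (lam, x)) => lam x q lam0; apply: (hJ (lam, x)).
Qed.

Variable J : R -> H -> Q.
Hypothesis hJ : forall lam x q, 0 < lam ->
  ip (j (J lam x)) (j q) + lam * ipQ (J lam x) q = ip x (j q).

Section fixed_parameter.
Variable lam : R.
Hypothesis lam0 : 0 < lam.

Lemma resolventB x y : J lam (x - y) = J lam x - J lam y.
Proof.
apply/eqP; rewrite -subr_eq0; apply/eqP.
have h1 q := hJ (x - y) q lam0; have h2 q := hJ x q lam0.
have h3 q := hJ y q lam0.
move: h1 h2 h3; move: (J lam (x - y)) (J lam x) (J lam y) => X Y Z h1 h2 h3.
have h q : ip (j (X - (Y - Z))) (j q) + lam * ipQ (X - (Y - Z)) q = 0.
  rewrite 2!linearB !ipBl; have := h1 q; rewrite ipBl.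
  by have := h2 q; have := h3 q; lra.
move: (X - (Y - Z)) (h (X - (Y - Z))) => d {}h.
apply: (ip_eq0 hilbQ); apply/eqP.
have := ip_ge0 hilbH (j d); have := ip_ge0 hilbQ d.
rewrite le_eqVlt => /predU1P[<-//|dd] jd.
by have := mulr_gt0 lam0 dd; lra.
Qed.

Lemma resolventC x y : ip x (j (J lam y)) = ip (j (J lam x)) y.
Proof.
rewrite (ipC ip _ y) -(hJ x _ lam0) -(hJ y _ lam0).
by rewrite ipC (ipC ipQ).
Qed.

Lemma resolvent_ge0 x : 0 <= ip x (j (J lam x)).
Proof.
by rewrite -(hJ x _ lam0) addr_ge0 ?ip_ge0// mulr_ge0 ?ip_ge0// ltW.
Qed.

Lemma resolvent_contraction x : `|j (J lam x)| <= `|x|.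
Proof.
have [->|j0] := eqVneq (j (J lam x)) 0; first by rewrite normr0.
have jp : 0 < `|j (J lam x)| by rewrite normr_gt0.
rewrite -(ler_pM2r jp) -expr2 hilbH.
apply: le_trans (le_trans (ler_norm _) (cauchy_schwarz hilbH x _)).
by rewrite -(hJ x _ lam0) lerDl mulr_ge0 ?ip_ge0// ltW.
Qed.

Lemma resolvent_form_le x : ip x (j (J lam x)) <= `|x| ^+ 2.
Proof.
apply: le_trans (le_trans (ler_norm _) (cauchy_schwarz hilbH x _)) _.
by rewrite expr2 ler_wpM2l// resolvent_contraction.
Qed.

(** The smoothing from [H] to [Q], obtained by testing with [J lam x] itself. The bound blows up as
    [lam] tends to 0, so the time mesh has to be chosen after [lam]. *)
Lemma resolvent_bounded x : `|J lam x| <= K / lam * `|x|.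
Proof.
have [->|j0] := eqVneq (J lam x) 0.
  by rewrite normr0 mulr_ge0// ltW// divr_gt0.
have jp : 0 < `|J lam x| by rewrite normr_gt0.
rewrite mulrAC ler_pdivlMr// -(ler_pM2r jp) mulrAC -expr2 mulrC hilbQ.
apply: (@le_trans _ _ (ip x (j (J lam x)))).
  by rewrite -(hJ x _ lam0) lerDr ip_ge0.
apply: le_trans (le_trans (ler_norm _) (cauchy_schwarz hilbH x _)) _.
by rewrite mulrAC (mulrC (K * _)) ler_wpM2l.
Qed.

(** A discrete chain rule: the two sides differ by the quadratic form at [x - y], which is
    nonnegative. This is convexity of the quadratic form, linearised at the later point [x]. *)
Lemma resolvent_form_sub x y :
  ip x (j (J lam x)) - ip y (j (J lam y)) <= 2 * ip (x - y) (j (J lam x)).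
Proof.
have e : ip x (j (J lam y)) = ip y (j (J lam x)) by rewrite resolventC ipC.
have := resolvent_ge0 (x - y); rewrite resolventB linearB/= !ipE e.
by lra.
Qed.

Lemma resolvent_continuous : continuous (J lam).
Proof.
move=> x; apply/cvgrPdist_lt => e e0.
have d0 : 0 < e / (K / lam) by rewrite !divr_gt0.
near=> y; rewrite -resolventB; apply: le_lt_trans (resolvent_bounded _) _.
rewrite mulrC -ltr_pdivlMr ?divr_gt0//.
Unshelve. all: by end_near. Qed.

(** Testing with [y - w] equates [lam * ipQ y (y - w)] with minus the square of [j (y - w)], so that
    [ipQ y y <= ipQ y w]. The next lemma reads the same identity as a bound for [j (y - w)]. *)
Lemma resolvent_le_norm w : `|J lam (j w)| <= `|w|.
Proof.
set y := J lam (j w).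
have [->|y0] := eqVneq y 0; first by rewrite normr0.
have yp : 0 < `|y| by rewrite normr_gt0.
have h : ip (j (y - w)) (j (y - w)) + lam * ipQ y (y - w) = 0.
  rewrite {1}linearB ipBl; have := hJ (j w) (y - w) lam0.
  by rewrite -/y; lra.
have : ipQ y (y - w) <= 0.
  by have := ip_ge0 hilbH (j (y - w)); rewrite -(pmulr_rle0 _ lam0); lra.
rewrite ipBr subr_le0 -hilbQ => h2.
rewrite -(ler_pM2l yp) -expr2; apply: le_trans h2 _.
exact: le_trans (ler_norm _) (cauchy_schwarz hilbQ _ _).
Qed.

Lemma resolvent_dist w : `|j (J lam (j w)) - j w| ^+ 2 <= 2 * `|w| ^+ 2 * lam.
Proof.
set y := J lam (j w).
have h : ip (j (y - w)) (j (y - w)) + lam * ipQ y (y - w) = 0.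
  rewrite {1}linearB ipBl; have := hJ (j w) (y - w) lam0.
  by rewrite -/y; lra.
rewrite -linearB hilbH.
have -> : ip (j (y - w)) (j (y - w)) = lam * - ipQ y (y - w) by lra.
rewrite mulrC ler_wpM2r ?(ltW lam0)//.
apply: le_trans (ler_norm _) _; rewrite normrN.
apply: le_trans (cauchy_schwarz hilbQ _ _) _.
have yw := resolvent_le_norm w; rewrite -/y in yw.
have yw' : `|y - w| <= 2 * `|w|.
  by apply: le_trans (ler_normB _ _) _; lra.
by rewrite expr2 mulrCA ler_pM.
Qed.

End fixed_parameter.

(** Subtracting the two equations, tested with [d = y - z], gives [0 <= ipQ z d]. Hence the squared
    norm of [y = z + d] exceeds that of [z] by at least the square of [d]: decreasing the parameter
    increases the norm, and the increase controls the distance. *)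
Lemma resolvent_monotone lam mu w : 0 < lam -> lam <= mu ->
  `|J mu (j w) - J lam (j w)| ^+ 2
    <= `|J lam (j w)| ^+ 2 - `|J mu (j w)| ^+ 2.
Proof.
move=> lam0; rewrite le_eqVlt => /predU1P[<-|lt].
  by rewrite !subrr normr0 expr0n.
have mu0 := lt_trans lam0 lt.
set y := J lam _; set z := J mu _; set d := y - z.
have h1 := hJ (j w) d lam0; have h2 := hJ (j w) d mu0.
rewrite -/y -/z in h1 h2.
have dd : 0 <= ip (j d) (j d) := ip_ge0 hilbH _.
have ddQ : 0 <= ipQ d d := ip_ge0 hilbQ _.
have jd : ip (j d) (j d) = ip (j y) (j d) - ip (j z) (j d).
  by rewrite /d {1}linearB ipBl.
have yE : y = z + d by rewrite addrC subrK.
have yd : ipQ y d = ipQ z d + ipQ d d by rewrite {1}yE ipDl.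
have yy : ipQ y y = ipQ z z + 2 * ipQ z d + ipQ d d.
  have ex (u v : Q) : ipQ (u + v) (u + v) = ipQ u u + 2 * ipQ u v + ipQ v v.
    by rewrite !ipE (ipC ipQ v u); ring.
  by rewrite -ex -yE.
have h3 : lam * ipQ d d <= (mu - lam) * ipQ z d.
  by move: h1; rewrite yd mulrDr mulrBl; lra.
have zd : 0 <= ipQ z d.
  rewrite -(pmulr_rge0 _ (_ : 0 < mu - lam)) ?subr_gt0//.
  by apply: le_trans h3; rewrite mulr_ge0// ltW.
by rewrite distrC -/d !hilbQ yy; lra.
Qed.

(** The norms increase and stay below that of [w], so the monotonicity estimate yields a Cauchy
    sequence in [Q]. Its limit is identified in [H] by [resolvent_dist] and pulled back by
    injectivity of [j]. *)
Lemma resolvent_cvg (jinj : injective j) w :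
  (fun n => J n.+1%:R^-1 (j w)) @ \oo --> w.
Proof.
have n0 n : 0 < (n.+1%:R^-1 : R) by rewrite invr_gt0.
pose u n := J n.+1%:R^-1 (j w).
have mono n m : (n <= m)%N -> `|u n - u m| ^+ 2 <= `|u m| ^+ 2 - `|u n| ^+ 2.
  move=> nm; apply: resolvent_monotone => //.
  by rewrite lef_pV2 ?posrE// ler_nat.
have nd : {homo (fun n => `|u n| ^+ 2) : n m / (n <= m)%N >-> n <= m}.
  move=> n m nm; rewrite -subr_ge0; apply: le_trans (mono _ _ nm).
  exact: sqr_ge0.
have ub : has_ubound (range (fun n => `|u n| ^+ 2)).
  exists (`|w| ^+ 2) => _ [n _ <-].
  by rewrite ler_pXn2r ?nnegrE//; exact: resolvent_le_norm.
have cvs := nondecreasing_cvgn nd ub.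
set S := sup _ in cvs.
have /cvg_ex[/= z uz] : cvgn u.
  apply: (@cvgn_sq _ _ _ (fun n => S - `|u n| ^+ 2)).
    by rewrite -(subrr S); apply: cvgB => //; exact: cvg_cst.
  move=> n m nm; apply: le_trans (mono _ _ nm) _.
  by rewrite lerD2r; apply: ub_le_sup => //; exists m.
suff zw : z = w by move: uz; rewrite zw.
apply/jinj/eqP; rewrite -subr_eq0 -normr_eq0 -sqrf_eq0; apply/eqP.
have juz : (fun n => `|j (u n) - j w| ^+ 2) @ \oo --> `|j z - j w| ^+ 2.
  have h : (fun n => `|j (u n) - j w|) @ \oo --> `|j z - j w|.
    apply: cvg_norm; apply: cvgB; last exact: cvg_cst.
    apply: cvg_dist0.
    apply: (@cvg_squeeze0 _ _ (fun n => K * `|u n - z|)).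
      by move=> n; rewrite normr_id -linearB.
    by rewrite -(mulr0 K); apply: cvgMr; exact: dist_cvg0.
  exact: (cvgM h h).
have ju0 : (fun n => `|j (u n) - j w| ^+ 2) @ \oo --> (0 : R).
  apply: (@cvg_squeeze0 _ _ (fun n => 2 * `|w| ^+ 2 * n.+1%:R^-1)).
    by move=> n; rewrite ger0_norm ?sqr_ge0//; exact: resolvent_dist.
  rewrite -(mulr0 (2 * `|w| ^+ 2)); apply: cvgMr; exact: cvg_harmonic.
exact: (@norm_cvg_unique _ _ _ _ _ _ juz ju0).
Qed.

End resolvent.

(** * Strong measurability and Bochner integrals *)

Section measure_preliminaries.
Context d (X : measurableType d) (R : realType).
Variable mu : {measure set X -> \bar R}.
Local Open Scope ereal_scope.

(* Unlike the library's ge0_le_integral, no measurability is assumed: this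
   relies on the definition of the integral as a supremum. *)
Lemma ge0_le_integral_sup (D : set X) (f g : X -> \bar R) :
  (forall x, D x -> 0 <= f x) -> (forall x, D x -> f x <= g x) ->
  \int[mu]_(x in D) f x <= \int[mu]_(x in D) g x.
Proof.
move=> f0 fg.
rewrite !ge0_integralE//; last by move=> x Dx; apply: le_trans (fg _ Dx); exact: f0.
apply: ereal_sup_le => _ [h /= hf <-]; exists h => // x.
apply: le_trans (hf x) _; rewrite !patchE; case: ifPn => // /set_mem.
exact: fg.
Qed.

(** [f] may fail to be measurable on the null set where [D] misses [I]. Replacing it there by [+oo],
    respectively by 0, gives measurable functions above and below it with the same integral. *)
Lemma ge0_integral_null_setD (I D : set X) (f : X -> \bar R) :
  measurable I -> measurable D -> D `<=` I -> mu (I `\` D) = 0 ->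
  (forall x, I x -> 0 <= f x) -> measurable_fun D f ->
  \int[mu]_(x in I) f x = \int[mu]_(x in D) f x.
Proof.
move=> mI mD DI ID0 f0 mf; apply/eqP; rewrite eq_le; apply/andP; split.
- pose h x := if x \in D then f x else +oo.
  have mh : measurable_fun I h.
    apply: measurable_fun_if => //.
      by apply: (measurable_fun_bool true); rewrite preimage_mem_true setIC; exact: measurableI.
    by rewrite preimage_mem_true setIC setIidl.
  have h0 x : I x -> 0 <= h x by rewrite /h; case: ifPn => // _; exact: f0.
  apply: (@le_trans _ _ (\int[mu]_(x in I) h x)).
    by apply: ge0_le_integral_sup => // x _; rewrite /h; case: ifPn => // _; rewrite leey.
  rewrite (@ge0_negligible_integral _ _ _ mu I (I `\` D))//; last exact: measurableD.
  rewrite setDD setIidr//.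
  by rewrite (eq_integral f)// => x xD; rewrite /h xD.
- rewrite -{1}(setIidr DI) integral_mkcondr; apply: ge0_le_integral_sup => x Ix.
    by rewrite patchE; case: ifPn => // _; exact: f0.
  by rewrite patchE; case: ifPn => // _; exact: f0.
Qed.

Lemma measurable_fun_cvg (D : set X) (h : nat -> X -> R) (f : X -> R) :
  (forall n, measurable_fun D (h n)) ->
  (forall x, D x -> (fun n => h n x) @ \oo --> f x) -> measurable_fun D f.
Proof.
move=> mh hf; apply/measurable_EFinP.
apply: (emeasurable_fun_cvg (fun n => EFin \o h n)) => [n|x Dx].
  exact/measurable_EFinP.
by apply: cvg_EFin; [exact: nearW|exact: hf].
Qed.

End measure_preliminaries.

Section strong_measurability.
Context {R : realType} {V : lmodType R}.
Variables (D : set (measurableTypeR R)) (S : set V) (N : V -> R).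
Hypotheses (mD : measurable D) (sS : is_subspace S).

(* Strong measurability on a set where the approximating simple functions converge
   everywhere.  As [lebesgue_measure] only measures Borel sets, hence is not
   complete, all almost everywhere hypotheses are replaced by statements that hold
   on a conull Borel subset D of ]0, T[. *)
Definition smeas (v : R -> V) := exists s : nat -> simple V,
  [/\ forall n, simple_in S (s n), forall t, D t -> S (v t)
    & forall t, D t -> (fun n => N (simple_val (s n) t - v t)) @ \oo --> (0 : R)].

Lemma simple_in_cons a (s : simple V) : simple_in S (a :: s) ->
  [/\ measurable a.1, S a.2 & simple_in S s].
Proof.
move=> h; have [? ?] := h 0%N isT; split => // i si; exact: (h i.+1).
Qed.

Lemma simple_val_cons a (s : simple V) t :
  simple_val (a :: s) t = (\1_(a.1) t : R) *: a.2 + simple_val s t.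
Proof. by rewrite /simple_val big_cons. Qed.

Lemma simple_val_in (s : simple V) t : simple_in S s -> S (simple_val s t).
Proof.
elim: s => [|a s IH] h; first by rewrite /simple_val big_nil; exact: subspace0.
have [_ Sa /IH hs] := simple_in_cons h.
by rewrite simple_val_cons; exact: sS.2.
Qed.

(** The sets of a simple function may overlap, so values add up. The offset [y] collects the vectors
    already switched on, and each set splits [D] in two. *)
Lemma measurable_fun_simple (F : R -> V -> R) (s : simple V) (y : V) :
  (forall x, S x -> measurable_fun D (F ^~ x)) -> simple_in S s -> S y ->
  measurable_fun D (fun t => F t (simple_val s t + y)).
Proof.
move=> mF; elim: s y => [|[A x] s IH] y hs Sy.
  rewrite (_ : (fun _ => _) = F ^~ y); first exact: mF.
  by apply/funext => t; rewrite /simple_val big_nil add0r.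
have [/= mA Sx {}hs] := simple_in_cons hs.
rewrite (_ : (fun _ => _) = fun t => if t \in A
    then F t (simple_val s t + (x + y)) else F t (simple_val s t + y)); last first.
  apply/funext => t; rewrite simple_val_cons/= indicE.
  by case: ifPn => _; rewrite ?scale1r ?scale0r ?add0r// -addrA addrCA.
apply: measurable_fun_if => //.
- by apply: (measurable_fun_bool true); rewrite preimage_mem_true; exact: measurableI.
- apply: (measurable_funS mD); first exact: subIsetl.
  by apply: IH => //; exact: subspaceD.
- apply: (measurable_funS mD); first exact: subIsetl.
  exact: IH.
Qed.

(** A Caratheodory criterion: measurability in time, sequential continuity in the vector. The
    dependence of [F] on time allows iterated use with several functions. *)
Lemma measurable_fun_smeas (F : R -> V -> R) (v : R -> V) :
  smeas v ->
  (forall x, S x -> measurable_fun D (F ^~ x)) ->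
  (forall t (u : nat -> V) x, D t -> (forall n, S (u n)) -> S x ->
    (fun n => N (u n - x)) @ \oo --> (0 : R) ->
    (fun n => F t (u n)) @ \oo --> F t x) ->
  measurable_fun D (fun t => F t (v t)).
Proof.
move=> [s [sS' Sv sv]] mF cF.
apply: (@measurable_fun_cvg _ _ _ _ (fun n t => F t (simple_val (s n) t))) => [n|t Dt].
  have := measurable_fun_simple mF (sS' n) (subspace0 sS).
  by under eq_fun do rewrite addr0.
apply: cF => //; last exact: sv.
- by move=> n; exact: simple_val_in.
- exact: Sv.
Qed.

End strong_measurability.

Section bochner.
Context {R : realType} {V : lmodType R}.
Local Notation mu := (@lebesgue_measure R).
Variables (T : R) (D : set (measurableTypeR R)) (S : set V) (N : V -> R).
Let I : set (measurableTypeR R) := `]0, T[.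
Hypotheses (mD : measurable D) (DI : D `<=` I) (ID0 : mu (I `\` D) = 0%E).
Hypothesis sS : is_subspace S.

Let mI : measurable I. Proof. exact: measurable_itv. Qed.

Let I_lty : (mu I < +oo)%E.
Proof. by rewrite lebesgue_measure_itv/=; case: ifP; rewrite ?ltry// -EFinB ltry. Qed.

Lemma lebesgue_subinterval_lty : (mu D < +oo)%E.
Proof.
by apply: le_lt_trans I_lty; apply: le_measure; rewrite ?inE.
Qed.

Lemma bounded_integrable (f : R -> R) (M : R) : measurable_fun D f ->
  (forall t, D t -> `|f t| <= M) -> mu.-integrable D (EFin \o f).
Proof.
move=> mf fM; apply: measurable_bounded_integrable => //.
  exact: lebesgue_subinterval_lty.
exists M; split; first exact: num_real.
by move=> x Mx t Dt; apply: le_trans (fM _ Dt) (ltW Mx).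
Qed.

Lemma ge0_integral_conull (f : R -> R) : (forall t, I t -> 0 <= f t) ->
  measurable_fun D f ->
  (\int[mu]_(t in I) (f t)%:E = \int[mu]_(t in D) (f t)%:E)%E.
Proof.
move=> f0 mf; apply: ge0_integral_null_setD => //.
exact/measurable_EFinP.
Qed.

Lemma Rintegral_indic (A : set (measurableTypeR R)) : measurable A ->
  \int[mu]_(t in D) (\1_A t : R) = fine (mu (A `&` I)).
Proof.
move=> mA; rewrite /Rintegral -ge0_integral_conull//.
  by rewrite integral_indic.
Qed.

Section linear_functional.
Variables (l : V -> R) (M : R).
Hypothesis lP : forall a x y, l (a *: x + y) = a * l x + l y.
Hypothesis lM : forall x, S x -> `|l x| <= M * N x.
Hypothesis N0 : forall x, S x -> 0 <= N x.
Hypothesis M0 : 0 < M.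

Let l0 : l 0 = 0.
Proof. by have := lP 1 0 0; rewrite scaler0 addr0 => h; lra. Qed.

Let lB x y : l (x - y) = l x - l y.
Proof. by rewrite addrC -scaleN1r lP mulN1r addrC. Qed.

Lemma integrable_simple (s : simple V) : simple_in S s ->
  mu.-integrable D (EFin \o (fun t => l (simple_val s t))) /\
  \int[mu]_(t in D) l (simple_val s t) = l (simple_int T s).
Proof.
elim: s => [|[A x] s IH] hs.
  rewrite /simple_int big_nil l0.
  have -> : (fun t => l (simple_val [::] t)) = cst 0.
    by apply/funext => t; rewrite /simple_val big_nil l0.
  split; first exact: integrable0.
  by rewrite Rintegral_cst// mul0r.
have [/= mA Sx {}hs] := simple_in_cons hs.
have [ints inte] := IH hs.
have E t : l (simple_val ((A, x) :: s) t) = l x * (\1_A t : R) + l (simple_val s t).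
  by rewrite simple_val_cons/= lP mulrC.
have iA : mu.-integrable D (EFin \o (\1_A : R -> R)).
  apply: (@bounded_integrable _ 1); first exact: measurable_funTS.
  by move=> t _; rewrite indicE; case: (_ \in _); rewrite ?normr1 ?normr0.
have iAx : mu.-integrable D (EFin \o (fun t => l x * (\1_A t : R))).
  exact: integrableZl iA.
split.
  have := integrableD mD iAx ints; apply: eq_integrable => // t _ /=.
  by rewrite E.
under eq_Rintegral do rewrite E.
rewrite RintegralD// inte RintegralZl// Rintegral_indic//.
by rewrite /simple_int big_cons/= lP mulrC.
Qed.

(** Both sides are limits of [l (simple_int T (s n))]: on one side [l] is bounded by [N] at the
    limit vector, on the other it is bounded by [N] under the integral. *)
Lemma bochner_integral_linear (v : R -> V) (x : V) :
  bochner_integral T S N v x -> measurable_fun D (l \o v) ->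
  mu.-integrable D (EFin \o (l \o v)) /\
  \int[mu]_(t in D) l (v t) = l x.
Proof.
move=> [Sx [s [[Sv sS' _] sv sx]]] mlv.
have DT t : D t -> 0 < t < T by move=> /DI; rewrite /I/= in_itv.
have Sd n t : D t -> S (simple_val (s n) t - v t).
  move=> Dt; apply: subspaceB => //; last exact/Sv/DT.
  exact: simple_val_in.
pose e n := (\int[mu]_(t in I) (N (simple_val (s n) t - v t))%:E)%E.
have e0 : e @ \oo --> 0%E by exact: sv.
have is_ n := (integrable_simple (sS' n)).1.
have ms n : measurable_fun D (fun t => l (simple_val (s n) t)).
  by apply/measurable_EFinP; exact: (measurable_int mu (is_ n)).
pose dl n t := l (simple_val (s n) t) - l (v t).
have mdl n : measurable_fun D (dl n) by exact: measurable_funB.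
(* The integrand of [e n] need not be measurable, so the comparison goes through the supremum; only
   [dl n] is known to be measurable. *)
have dle n : (\int[mu]_(t in D) (M^-1 * `|dl n t|)%:E <= e n)%E.
  rewrite -{1}(setIidr DI) integral_mkcondr; apply: ge0_le_integral_sup => t It.
    rewrite patchE; case: ifPn => // _.
    by rewrite lee_fin mulr_ge0// invr_ge0 ltW.
  have St : S (simple_val (s n) t - v t).
    apply: subspaceB => //; first exact: simple_val_in.
    by apply: Sv; move: It; rewrite /I/= in_itv.
  rewrite patchE; case: ifPn => [/set_mem Dt|_]; last by rewrite lee_fin N0.
  by rewrite lee_fin ler_pdivrMl// /dl -lB; exact: lM.
have e_ge0 n : (0 <= e n)%E.
  apply: le_trans (dle n); apply: integral_ge0 => t Dt.
  by rewrite lee_fin mulr_ge0// invr_ge0 ltW.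
(* The errors are extended reals and only finite for large [n]. One index with a finite error is
   enough to make [l \o v] integrable. *)
have [e_fin fe0] : (\forall n \near \oo, e n \is a fin_num) /\
    (fine \o e) @ \oo --> (0 : R) by apply/fine_cvgP.
have intdl n : e n \is a fin_num -> mu.-integrable D (EFin \o dl n) /\
    `|\int[mu]_(t in D) dl n t| <= M * fine (e n).
  move=> en.
  have iM : mu.-integrable D (EFin \o (fun t => M^-1 * dl n t)).
    apply/integrableP; split.
      by apply/measurable_EFinP; apply: measurable_funM.
    apply: (@le_lt_trans _ _ (\int[mu]_(t in D) (M^-1 * `|dl n t|)%:E)%E).
      rewrite le_eqVlt; apply/orP; left; apply/eqP; apply: eq_integral.
      by move=> t _ /=; rewrite normrM gtr0_norm ?invr_gt0.
    by apply: le_lt_trans (dle n) _; rewrite -ge0_fin_numE.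
  have idl : mu.-integrable D (EFin \o dl n).
    have := integrableZl mD M iM; apply: eq_integrable => // t _ /=.
    by rewrite -EFinM mulrA divff ?gt_eqF// mul1r.
  split=> //; apply: le_trans (le_normr_Rintegral mD idl) _.
  rewrite -ler_pdivrMl// -RintegralZl//; last exact: integrable_norm.
  rewrite /Rintegral fine_le//.
  rewrite ge0_fin_numE; first by apply: le_lt_trans (dle n) _; rewrite -ge0_fin_numE.
  apply: integral_ge0 => t Dt.
  by rewrite lee_fin mulr_ge0// invr_ge0 ltW.
have [n0 en0] : exists n, e n \is a fin_num.
  by case: e_fin => n _ hn; exists n; apply: hn => /=.
have ilv : mu.-integrable D (EFin \o (l \o v)).
  have := integrableB mD (is_ n0) (intdl _ en0).1.
  apply: eq_integrable => // t _ /=; rewrite /dl -EFinB; congr EFin; ring.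
split=> //.
have Ss n : S (simple_int T (s n)).
  rewrite /simple_int; elim: (s n) (sS' n) => [|a r IH] h.
    by rewrite big_nil; exact: subspace0.
  have [_ Sa /IH hs] := simple_in_cons h.
  by rewrite big_cons; exact: sS.2.
have lim1 : (fun n => l (simple_int T (s n))) @ \oo --> l x.
  apply: cvg_dist0; apply: (@cvg_squeeze0 _ _ (fun n => M * N (simple_int T (s n) - x))).
    by move=> n; rewrite normr_id -lB; apply: lM; exact: subspaceB.
  by rewrite -(mulr0 M); apply: cvgMr.
have lim2 : (fun n => l (simple_int T (s n))) @ \oo --> \int[mu]_(t in D) l (v t).
  apply/cvgrPdist_lt => eps eps0.
  have eM : 0 < eps / M by rewrite divr_gt0.
  have /cvgrPdist_lt/(_ _ eM) he := fe0.
  near=> n.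
  have en : e n \is a fin_num by near: n.
  have [_] := intdl n en.
  rewrite /dl (RintegralB mD (is_ n) ilv).
  rewrite (integrable_simple (sS' n)).2 distrC => h; apply: le_lt_trans h _.
  rewrite mulrC -ltr_pdivlMr//.
  have : `|0 - (fine \o e) n| < eps / M by near: n.
  by rewrite sub0r normrN; apply: le_lt_trans; exact: ler_norm.
exact: (@norm_cvg_unique _ _ _ _ _ _ lim2 lim1).
Unshelve. all: by end_near. Qed.

End linear_functional.

End bochner.

(** * Test functions and scalar weak derivatives *)

Section smooth.
Context {R : realType}.
Implicit Types (f g : R -> R) (t : R).

(** Shifted by one from the usual order: [Ck 0] already asks for a derivative, so [Ck n] asks for
    [n.+1] of them. *)
Fixpoint Ck n f : Prop := (forall t, derivable f t 1) /\
  (if n is n'.+1 then Ck n' (derive1 f) else True).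

Lemma CkS n f : Ck n.+1 f -> Ck n f.
Proof.
elim: n f => [|n IH] f [df Cf]; first by split; [exact: df|exact: I].
by split; [exact: df|exact: IH].
Qed.

Lemma Ck_derivable n f : Ck n f -> forall t, derivable f t 1.
Proof. by case: n => [|n] []. Qed.

Lemma Ck_derive1n f : (forall n, Ck n f) ->
  forall n t, derivable (derive1n n f) t 1.
Proof.
move=> Cf n; elim: n f {Cf}(Cf n) => [|n IH] f [df Cf] t; first exact: df.
by rewrite /derive1n iterSr; exact: IH.
Qed.

Lemma derive1_eq f g : (forall t : R, is_derive t 1 f (g t)) -> derive1 f = g.
Proof.
by move=> h; apply/funext => t; rewrite derive1E; apply: derive_val; exact: h.
Qed.

Lemma is_derive_derive1 f (t : R) : derivable f t 1 -> is_derive t 1 f (derive1 f t).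
Proof. by move=> df; rewrite derive1E; exact: derivableP. Qed.

Lemma Ck_is_derive n f g : (forall t : R, is_derive t 1 f (g t)) -> Ck n g ->
  Ck n.+1 f.
Proof.
move=> h Cg; split; last by rewrite (derive1_eq h).
by move=> t; have [] := h t.
Qed.

Lemma Ck_add n f g : Ck n f -> Ck n g -> Ck n (f \+ g).
Proof.
elim: n f g => [|n IH] f g [df Cf] [dg Cg].
  by split; [move=> t; exact: derivableD|exact: I].
apply: (@Ck_is_derive _ _ (derive1 f \+ derive1 g)); last exact: IH.
by move=> t; apply: is_deriveD; exact: is_derive_derive1.
Qed.

Lemma Ck_mul n f g : Ck n f -> Ck n g -> Ck n (f \* g).
Proof.
elim: n f g => [|n IH] f g Cf Cg.
  case: Cf Cg => [df _] [dg _].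
  by split; [move=> t; exact: derivableM|exact: I].
have [[df Cf'] [dg Cg']] := (Cf, Cg).
apply: (@Ck_is_derive _ _ ((f \* derive1 g) \+ (g \* derive1 f))); last first.
  by apply: Ck_add; apply: IH; [exact: CkS Cf|exact: Cg'|exact: CkS Cg|exact: Cf'].
by move=> t; apply: is_deriveM; exact: is_derive_derive1.
Qed.

Lemma Ck_cst n (c : R) : Ck n (cst c).
Proof.
elim: n c => [|n IH] c; first by split; [move=> t; exact: derivable_cst|exact: I].
by apply: (@Ck_is_derive _ _ (cst 0)) (IH 0) => t; exact: is_derive_cst.
Qed.

Lemma Ck_opp n f : Ck n f -> Ck n (fun t => - f t).
Proof.
move=> Cf; have := Ck_mul (Ck_cst n (- 1)) Cf; congr Ck.
by apply/funext => t /=; rewrite mulN1r.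
Qed.

Lemma Ck_inv n f : (forall t, f t != 0) -> Ck n f -> Ck n (fun t => (f t)^-1).
Proof.
move=> f0; elim: n => [|n IH] Cf.
  by case: Cf => df _; split; [move=> t; exact: derivableV|exact: I].
have [df Cf'] := Cf.
have Ci := IH (CkS Cf).
apply: (@Ck_is_derive _ _ (fun t => - ((f t)^-1 * (f t)^-1 * derive1 f t))).
  move=> t; have h := is_deriveV (f0 t) (is_derive_derive1 (df t)).
  by apply: (is_derive_eq h); rewrite /GRing.scale/= mulNr expr2 invfM.
exact/Ck_opp/Ck_mul/Cf'/Ck_mul.
Qed.

Lemma Ck_affine n (a c : R) f : Ck n f -> Ck n (fun t => f (a * t + c)).
Proof.
have da (t : R) : is_derive t 1 (fun t => a * t + c) a.
  have h := is_deriveD (is_deriveZ a (is_derive_id t 1)) (is_derive_cst c t 1).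
  by apply: (is_derive_eq h); rewrite addr0 /GRing.scale/= mulr1.
have dfa g (t : R) : derivable g (a * t + c) 1 ->
    is_derive t 1 (fun t => g (a * t + c)) (derive1 g (a * t + c) * a).
  by move=> dg; apply: is_derive1_comp; exact: is_derive_derive1.
elim: n f => [|n IH] f [df Cf].
  by split; [move=> t; have [] := dfa f t (df _)|exact: I].
have H := Ck_mul (IH _ Cf) (Ck_cst n a).
by refine (Ck_is_derive _ H) => t; exact: dfa.
Qed.

(** For [p = 1] this is the classical flat function exp(-1/x). The polynomial factor in 1/x makes
    the family stable under differentiation, so smoothness is a single induction over all [p]. *)
Definition flat (p : {poly R}) (x : R) : R :=
  if 0 < x then p.[x^-1] * expR (- x^-1) else 0.

Lemma poly_expR_bounded (p : {poly R}) : exists2 C : R, 0 < C &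
  forall y : R, 0 <= y -> `|p.[y] * expR (- y)| <= C.
Proof.
have mono n (y : R) : 0 <= y -> y ^+ n * expR (- y) <= n`!%:R.
  move=> y0; rewrite expRN ler_pdivrMr ?expR_gt0// mulrC -ler_pdivrMr ?ltr0n ?fact_gt0//.
  case: n => [|n]; first by rewrite fact0 expr0 divr1; have := expR_ge1Dx y; lra.
  by apply: le_trans (expR_ge1Dxn n y0); rewrite lerDr.
exists (\sum_(i < size p) `|p`_i| * i`!%:R + 1).
  by rewrite ltr_wpDl// sumr_ge0// => i _; rewrite mulr_ge0.
move=> y y0; rewrite horner_coef mulr_suml.
apply: le_trans (ler_norm_sum _ _ _) _.
rewrite -[leLHS]addr0 lerD//; apply: ler_sum => i _.
rewrite -mulrA normrM ler_wpM2l// ger0_norm ?mono//.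
by rewrite mulr_ge0 ?exprn_ge0 ?expR_ge0.
Qed.

Lemma is_derive_flat p (t : R) : is_derive t 1 (flat p) (flat ('X^2 * (p - p^`())) t).
Proof.
have [t0|t0|->] := ltgtP t 0.
- rewrite {2}/flat ltNge (ltW t0)/=.
  apply: (@near_eq_is_derive _ _ _ (cst 0)).
  near=> x; rewrite /flat ltNge (_ : x <= 0 = true)//.
  by apply/ltW; near: x; exact: lt_nbhsl.
- rewrite {2}/flat t0.
  have tn0 : t != 0 by rewrite gt_eqF.
  have dV : is_derive t 1 (fun x : R => x^-1) (- t ^- 2).
    have h := is_deriveV tn0 (is_derive_id t 1).
    by apply: (is_derive_eq h); rewrite /GRing.scale/= mulr1.
  have dp : is_derive t 1 (fun x => p.[x^-1]) (p^`().[t^-1] * - t ^- 2).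
    exact: (@is_derive1_comp _ (fun y => p.[y]) _ t _ _ (is_derive_poly p _) dV).
  have de : is_derive t 1 (fun x => expR (- x^-1)) (expR (- t^-1) * t ^- 2).
    have dN := is_deriveN dV; rewrite opprK in dN.
    exact: (@is_derive1_comp _ expR _ t _ _ (is_derive_expR _) dN).
  have H := is_deriveM dp de.
  refine (near_eq_is_derive _ (is_derive_eq H _)).
    near=> x; rewrite /flat (_ : 0 < x = true)//.
    by near: x; exact: lt_nbhsr.
  rewrite /GRing.scale/= hornerM hornerD hornerN hornerXn exprVn.
  by ring.
- rewrite {2}/flat ltxx.
  (* Of the two factors 1/h from ['X^2], one is the denominator of the difference quotient, the
     other leaves a factor [h] that sends the quotient to 0. *)
  have [C C0 hC] := poly_expR_bounded ('X^2 * p).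
  have key (h : R) : `|h^-1 * flat p h| <= C * `|h|.
    rewrite /flat; case: ifPn => h0; last by rewrite mulr0 normr0 mulr_ge0// ltW.
    have hi0 : 0 <= h^-1 by rewrite invr_ge0 ltW.
    have := hC h^-1 hi0; rewrite hornerM hornerXn => hh.
    rewrite (gtr0_norm h0) -ler_pdivrMr//; apply: le_trans hh.
    by rewrite !normrM ?normrX (ger0_norm hi0) le_eqVlt; apply/orP; left; apply/eqP; ring.
  have lim0 : (fun h : R => h^-1 *: ((flat p \o shift 0) (h *: 1) - flat p 0))
      @ 0^' --> (0 : R).
    apply/norm_cvg0P; apply/cvgrPdist_lt => e e0.
    near=> h; rewrite sub0r normrN normr_id.
    have -> : (flat p \o shift 0) (h *: 1) - flat p 0 = flat p h.
      by rewrite /= /flat ltxx subr0 addr0 /GRing.scale/= mulr1.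
    apply: le_lt_trans (key h) _; rewrite mulrC -ltr_pdivlMr//.
    by near: h; apply: dnbhs0_lt; rewrite divr_gt0.
  split; first by apply/cvg_ex; exists 0.
  by rewrite /derive; apply: cvg_lim => //.
Unshelve. all: by end_near. Qed.

Lemma Ck_flat n p : Ck n (flat p).
Proof.
elim: n p => [|n IH] p.
  by split; [move=> t; have [] := is_derive_flat p t|exact: I].
by apply: Ck_is_derive (IH _); exact: is_derive_flat.
Qed.

Let den t : R := flat 1 t + flat 1 (-1 * t + 1).

Let flat1_gt0 t : 0 < t -> 0 < flat 1 t.
Proof. by move=> t0; rewrite /flat t0 hornerC mul1r expR_gt0. Qed.

Let flat1_eq0 t : t <= 0 -> flat 1 t = 0.
Proof. by rewrite /flat leNgt => /negbTE ->. Qed.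

Let flat1_ge0 t : 0 <= flat 1 t.
Proof. by rewrite /flat; case: ifPn => // _; rewrite hornerC mul1r expR_ge0. Qed.

Let den_gt0 t : 0 < den t.
Proof.
have [t0|t0] := ltP 0 t; first by rewrite ltr_pwDl// flat1_gt0.
by rewrite ltr_wpDl// flat1_gt0//; lra.
Qed.

(* The classical smooth transition f(t) / (f(t) + f(1 - t)) with f(t) = exp(-1/t). *)
Definition step t : R := flat 1 t * (den t)^-1.

Lemma Ck_step n : Ck n step.
Proof.
apply: Ck_mul; first exact: Ck_flat.
apply: Ck_inv; first by move=> t; rewrite gt_eqF.
by apply: Ck_add; [|apply: Ck_affine]; exact: Ck_flat.
Qed.

Lemma step_le0 t : t <= 0 -> step t = 0.
Proof. by move=> t0; rewrite /step flat1_eq0// mul0r. Qed.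

Lemma step_ge1 t : 1 <= t -> step t = 1.
Proof.
move=> t1; rewrite /step /den (@flat1_eq0 (-1 * t + 1)); last lra.
by rewrite addr0 divff// gt_eqF// flat1_gt0//; lra.
Qed.

Lemma step_bounds t : 0 <= step t <= 1.
Proof.
apply/andP; split; first by rewrite mulr_ge0// invr_ge0 ltW.
by rewrite ler_pdivrMr// mul1r /den lerDl.
Qed.

Lemma derivable_step t : derivable step t 1.
Proof. exact: (Ck_derivable (Ck_step 0)). Qed.

Lemma derive1_step_continuous : continuous (derive1 step).
Proof.
move=> t; apply: differentiable_continuous; apply/derivable1_diffP.
by have [_ [C0 _]] := Ck_step 1; exact: C0.
Qed.

Lemma derive1_step_eq0 t : t < 0 \/ 1 < t -> derive1 step t = 0.
Proof.
move=> h; rewrite derive1E.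
have [c hc] : exists c, \forall x \near t, cst c x = step x.
  case: h => ht.
    exists 0; near=> x; rewrite step_le0//; apply/ltW.
    by near: x; exact: lt_nbhsl.
  exists 1; near=> x; rewrite step_ge1//; apply/ltW.
  by near: x; exact: lt_nbhsr.
by rewrite -(near_eq_derive _ hc) derive_cst.
Unshelve. all: by end_near. Qed.

Lemma derive1_step_bounded : exists2 K : R, 0 < K & forall t, `|derive1 step t| <= K.
Proof.
have [|c _ hc] := @EVT_max R (fun t => `|derive1 step t|) 0 1 ler01.
  apply: continuous_subspaceT => t.
  by apply: cvg_norm; exact: derive1_step_continuous.
exists (`|derive1 step c| + 1); first by rewrite ltr_wpDl.
move=> t; have [t0|t0] := ltP t 0.
  by rewrite derive1_step_eq0 ?normr0; [rewrite addr_ge0|left].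
have [t1|t1] := ltP 1 t.
  by rewrite derive1_step_eq0 ?normr0; [rewrite addr_ge0|right].
apply: (@le_trans _ _ `|derive1 step c|); last by rewrite lerDl.
by apply: hc; rewrite in_itv/= t0 t1.
Qed.

End smooth.

(** * Dominated convergence, approximate identities and Lebesgue points *)

Section dominated.
Context d (X : measurableType d) (R : realType).
Variable mu : {measure set X -> \bar R}.

Lemma dominated_Rintegral (D : set X) (h : nat -> X -> R) (f g : X -> R) :
  measurable D -> (forall n, measurable_fun D (h n)) ->
  (forall x, D x -> (fun n => h n x) @ \oo --> f x) ->
  mu.-integrable D (EFin \o g) ->
  (forall n x, D x -> `|h n x| <= g x) ->
  mu.-integrable D (EFin \o f) /\
  (fun n => \int[mu]_(x in D) h n x) @ \oo --> \int[mu]_(x in D) f x.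
Proof.
move=> mD mh hf ig hg.
have mf := measurable_fun_cvg mh hf.
have [] := @dominated_convergence _ _ _ mu D mD (fun n => EFin \o h n)
  (EFin \o f) (EFin \o g).
- by move=> n; exact/measurable_EFinP.
- exact/measurable_EFinP.
- by apply: aeW => x Dx; apply: cvg_EFin; [exact: nearW|exact: hf].
- exact: ig.
- by apply: aeW => x n Dx; rewrite lee_fin; exact: hg.
move=> if_ _ cv; split => //.
apply: fine_cvg; rewrite /Rintegral fineK; first exact: cv.
exact: integrable_fin_num.
Qed.

End dominated.

Section approximate_identity.
Context {R : realType}.
Local Notation mu := (@lebesgue_measure R).

(** Rises from 0 to 1 across [[s, s + e]]; the argument is kept in the affine form of [Ck_affine].
    As [e] tends to 0, the derivative [dramp s e] concentrates to the right of [s]. *)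
Definition ramp (s e t : R) : R := step (e^-1 * t + - (e^-1 * s)).

Definition dramp (s e t : R) : R := derive1 step (e^-1 * t + - (e^-1 * s)) * e^-1.

Lemma is_derive_ramp (s e t : R) : is_derive t 1 (ramp s e) (dramp s e t).
Proof.
have h := is_deriveD (is_deriveZ e^-1 (is_derive_id t 1))
  (is_derive_cst (- (e^-1 * s)) t 1).
have h' : is_derive t 1 (fun t => e^-1 * t + - (e^-1 * s)) e^-1.
  by apply: (is_derive_eq h); rewrite addr0 /GRing.scale/= mulr1.
have hs := is_derive_derive1 (@derivable_step R (e^-1 * t + - (e^-1 * s))).
exact: (@is_derive1_comp _ step _ t _ _ hs h').
Qed.

Lemma dramp_continuous s e : continuous (dramp s e).
Proof.
move=> t; apply: cvgMl.
apply: (@continuous_comp _ _ _ (fun t => e^-1 * t + - (e^-1 * s)) (derive1 step)).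
  by apply: cvgD; [apply: cvgMr; exact: cvg_id|exact: cvg_cst].
exact: derive1_step_continuous.
Qed.

(** [dramp s e] has integral 1 over [[s, s + e]] and is bounded by [K / e]. The error is thus at
    most [K / e] times the integral of the deviation from the value at [s], which is at most [4 * K]
    times its mean over the ball of radius [2 * e], of length [4 * e]. At a Lebesgue point this mean
    tends to 0. *)
Lemma approximate_identity (D : set (measurableTypeR R)) (f : R -> R) (s : R) :
  measurable D -> mu.-integrable D (EFin \o f) -> lebesgue_pt (f \_ D) s ->
  forall eta : R, 0 < eta -> exists2 del : R, 0 < del &
    forall e : R, 0 < e -> e < del ->
    mu.-integrable D (EFin \o (fun t => dramp s e t * f t)) /\
    `|\int[mu]_(t in D) (dramp s e t * f t) - (f \_ D) s| < eta.
Proof.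
move=> mD if_; pose A := f \_ D; rewrite -/A => LA eta eta0.
have iA : mu.-integrable setT (EFin \o A).
  rewrite /A -restrict_EFin; exact: ((integrable_mkcond _ mD).1 if_).
have [K K0 hK] := @derive1_step_bounded R.
have eK : 0 < eta / (4 * K + 1) by rewrite divr_gt0// ltr_wpDl// mulr_ge0// ltW.
have hd : \forall r \near (0%R:R)^'+, (davg A s r < (eta / (4 * K + 1))%:E)%E.
  have /fine_cvgP[hfin /cvgrPdist_lt/(_ _ eK) hlt] := LA.
  near=> r.
  have fin : davg A s r \is a fin_num by near: r.
  have : `|0 - (fine \o davg A s) r| < eta / (4 * K + 1) by near: r; exact: hlt.
  rewrite sub0r normrN/= => h; rewrite -(fineK fin) lte_fin.
  exact: le_lt_trans (ler_norm _) h.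
have [del /= del0 hdel] := hd.
(* Halved because the mean is taken over the radius [2 * e]. *)
exists (del / 2); first by rewrite divr_gt0.
move=> e e0 edel.
have e20 : 0 < 2 * e by rewrite mulr_gt0.
have hav : (davg A s (2 * e) < (eta / (4 * K + 1))%:E)%E.
  apply: hdel => //=; rewrite sub0r normrN gtr0_norm//.
  by rewrite mulrC -ltr_pdivlMr.
pose b : set (measurableTypeR R) := [set` `[s, s + e]].
have mb : measurable b by exact: measurable_itv.
have ses : s < s + e by rewrite ltrDl.
have dramp0 t : ~ b t -> dramp s e t = 0.
  move=> /negP; rewrite in_itv/= negb_and -!ltNge => h.
  rewrite /dramp derive1_step_eq0 ?mul0r// -mulrBr.
  case/orP: h => h; [left|right].
    by rewrite pmulr_rlt0 ?invr_gt0// subr_lt0.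
  by rewrite mulrC ltr_pdivlMr// mul1r ltrBrDl.
have drampK t : `|dramp s e t| <= K / e.
  by rewrite normrM (gtr0_norm (_ : 0 < e^-1)) ?invr_gt0// ler_pM2r ?invr_gt0.
have mdr : measurable_fun setT (dramp s e).
  by apply: continuous_measurable_fun; exact: dramp_continuous.
have b_lty : (mu b < +oo)%E.
  by rewrite lebesgue_measure_itv/= lte_fin ses -EFinB ltry.
have ib (h : R -> R) (M : R) : measurable_fun b h -> (forall t, b t -> `|h t| <= M) ->
    mu.-integrable b (EFin \o h).
  move=> mh hM; apply: measurable_bounded_integrable => //.
  exists M; split; first exact: num_real.
  by move=> x Mx t Dt; apply: le_trans (hM _ Dt) (ltW Mx).
have idr : mu.-integrable b (EFin \o dramp s e).
  by apply: (ib _ (K / e)) => //; exact: measurable_funTS.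
have int1 : \int[mu]_(t in b) dramp s e t = 1.
  rewrite /Rintegral (@continuous_FTC2 _ _ (ramp s e))//.
  - rewrite /ramp -!mulrBr subrr mulr0 (step_le0 (lexx 0)) addrAC subrr add0r.
    by rewrite mulVf ?gt_eqF// step_ge1//= subr0.
  - by apply: continuous_subspaceT; exact: dramp_continuous.
  - have cr : continuous (ramp s e).
      move=> t; apply: differentiable_continuous; apply/derivable1_diffP.
      by have [] := is_derive_ramp s e t.
    split.
    + by move=> t _; have [] := is_derive_ramp s e t.
    + exact/cvg_at_right_filter/cr.
    + exact/cvg_at_left_filter/cr.
  - by move=> t _; rewrite derive1E; apply: derive_val; exact: is_derive_ramp.
have imA := measurable_int mu iA.
have mA : measurable_fun setT A by exact/measurable_EFinP.
have iAb : mu.-integrable b (EFin \o A).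
  by apply: integrableS iA => //.
have imul (h : R -> R) : measurable_fun b h -> mu.-integrable b (EFin \o h) ->
    mu.-integrable b (EFin \o (fun t => dramp s e t * h t)).
  move=> mh ih.
  have i2 : mu.-integrable b (EFin \o (fun t => K / e * `|h t|)).
    exact: (integrableZl mb (K / e) (integrable_norm ih)).
  apply: (le_integrable mb _ _ i2).
    apply/measurable_EFinP; apply: measurable_funM => //; exact: measurable_funTS.
  move=> t _ /=; rewrite lee_fin normrM [leRHS]ger0_norm; last first.
    by rewrite mulr_ge0// divr_ge0// ltW.
  by rewrite ler_wpM2r.
have mAb : measurable_fun b A by exact: measurable_funTS.
have iprod := imul A mAb iAb.
have offb t : ~ b t -> dramp s e t * A t = 0 by move=> /dramp0 ->; rewrite mul0r.
have Eb : (fun t => dramp s e t * f t) \_ D = (fun t => dramp s e t * A t) \_ b.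
  apply/funext => t; rewrite !patchE /A patchE.
  case: ifPn => tD; case: ifPn => // /negP tb.
    have /dramp0 -> : ~ b t by move=> bt; apply: tb; rewrite inE.
    by rewrite mul0r.
  by rewrite mulr0.
split.
  apply/(integrable_mkcond _ mD).
  rewrite [X in _.-integrable _ X](_ : _ = EFin \o ((fun t => dramp s e t * A t) \_ b)).
    rewrite -restrict_EFin; apply: (integrable_mkcond _ mb).1.
    exact: iprod.
  by rewrite -Eb -restrict_EFin.
rewrite Rintegral_mkcond Eb -Rintegral_mkcond.
have icst : mu.-integrable b (EFin \o cst (A s)) by exact: (ib _ `|A s|).
have icd : mu.-integrable b (EFin \o (fun t => dramp s e t * cst (A s) t)).
  by apply: imul => //.
pose dA t := A t - A s.
have idA : mu.-integrable b (EFin \o dA).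
  have := integrableB mb iAb icst; exact: eq_integrable.
have mdA : measurable_fun b dA by apply: measurable_funB.
have idd := imul dA mdA idA.
have -> : \int[mu]_(t in b) (dramp s e t * A t) - A s =
    \int[mu]_(t in b) (dramp s e t * dA t).
  rewrite -{1}[A s]mul1r -int1 -RintegralZr//.
  by rewrite -(RintegralB mb iprod icd); apply: eq_Rintegral => t _; rewrite /dA mulrBr.
apply: le_lt_trans (le_normr_Rintegral mb idd) _.
have h1 : \int[mu]_(t in b) `|dramp s e t * dA t| <=
    K / e * \int[mu]_(t in b) `|dA t|.
  rewrite -RintegralZl//; last exact: integrable_norm.
  apply: le_Rintegral => //; first exact: integrable_norm.
    exact: (integrableZl mb (K / e) (integrable_norm idA)).
  by move=> t _; rewrite normrM ler_wpM2r.
apply: le_lt_trans h1 _.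
have h2 : ((\int[mu]_(t in b) `|dA t|)%:E <= (4 * e)%:E * davg A s (2 * e))%E.
  rewrite /davg /iavg. rewrite (lebesgue_measure_ball _ (ltW e20)) inver.
  rewrite muleA ifF; last by rewrite mulrn_eq0/= gt_eqF.
  rewrite -EFinM (_ : 4 * e * _ = 1) ?mul1e; last first.
    by rewrite -mulr_natr; field; rewrite gt_eqF.
  rewrite fineK; last exact: integrable_fin_num (integrable_norm idA).
  rewrite -{1}(_ : ball s (2 * e) `&` b = b); last first.
    apply/setIidr => t; rewrite ball_itv /b /= in_itv/= => /andP[st te].
    rewrite in_itv/= (lt_le_trans _ st) ?gtrBl// (le_lt_trans te)// ltrD2l.
    by rewrite ltr_pMl// ltr1n.
  rewrite integral_mkcondr; apply: ge0_le_integral_sup => t _.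
    by rewrite patchE; case: ifPn.
  by rewrite patchE; case: ifPn => _; [exact: lexx|exact: (abse_ge0 _)].
have dfin : davg A s (2 * e) \is a fin_num.
  by rewrite ge0_fin_numE ?davg_ge0//; apply: lt_trans hav _; rewrite ltry.
move: h2 hav; rewrite -(fineK dfin) -EFinM lee_fin lte_fin => h2 hav.
apply: (@le_lt_trans _ _ (K / e * (4 * e * fine (davg A s (2 * e))))).
  by rewrite ler_wpM2l// divr_ge0// ltW.
have -> : K / e * (4 * e * fine (davg A s (2 * e))) = 4 * K * fine (davg A s (2 * e)).
  by field; rewrite gt_eqF.
apply: (@le_lt_trans _ _ (4 * K * (eta / (4 * K + 1)))).
  by rewrite ler_wpM2l ?ltW// mulr_gt0.
rewrite mulrA ltr_pdivrMr; first by rewrite mulrC ltr_pM2l//; lra.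
by rewrite ltr_wpDl// mulr_ge0// ltW.
Unshelve. all: by end_near. Qed.

End approximate_identity.

(** * Primitives and plateau test functions *)

Section primitive.
Context {R : realType}.
Local Notation mu := (@lebesgue_measure R).
Variable (D : set (measurableTypeR R)).
Hypothesis mD : measurable D.

Definition primitive (f : R -> R) (t : R) : R :=
  \int[mu]_(x in D `&` [set` `[0, t]]) f x.

Lemma primitiveB (f : R -> R) (s t : R) : mu.-integrable D (EFin \o f) ->
  0 <= s -> s <= t ->
  primitive f t - primitive f s = \int[mu]_(x in D `&` [set` `]s, t]]) f x.
Proof.
move=> if_ s0 st; rewrite /primitive.
have -> : [set` `[0, t]] = [set` `[0, s]] `|` [set` `]s, t]] :> set R.
  by rewrite -itv_bndbnd_setU// bnd_simp.
rewrite setIUr Rintegral_setU.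
- by rewrite addrAC subrr add0r.
- by apply: measurableI => //; exact: measurable_itv.
- by apply: measurableI => //; exact: measurable_itv.
- rewrite -setIUr; apply: integrableS if_ => //.
  by apply: measurableI => //; apply: measurableU; exact: measurable_itv.
- apply/disj_setPS => y [[_ /=]]; rewrite in_itv/= => /andP[_ ys] [_ /=].
  by rewrite in_itv/= => /andP[]; rewrite ltNge ys.
Qed.

Lemma primitive_continuous (f : R -> R) (T : R) : 0 <= T ->
  mu.-integrable D (EFin \o f) -> {within `[0, T], continuous (primitive f)}.
Proof.
move=> T0 if_.
have -> : primitive f = fun t => parameterized_integral mu 0 t (f \_ D).
  by apply/funext => t; rewrite /primitive /parameterized_integral Rintegral_mkcondl.
apply: parameterized_integral_continuous => //.
have := (integrable_mkcond _ mD).1 if_; rewrite restrict_EFin.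
by apply: integrableS => //; exact: measurable_itv.
Qed.

End primitive.

Section test_functions.
Context {R : realType}.

Lemma is_derive_plateau (s t e x : R) :
  is_derive x 1 (fun y => ramp s e y - ramp t e y) (dramp s e x - dramp t e x).
Proof. by apply: is_deriveB; exact: is_derive_ramp. Qed.

Lemma ramp_le (s e t : R) : 0 < e -> t <= s -> ramp s e t = 0.
Proof.
move=> e0 ts; rewrite /ramp -mulrBr step_le0//.
by rewrite pmulr_rle0 ?invr_gt0// subr_le0.
Qed.

Lemma ramp_ge (s e t : R) : 0 < e -> s + e <= t -> ramp s e t = 1.
Proof.
move=> e0 ts; rewrite /ramp -mulrBr step_ge1//.
by rewrite mulrC ler_pdivlMr// mul1r lerBrDl.
Qed.

Lemma ramp_bounds (s e t : R) : 0 <= ramp s e t <= 1.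
Proof. exact: step_bounds. Qed.

Lemma plateau_test_function (s t e T : R) : 0 < e -> 0 < s -> s <= t ->
  t + e < T -> test_function T (fun x => ramp s e x - ramp t e x).
Proof.
move=> e0 s0 st teT.
have sub : closure [set x | ramp s e x - ramp t e x != 0] `<=` [set` `[s, t + e]].
  rewrite [X in _ `<=` X](_ : _ = closure [set` `[s, t + e]]); last first.
    by apply/closure_id; exact: itv_closed.
  apply: closureS => x /=; apply: contra_neqT.
  rewrite in_itv/= negb_and -!ltNge => /orP[xs|xt].
    by rewrite !ramp_le ?subrr//; [exact: ltW (lt_le_trans xs st)|exact: ltW].
  rewrite !ramp_ge ?subrr//; first exact: ltW.
  by apply: le_trans (ltW xt); rewrite lerD2r.
split.
- apply: Ck_derive1n => n; apply: Ck_add; last apply: Ck_opp.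
    by apply: Ck_affine; exact: Ck_step.
  by apply: Ck_affine; exact: Ck_step.
- apply: (subclosed_compact (@closed_closure _ _) (@segment_compact _ s (t + e))).
  exact: sub.
- apply: subset_trans sub _ => x /=; rewrite !in_itv/= => /andP[sx xt].
  by rewrite (lt_le_trans s0 sx) (le_lt_trans xt teT).
Qed.

End test_functions.

(** * Scalar functions with an integrable weak derivative *)

Section weak_derivative_scalar.
Context {R : realType}.
Local Notation mu := (@lebesgue_measure R).
Variables (T : R) (D : set (measurableTypeR R)).
Hypotheses (mD : measurable D) (DI : forall t, D t -> 0 < t < T).
Variables (f g : R -> R).
Hypothesis intf : mu.-integrable D (EFin \o f).
Hypothesis intg : mu.-integrable D (EFin \o g).
Hypothesis weakfg : forall phi, test_function T phi ->
  \int[mu]_(t in D) (derive1 phi t * f t) = - \int[mu]_(t in D) (phi t * g t).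

(** Plateaus with shrinking ramps are test functions: against [f], their derivatives yield
    [f s - f t] in the limit because [s] and [t] are Lebesgue points; against [g], the plateaus tend
    to the indicator of []s, t]]. *)
Lemma weak_derivative_lebesgue_pt (s t : R) : D s -> D t -> s <= t ->
  lebesgue_pt (f \_ D) s -> lebesgue_pt (f \_ D) t ->
  f t - f s = primitive D g t - primitive D g s.
Proof.
move=> Ds Dt st Ls Lt.
have [[s0 sT] [t0 tT]] := (andP (DI Ds), andP (DI Dt)).
rewrite (primitiveB mD intg (ltW s0) st).
(* The factor 1/2 keeps the descending ramp strictly inside the interval, even for [n = 0]. *)
pose e n : R := (T - t) / 2 * n.+1%:R^-1.
have Tt : 0 < T - t by rewrite subr_gt0.
have e0 n : 0 < e n by rewrite !mulr_gt0// invr_gt0.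
have ele n : e n < T - t.
  rewrite /e -[ltRHS]mulr1 -mulrA ltr_pM2l//.
  have aux (z : R) : z <= 1 -> 2^-1 * z < 1 by lra.
  by apply: aux; rewrite invf_le1// ler1n.
have ecvg : e @ \oo --> (0 : R).
  by rewrite -(mulr0 ((T - t) / 2)); apply: cvgMr; exact: cvg_harmonic.
have test n := @plateau_test_function R s t (e n) T (e0 n) s0 st.
have small (del : R) : 0 < del -> \forall n \near \oo, e n < del.
  move=> del0; have /cvgrPdist_lt/(_ _ del0) := ecvg; apply: filterS => n.
  by rewrite sub0r normrN; apply: le_lt_trans; exact: ler_norm.
have fD x : D x -> (f \_ D) x = f x by move=> Dx; rewrite patchE mem_set.
have lim_at x : D x -> lebesgue_pt (f \_ D) x ->
    (\forall n \near \oo, mu.-integrable D (EFin \o (fun y => dramp x (e n) y * f y))) /\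
    (fun n => \int[mu]_(y in D) (dramp x (e n) y * f y)) @ \oo --> f x.
  move=> Dx Lx; split.
    have [del del0 hdel] := approximate_identity mD intf Lx ltr01.
    by have := small _ del0; apply: filterS => n en; exact: (hdel _ (e0 n) en).1.
  apply/cvgrPdist_lt => eta eta0.
  have [del del0 hdel] := approximate_identity mD intf Lx eta0.
  have := small _ del0; apply: filterS => n en.
  by rewrite distrC -fD//; exact: (hdel _ (e0 n) en).2.
have [is_ cs] := lim_at s Ds Ls.
have [it_ ct] := lim_at t Dt Lt.
pose phi n x := ramp s (e n) x - ramp t (e n) x.
have cphi n : continuous (phi n).
  move=> x; apply: differentiable_continuous; apply/derivable1_diffP.
  by have [] := is_derive_plateau s t (e n) x.
have mg : measurable_fun D g by apply/measurable_EFinP; exact: measurable_int intg.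
have [|||_ cg] := @dominated_Rintegral _ _ _ mu D (fun n x => phi n x * g x)
  (fun x => \1_([set` `]s, t]]) x * g x) (fun x => `|g x|) mD _ _ (integrable_norm intg) _.
  move=> n; apply: measurable_funM; last exact: mg.
  by apply: measurable_funTS; apply: continuous_measurable_fun; exact: cphi.
  move=> x Dx; suff h : (fun n => phi n x) @ \oo --> (\1_([set` `]s, t]]) x : R).
    exact: cvgM h (cvg_cst _).
  (* At each point the plateaus are eventually constant. Ramps start at their first parameter, so
     the value is 0 at [s] and 1 at [t] when [s < t]: this decides the half-open interval. *)
  apply: cvg_near_cst.
  have [xs|sx] := leP x s.
    apply: nearW => n; rewrite /phi !ramp_le ?subrr//; last exact: le_trans xs st.
    by rewrite indicE memNset//= in_itv/= ltNge xs.
  have := small (x - s); rewrite subr_gt0 => /(_ sx).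
  have [xt|tx] := leP x t.
    apply: filterS => n en; rewrite /phi ramp_ge//; last lra.
    by rewrite ramp_le// subr0 indicE mem_set//= in_itv/= sx.
  have := small (x - t); rewrite subr_gt0 => /(_ tx).
  apply: filterS2 => n en1 en2.
  rewrite /phi ramp_ge//; last lra.
  rewrite ramp_ge//; last lra.
  by rewrite subrr indicE memNset//= in_itv/= sx/= leNgt tx.
  move=> n x Dx; rewrite normrM -[leRHS]mul1r ler_wpM2r//.
  have := ramp_bounds s (e n) x; have := ramp_bounds t (e n) x.
  by rewrite /phi ler_norml => /andP[? ?] /andP[? ?]; apply/andP; split; lra.
have E : \int[mu]_(x in D) (\1_([set` `]s, t]]) x * g x) =
    \int[mu]_(x in D `&` [set` `]s, t]]) g x.
  rewrite Rintegral_mkcondr; apply: eq_Rintegral => x _.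
  by rewrite patchE indicE; case: ifPn => _; rewrite ?mul1r ?mul0r.
rewrite -E; apply/eqP; rewrite -subr_eq0 -oppr_eq0 opprB; apply/eqP.
have c1 : (fun n => \int[mu]_(x in D) (phi n x * g x)) @ \oo --> f t - f s.
  have h : (fun n => \int[mu]_(x in D) (dramp t (e n) x * f x) -
      \int[mu]_(x in D) (dramp s (e n) x * f x)) @ \oo --> f t - f s.
    exact: cvgB ct cs.
  apply/cvgrPdist_lt => eta eta0.
  have /cvgrPdist_lt/(_ _ eta0) hlt := h.
  apply: filterS3 is_ it_ hlt => n i1 i2 hlt.
  have -> : \int[mu]_(x in D) (phi n x * g x) =
      \int[mu]_(x in D) (dramp t (e n) x * f x) - \int[mu]_(x in D) (dramp s (e n) x * f x).
    rewrite -[LHS]opprK -weakfg; last by apply: test; rewrite -ltrBrDl.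
    rewrite (derive1_eq (is_derive_plateau s t (e n))).
    rewrite -[RHS]opprB; congr (- _); rewrite -(RintegralB mD i1 i2).
    by apply: eq_Rintegral => x _; rewrite mulrBl.
  exact: hlt.
by apply/eqP; rewrite subr_eq0; apply/eqP; apply: (@norm_cvg_unique _ _ _ _ _ _ cg c1).
Qed.

Lemma ae_sub (P P' : R -> Prop) : (forall t, P t -> P' t) ->
  {ae mu, forall t, P t} -> {ae mu, forall t, P' t}.
Proof.
by move=> PP'; apply: filterS => //; exact: (ae_filter_ringOfSetsType mu).
Qed.

Lemma weak_derivative_ae : exists k : R,
  {ae mu, forall t, D t -> f t = k + primitive D g t}.
Proof.
have locf : locally_integrable setT (f \_ D).
  apply: open_integrable_locally; first exact: openT.
  by rewrite -restrict_EFin; exact: ((integrable_mkcond _ mD).1 intf).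
have Lf := lebesgue_differentiation locf.
have [[s [Ds Ls]]|no] := pselect (exists s, D s /\ lebesgue_pt (f \_ D) s).
  exists (f s - primitive D g s); apply: ae_sub Lf => t Lt Dt.
  have [st|/ltW ts] := leP s t.
    by have := weak_derivative_lebesgue_pt Ds Dt st Ls Lt; lra.
  by have := weak_derivative_lebesgue_pt Dt Ds ts Lt Ls; lra.
(* Almost every point is a Lebesgue point, so here [D] is a null set and any constant does. *)
exists 0; apply: ae_sub Lf => t Lt Dt; exfalso.
by apply: no; exists t.
Qed.

End weak_derivative_scalar.

(** * The energy inequality *)

Lemma within_itv_unif_continuous (R : realType) (V : normedModType R)
    (T : R) (c : R -> V) : {within `[0, T], continuous c} ->
  forall eps : R, 0 < eps -> exists2 del : R, 0 < del &
    forall s t, 0 <= s <= T -> 0 <= t <= T -> `|s - t| < del ->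
      `|c s - c t| <= eps.
Proof.
move=> cc eps eps0.
have /compact_near_coveringP cov := @segment_compact R 0 T.
pose P (del : R) (x : R) := forall y : R, 0 <= y <= T -> 0 <= x <= T ->
  `|x - y| < del -> `|c x - c y| <= eps.
have e20 : 0 < eps / 2 by rewrite divr_gt0.
suff [del /= del0 hdel] : \forall del \near (0 : R)^'+, `[0, T] `<=` P del.
  exists (del / 2); first by rewrite divr_gt0.
  move=> s t sT tT st.
  apply: (hdel (del / 2)) => //=.
  - by rewrite sub0r normrN gtr0_norm ?divr_gt0//; lra.
  - by rewrite divr_gt0.
apply: cov => x xT.
have xT' : 0 <= x <= T by move: xT; rewrite /= in_itv.
have [r /= r0 hr] : exists2 r : R, 0 < r & forall y, 0 <= y <= T ->
    `|x - y| < r -> `|c x - c y| < eps / 2.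
  have /subspace_continuousP/(_ x xT)/cvgrPdist_lt/(_ _ e20) := cc.
  move=> [r /= r0 hr]; exists r => // y yT xy.
  by apply: hr => //=; rewrite in_itv.
(* Radii are halved so that a point within [d] of [x'] is still within [r] of [x]; both values are
   then compared with [c x]. *)
exists (ball x (r / 2), [set d : R | 0 < d < r / 2]).
  split => /=; first by apply: nbhsx_ballx; rewrite divr_gt0.
  exists (r / 2) => /=; first by rewrite divr_gt0.
  by move=> d /=; rewrite sub0r normrN => dr d0; rewrite d0 (le_lt_trans _ dr)// ler_norm.
move=> [x' d] [/= xx' /andP[d0 dr]] y yT x'T x'y.
rewrite -ball_normE/= in xx'.
have h1 : `|c x - c x'| < eps / 2 by apply: hr => //; apply: lt_le_trans xx' _; lra.
have h2 : `|c x - c y| < eps / 2.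
  apply: hr => //; rewrite -(subrKA x' x); apply: le_lt_trans (ler_normD _ _) _.
  by lra.
rewrite -(subrKA (c x) (c x')); apply: le_trans (ler_normD _ _) _.
by rewrite (distrC (c x')); lra.
Qed.

(** Chaining over an equidistant subdivision of mesh below [del]: an estimate valid on short
    intervals only becomes global. *)
Lemma local_nonincreasing (R : realType) (T del : R) (F : R -> R) :
  0 < T -> 0 < del ->
  (forall s t, 0 <= s -> s <= t -> t <= T -> t - s < del -> F t <= F s) ->
  F T <= F 0.
Proof.
move=> T0 del0 hF.
have [n hn] : exists n : nat, T / n.+1%:R < del.
  exists (Num.truncn (T / del)).
  have := truncnS_gt (T / del); rewrite ltr_pdivrMr// ltr_pdivrMr ?ltr0n//.
  by rewrite mulrC.
pose p (k : nat) := T * k%:R / n.+1%:R.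
have pS k : p k.+1 = p k + T / n.+1%:R.
  by rewrite /p -[k.+1%:R]natr1 mulrDr mulr1 mulrDl.
have main k : (k <= n.+1)%N -> F (p k) <= F 0.
  elim: k => [|k IH] kn; first by rewrite /p mulr0 mul0r.
  apply: le_trans (IH (ltnW kn)); apply: hF.
  - by rewrite /p !mulr_ge0 ?invr_ge0// ltW.
  - by rewrite pS lerDl divr_ge0// ltW.
  - by rewrite /p -mulrA ler_piMr ?(ltW T0)// ler_pdivrMr ?ltr0n// mul1r ler_nat.
  - by rewrite pS addrC addKr.
by have := main n.+1 (leqnn _); rewrite /p mulfK ?pnatr_eq0.
Qed.

Lemma energy_balance_ge0 (R : realType) (xT x0 n0 i h e s : R) :
  0 <= xT -> xT - 2 * h <= x0 -> x0 <= n0 -> h = i + s -> 2 * s <= e ->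
  0 <= n0 + 2 * i + e.
Proof. by lra. Qed.

Section energy.
Context {R : realType} {Q H : completeNormedModType R}.
Local Notation mu := (@lebesgue_measure R).
Variables (ip : {dot H for (@idfun R)}) (j : {linear Q -> H}).
Variables (T : R) (D : set (measurableTypeR R)).
Hypotheses (T0 : 0 < T) (mD : measurable D) (DI : forall t, D t -> 0 < t < T).
Variable c : R -> H.
Hypothesis cc : {within `[0, T], continuous c}.
Variables (g : R -> Q -> R) (G : R -> R).
Hypothesis gG : forall t q q', D t -> `|g t q - g t q'| <= G t * `|q - q'|.
Hypothesis G0 : forall t, D t -> 0 <= G t.
Hypothesis iG : mu.-integrable D (EFin \o G).
Hypothesis ig : forall q, mu.-integrable D (EFin \o (g ^~ q)).
Hypothesis cg : forall q s t, 0 <= s -> s <= t -> t <= T ->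
  ip (c t - c s) (j q) = \int[mu]_(x in D `&` [set` `]s, t]]) g x q.

Lemma primitive_ends (f : R -> R) :
  primitive D f 0 = 0 /\ primitive D f T = \int[mu]_(x in D) f x.
Proof.
rewrite /primitive; split.
  rewrite (_ : _ `&` _ = set0) ?Rintegral_set0//.
  rewrite -subset0 => x [/DI/andP[x0 _]]/=.
  by rewrite in_itv/= leNgt => /andP[_]; rewrite leNgt x0.
by rewrite setIidl// => x /DI/andP[x0 xT] /=; rewrite in_itv/= !ltW.
Qed.

Section resolvent_energy.
Variables (J : H -> Q) (lam : R).
Hypothesis JB : forall x y, `|J x - J y| <= lam * `|x - y|.
Hypothesis lam0 : 0 < lam.
Hypothesis Jsub : forall x y,
  ip x (j (J x)) - ip y (j (J y)) <= 2 * ip (x - y) (j (J x)).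
Hypothesis J0 : forall x, 0 <= ip x (j (J x)).
Hypothesis Jle : forall x, ip x (j (J x)) <= `|x| ^+ 2.
Hypothesis igJ : mu.-integrable D (EFin \o (fun t => g t (J (c t)))).

(* On a short interval ]s, t], J (c t) differs little in Q from J (c x) for every x,
   so that the increment of (c, J c) is at most 2 \int_s^t g(x)(J (c x)) dx, up to
   a small multiple of \int_s^t G. *)
Lemma resolvent_energy : 0 <= `|c 0| ^+ 2 + 2 * \int[mu]_(t in D) g t (J (c t)).
Proof.
apply/ler_addgt0Pr => eps eps0.
set iGv := \int[mu]_(t in D) G t.
have iGv0 : 0 <= iGv by apply: Rintegral_ge0.
(* Chosen so that the total freezing error [2 * (eta * iGv)] stays below [eps]; the [+ 1] covers
   [iGv = 0]. *)
pose eta := eps / (2 * (iGv + 1)).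
have eta0 : 0 < eta by rewrite divr_gt0// mulr_gt0// ltr_wpDl.
have etal : 0 < eta / lam by rewrite divr_gt0.
have [del del0 hdel] := within_itv_unif_continuous cc etal.
pose h t := g t (J (c t)) + eta * G t.
have iEG : mu.-integrable D (EFin \o (fun t => eta * G t)).
  exact: (integrableZl mD eta iG).
have ih : mu.-integrable D (EFin \o h).
  by have := integrableD mD igJ iEG; exact: eq_integrable.
pose F t := ip (c t) (j (J (c t))) - 2 * primitive D h t.
have : F T <= F 0.
  apply: (local_nonincreasing T0 del0) => s t s0 st tT tsdel.
  suff hst : ip (c t) (j (J (c t))) - ip (c s) (j (J (c s))) <=
      2 * (primitive D h t - primitive D h s) by move: hst; rewrite /F; lra.
  apply: le_trans (Jsub _ _) _; rewrite ler_pM2l//.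
  rewrite (primitiveB mD ih s0 st) (cg _ s0 st tT).
  have mDst : measurable (D `&` [set` `]s, t]]).
    by apply: measurableI => //; exact: measurable_itv.
  apply: le_Rintegral => //.
  - by apply: integrableS (ig _) => //; exact: mDst.
  - by apply: integrableS ih => //; exact: mDst.
  move=> x [Dx /=]; rewrite in_itv/= => /andP[sx xt].
  have [x0 xT] := andP (DI Dx).
  rewrite /h -lerBlDl; apply: le_trans (ler_norm _) _.
  apply: le_trans (gG _ _ Dx) _; rewrite mulrC ler_wpM2r ?G0//.
  apply: le_trans (JB _ _) _; rewrite mulrC -ler_pdivlMr//.
  apply: hdel.
  - by rewrite (le_trans s0 st).
  - by rewrite !ltW.
  - by rewrite ger0_norm ?subr_ge0//; apply: le_lt_trans tsdel; rewrite lerD2l lerN2 ltW.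
have [p0 pT] := primitive_ends h.
rewrite /F p0 pT mulr0 subr0 => hF.
have small : 2 * (eta * iGv) <= eps.
  have -> : 2 * (eta * iGv) = eps * (iGv / (iGv + 1)).
    by rewrite /eta; field; rewrite gt_eqF// ltr_wpDl.
  by rewrite ler_piMr ?(ltW eps0)// ler_pdivrMr ?ltr_wpDl// mul1r lerDl.
have hE : \int[mu]_(x in D) h x = \int[mu]_(x in D) g x (J (c x)) + eta * iGv.
  by rewrite /h (RintegralD mD igJ iEG) RintegralZl.
exact: (energy_balance_ge0 (J0 (c T)) hF (Jle (c 0)) hE small).
Qed.

End resolvent_energy.
End energy.

Section energy_inequality.
Context {R : realType} {Q H : completeNormedModType R}.
Local Notation mu := (@lebesgue_measure R).
Variables (ipQ : {dot Q for (@idfun R)}) (ip : {dot H for (@idfun R)}).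
Hypothesis (hilbQ : hilbert ipQ) (hilbH : hilbert ip).
Variables (j : {linear Q -> H}).
Hypotheses (jinj : injective j) (jcont : continuous j).
Variables (T : R) (D : set (measurableTypeR R)).
Hypotheses (T0 : 0 < T) (mD : measurable D) (DI : forall t, D t -> 0 < t < T).
Variables (c : R -> H) (w : R -> Q).
Hypothesis cc : {within `[0, T], continuous c}.
Hypothesis cw : forall t, D t -> c t = j (w t).
Variables (g : R -> Q -> R) (G : R -> R).
Hypothesis gG : forall t q q', D t -> `|g t q - g t q'| <= G t * `|q - q'|.
Hypothesis g0 : forall t, D t -> g t 0 = 0.
Hypothesis G0 : forall t, D t -> 0 <= G t.
Hypothesis iG : mu.-integrable D (EFin \o G).
Hypothesis iGw : mu.-integrable D (EFin \o (fun t => G t * `|w t|)).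
Hypothesis mg : forall u : Q -> Q, continuous u ->
  measurable_fun D (fun t => g t (u (w t))).
Hypothesis cg : forall q s t, 0 <= s -> s <= t -> t <= T ->
  ip (c t - c s) (j q) = \int[mu]_(x in D `&` [set` `]s, t]]) g x q.

(** [J] is applied to [c = j w], where it contracts [Q]; hence [G t * |w t|] majorises all the
    integrands, and integrability of the limit comes with dominated convergence. *)
Lemma energy_inequality :
  mu.-integrable D (EFin \o (fun t => g t (w t))) /\
  0 <= `|c 0| ^+ 2 + 2 * \int[mu]_(t in D) g t (w t).
Proof.
have [K K0 jK] := continuous_linear_lipschitz jcont.
have [J hJ] := resolvent_exists hilbQ hilbH jK.
have gle t q : D t -> `|g t q| <= G t * `|q|.
  by move=> Dt; rewrite -[g t q]subr0 -(g0 Dt) -[q in leRHS]subr0 gG.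
have ig q : mu.-integrable D (EFin \o (g ^~ q)).
  apply: (le_integrable mD _ _ (integrableZl mD `|q| iG)).
    apply/measurable_EFinP; apply: (@mg (fun=> q)) => x; exact: cst_continuous.
  move=> t Dt; rewrite /= lee_fin [leRHS]ger0_norm ?mulr_ge0 ?G0//.
  by rewrite mulrC gle.
have lam0 n : 0 < (n.+1%:R^-1 : R) by rewrite invr_gt0.
pose h n t := g t (J n.+1%:R^-1 (j (w t))).
have mh n : measurable_fun D (h n).
  apply: (@mg (fun q => J n.+1%:R^-1 (j q))) => q.
  by apply: continuous_comp; [exact: jcont|exact: (resolvent_continuous hilbQ hilbH K0 jK hJ (lam0 n))].
have hle n t : D t -> `|h n t| <= G t * `|w t|.
  move=> Dt; apply: le_trans (gle _ _ Dt) _; rewrite ler_wpM2l ?G0//.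
  exact: (resolvent_le_norm hilbQ hilbH hJ).
have hcv t : D t -> (fun n => h n t) @ \oo --> g t (w t).
  move=> Dt; apply: cvg_dist0.
  apply: (@cvg_squeeze0 _ _ (fun n => G t * `|J n.+1%:R^-1 (j (w t)) - w t|)).
    by move=> n; rewrite normr_id gG.
  rewrite -(mulr0 (G t)); apply: cvgMr; apply: dist_cvg0.
  exact: (resolvent_cvg hilbQ hilbH jK hJ jinj).
have [iw cvw] := dominated_Rintegral mD mh hcv iGw hle.
split=> //.
have ih n : mu.-integrable D (EFin \o h n).
  apply: (le_integrable mD _ _ iGw); first exact/measurable_EFinP.
  move=> t Dt; rewrite /= lee_fin [leRHS]ger0_norm; last by rewrite mulr_ge0 ?G0.
  exact: hle.
have ge0 n : 0 <= `|c 0| ^+ 2 + 2 * \int[mu]_(t in D) h n t.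
  have -> : \int[mu]_(t in D) h n t = \int[mu]_(t in D) g t (J n.+1%:R^-1 (c t)).
    by apply: eq_Rintegral => t /set_mem Dt; rewrite (cw Dt).
  apply: (@resolvent_energy _ _ _ ip j T D T0 mD DI c cc g G gG G0 iG ig cg
    (J n.+1%:R^-1) (K / n.+1%:R^-1)).
  - move=> x y; rewrite -(resolventB hilbQ hilbH hJ)//.
    exact: (resolvent_bounded hilbQ hilbH K0 jK hJ).
  - by rewrite divr_gt0.
  - by move=> x y; exact: (resolvent_form_sub hilbQ hilbH hJ).
  - by move=> x; exact: (resolvent_ge0 hilbQ hilbH hJ).
  - by move=> x; exact: (resolvent_form_le hilbQ hilbH hJ).
  - apply: eq_integrable (ih n) => // t /set_mem Dt.
    by rewrite /h /= (cw Dt).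
have cv : (fun n => `|c 0| ^+ 2 + 2 * \int[mu]_(t in D) h n t) @ \oo -->
    `|c 0| ^+ 2 + 2 * \int[mu]_(t in D) g t (w t).
  by apply: cvgD; [exact: cvg_cst|apply: cvgMr; exact: cvw].
by apply: (cvgr_to_ge cv); exact: nearW.
Qed.

End energy_inequality.

(** * The form, its norm and the elliptic reconstruction *)

Section bilinear_subspace.
Context {R : realType} {V : lmodType R}.
Variables (S : set V) (b : V -> V -> R) (N : V -> R).
Hypotheses (sS : is_subspace S) (hb : bilinear_on S b) (hN : norm_on S N).

Lemma formDl x y z : S x -> S y -> S z -> b (x + y) z = b x z + b y z.
Proof. by move=> Sx Sy Sz; rewrite -[x]scale1r hb.1// mul1r scale1r. Qed.

Lemma formDr x y z : S x -> S y -> S z -> b z (x + y) = b z x + b z y.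
Proof. by move=> Sx Sy Sz; rewrite -[x]scale1r hb.2// mul1r scale1r. Qed.

Lemma form0l z : S z -> b 0 z = 0.
Proof.
move=> Sz; have S0 := subspace0 sS.
have := formDl S0 S0 Sz; rewrite addr0 => h.
by apply/eqP; rewrite -(subrr (b 0 z)) {2}h addrK.
Qed.

Lemma form0r z : S z -> b z 0 = 0.
Proof.
move=> Sz; have S0 := subspace0 sS.
have := formDr S0 S0 Sz; rewrite addr0 => h.
by apply/eqP; rewrite -(subrr (b z 0)) {2}h addrK.
Qed.

Lemma formBl x y z : S x -> S y -> S z -> b (x - y) z = b x z - b y z.
Proof.
by move=> Sx Sy Sz; rewrite addrC -scaleN1r hb.1// mulN1r addrC.
Qed.

Lemma formBr x y z : S x -> S y -> S z -> b z (x - y) = b z x - b z y.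
Proof.
by move=> Sx Sy Sz; rewrite addrC -scaleN1r hb.2// mulN1r addrC.
Qed.

Lemma form_suml (r : seq V) (a : V -> R) z : (forall g, g \in r -> S g) -> S z ->
  b (\sum_(g <- r) a g *: g) z = \sum_(g <- r) a g * b g z.
Proof.
move=> Sr Sz; elim: r Sr => [|g r IH] Sr; first by rewrite !big_nil form0l.
have Sr' h : h \in r -> S h by move=> hr; apply: Sr; rewrite in_cons hr orbT.
rewrite !big_cons hb.1 ?IH//; first by apply: Sr; rewrite mem_head.
by apply: subspace_sum => // h hr; apply: subspaceZ => //; exact: Sr'.
Qed.

Lemma form_sumr (r : seq V) (a : V -> R) z : (forall g, g \in r -> S g) -> S z ->
  b z (\sum_(g <- r) a g *: g) = \sum_(g <- r) a g * b z g.
Proof.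
move=> Sr Sz; elim: r Sr => [|g r IH] Sr; first by rewrite !big_nil form0r.
have Sr' h : h \in r -> S h by move=> hr; apply: Sr; rewrite in_cons hr orbT.
rewrite !big_cons hb.2 ?IH//; first by apply: Sr; rewrite mem_head.
by apply: subspace_sum => // h hr; apply: subspaceZ => //; exact: Sr'.
Qed.

Lemma norm_on0 : N 0 = 0.
Proof.
have [_ _ NZ _] := hN; have := NZ 0 0 (subspace0 sS).
by rewrite scaler0 normr0 mul0r.
Qed.

Lemma norm_onN x : S x -> N (- x) = N x.
Proof.
by have [_ _ NZ _] := hN; move=> Sx; rewrite -scaleN1r NZ// normrN1 mul1r.
Qed.

Lemma norm_on_sum (r : seq V) (a : V -> R) : (forall g, g \in r -> S g) ->
  N (\sum_(g <- r) a g *: g) <= \sum_(g <- r) `|a g| * N g.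
Proof.
have [_ _ NZ ND] := hN.
elim: r => [|g r IH] Sr; first by rewrite !big_nil norm_on0.
have Sr' h : h \in r -> S h by move=> hr; apply: Sr; rewrite in_cons hr orbT.
have Sg : S g by apply: Sr; rewrite mem_head.
rewrite !big_cons; apply: le_trans (ND _ _ _ _) _.
- exact: subspaceZ.
- by apply: subspace_sum => // h hr; apply: subspaceZ => //; exact: Sr'.
- by rewrite NZ// lerD2l IH.
Qed.

Lemma norm_on_dist x y : S x -> S y -> `|N x - N y| <= N (x - y).
Proof.
have [_ _ _ ND] := hN => Sx Sy; rewrite ler_norml.
have Sxy : S (x - y) by exact: subspaceB.
have Syx : S (y - x) by exact: subspaceB.
have e : N (x - y) = N (y - x) by rewrite -norm_onN// opprB.
apply/andP; split.
  rewrite lerNl opprB lerBlDr e.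
  by apply: le_trans (ND _ _ Syx Sx); rewrite subrK.
by rewrite lerBlDr; apply: le_trans (ND _ _ Sxy Sy); rewrite subrK.
Qed.

End bilinear_subspace.

Section setting.
Context {R : realType} {Q H : completeNormedModType R}.
Variables (ip : {dot H for (@idfun R)}) (hilbH : hilbert ip).
Variables (j : {linear Q -> H}) (jinj : injective j) (jcont : continuous j).
Variables (Qt : set H) (hQt : finite_dim_subspace Qt).
Variables (b : H -> H -> R) (hb : bilinear_on (Qsum j Qt) b).
Hypotheses (hbcont : continuous_form j b) (hbcoer : coercive_form j b).
Variables (N : H -> R) (hN : norm_on (Qsum j Qt) N).
Hypothesis hNb : forall q : Q, N (j q) ^+ 2 = b (j q) (j q).

Let sQt : is_subspace Qt := finite_dim_subspace_subspace hQt.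

Lemma Qsum_subspace : is_subspace (Qsum j Qt).
Proof.
split; first by exists 0, 0; rewrite linear0 addr0; split => //; exact: subspace0.
move=> a x y [q [u [Qu ->]]] [q' [u' [Qu' ->]]].
exists (a *: q + q'), (a *: u + u'); split; first exact: sQt.2.
by rewrite linearP scalerDr addrACA.
Qed.

Let sS := Qsum_subspace.

Lemma Qsum_j q : Qsum j Qt (j q).
Proof. by exists q, 0; rewrite addr0; split => //; exact: subspace0. Qed.

Lemma Qsum_Qt y : Qt y -> Qsum j Qt y.
Proof. by exists 0, y; rewrite linear0 add0r. Qed.

Lemma N_ge0 q : 0 <= N (j q).
Proof. by have [h _ _ _] := hN; apply: h; exact: Qsum_j. Qed.

Lemma N_j_le : exists2 C : R, 0 <= C & forall q, N (j q) <= C * `|q|.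
Proof.
have [M hM] := hbcont; exists (Num.sqrt `|M|); first exact: sqrtr_ge0.
move=> q; rewrite -(ler_pXn2r (n := 2)) ?nnegrE ?N_ge0 ?mulr_ge0 ?sqrtr_ge0//.
rewrite hNb exprMn sqr_sqrtr// expr2 mulrA.
apply: le_trans (ler_norm _) _; apply: le_trans (hM _ _) _.
by rewrite ler_wpM2r// ler_wpM2r// ler_norm.
Qed.

Lemma N_j_ge : exists2 C : R, 0 <= C & forall q, `|q| <= C * N (j q).
Proof.
have [alpha a0 ha] := hbcoer; exists (Num.sqrt alpha^-1); first exact: sqrtr_ge0.
move=> q; rewrite -(ler_pXn2r (n := 2)) ?nnegrE ?mulr_ge0 ?sqrtr_ge0 ?N_ge0//.
rewrite exprMn sqr_sqrtr ?invr_ge0 ?(ltW a0)// hNb.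
by rewrite mulrC ler_pdivlMr// mulrC.
Qed.

Lemma Qt_frame : exists fs : seq H, (forall g, g \in fs -> Qt g) /\
  forall x, Qt x -> x = \sum_(g <- fs) ip x g *: g.
Proof.
have [vs hvs] := finite_dim_subspace_span hQt.
exact: (frame_exists hilbH sQt hvs).
Qed.

(** No continuity of [N] on [Qt] is assumed: it follows from finite dimension, since Cauchy-Schwarz
    bounds the coefficients of the expansion. The same argument then bounds [b]. *)
Lemma N_Qt_le : exists2 C : R, 0 <= C & forall y, Qt y -> N y <= C * `|y|.
Proof.
have [fs [Sfs fsE]] := Qt_frame; have [N0 _ _ _] := hN.
have Sf g : g \in fs -> Qsum j Qt g by move=> /Sfs; exact: Qsum_Qt.
exists (\sum_(g <- fs) `|g| * N g).
  by rewrite big_seq sumr_ge0// => g gfs; rewrite mulr_ge0// N0//; exact: Sf.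
move=> y Qy; rewrite {1}(fsE y Qy); apply: le_trans (norm_on_sum sS hN _ Sf) _.
rewrite mulr_suml big_seq [leRHS]big_seq; apply: ler_sum => g gfs.
rewrite mulrAC ler_wpM2r ?N0//; first exact: Sf.
by rewrite mulrC; exact: cauchy_schwarz.
Qed.

Lemma form_Qt_bounded : exists2 C : R, 0 <= C &
  forall x y, Qt x -> Qt y -> `|b x y| <= C * `|x| * `|y|.
Proof.
have [fs [Sfs fsE]] := Qt_frame.
have Sf g : g \in fs -> Qsum j Qt g by move=> /Sfs; exact: Qsum_Qt.
exists (\sum_(g <- fs) `|g| * \sum_(h <- fs) `|h| * `|b g h|).
  by rewrite sumr_ge0// => g _; rewrite mulr_ge0// sumr_ge0// => h _; rewrite mulr_ge0.
move=> x y Qx Qy; rewrite {1}(fsE x Qx) (form_suml sS hb)//; last exact: Qsum_Qt.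
have bgy g : g \in fs -> `|b g y| <= (\sum_(h <- fs) `|h| * `|b g h|) * `|y|.
  move=> /Sf Sg; rewrite {1}(fsE y Qy) (form_sumr sS hb)//.
  apply: le_trans (ler_norm_sum _ _ _) _.
  rewrite mulr_suml; apply: ler_sum => h _; rewrite normrM mulrAC ler_wpM2r//.
  by rewrite mulrC; exact: cauchy_schwarz.
apply: le_trans (ler_norm_sum _ _ _) _.
rewrite -mulrA mulr_suml big_seq [leRHS]big_seq; apply: ler_sum => g gfs.
rewrite normrM; set s := \sum_(h <- fs) _.
rewrite (_ : `|g| * s * _ = (`|x| * `|g|) * (s * `|y|)); last by ring.
by apply: ler_pM => //; [exact: cauchy_schwarz|exact: bgy].
Qed.

(** The infimum is attained: the set is bounded below by 0 and, by continuity together with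
    coercivity, nonempty. *)
Lemma continuity_constantP : 0 <= continuity_constant j b N /\
  forall q q', `|b (j q) (j q')| <=
    continuity_constant j b N * N (j q) * N (j q').
Proof.
rewrite /continuity_constant; set A := [set M : R | _].
have lbA : lbound A 0 by move=> M [].
have A0 : A !=set0.
  have [M hM] := hbcont; have [C C0 hC] := N_j_ge.
  exists (`|M| * C * C); split; first by rewrite !mulr_ge0.
  move=> q q'; apply: le_trans (hM q q') _.
  apply: (@le_trans _ _ (`|M| * `|q| * `|q'|)).
    by rewrite ler_wpM2r// ler_wpM2r// ler_norm.
  rewrite (_ : `|M| * C * C * _ * _ = `|M| * (C * N (j q)) * (C * N (j q'))); last by ring.
  by apply: ler_pM => //; rewrite ler_wpM2l.
split; first exact: lb_le_inf.
move=> q q'; rewrite -mulrA.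
(* The bound passes to the infimum by division, so a vanishing product of norms is treated apart;
   any admissible constant settles it. *)
have := mulr_ge0 (N_ge0 q) (N_ge0 q'); rewrite le_eqVlt => /predU1P[n0|n0].
  have [M [_ hM]] := A0; rewrite -n0 mulr0.
  by apply: le_trans (hM q q') _; rewrite -mulrA -n0 mulr0.
rewrite -ler_pdivrMr//; apply: lb_le_inf => // M [_ hM].
by rewrite ler_pdivrMr// mulrA.
Qed.

Lemma norm_Qm1_spec g q : ip g (j q) <= norm_Qm1 ip j N g * N (j q).
Proof.
have [->|q0] := eqVneq q 0.
  by rewrite linear0 ip0r (norm_on0 sS hN) mulr0.
have [C C0 hC] := N_j_ge.
have Nq : 0 < N (j q).
  rewrite lt_neqAle N_ge0 andbT eq_sym; apply: contra_neq q0 => Nq.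
  by apply/eqP; rewrite -normr_le0; apply: le_trans (hC q) _; rewrite Nq mulr0.
rewrite -ler_pdivrMr//; apply: ub_le_sup; last by exists q.
have [K K0 jK] := continuous_linear_lipschitz jcont.
exists (`|g| * K * C) => _ [q' q'0 ->].
have Nq' : 0 < N (j q').
  rewrite lt_neqAle N_ge0 andbT eq_sym; apply: contra_neq q'0 => Nq'.
  by apply/eqP; rewrite -normr_le0; apply: le_trans (hC q') _; rewrite Nq' mulr0.
rewrite ler_pdivrMr//; apply: le_trans (ler_norm _) _.
apply: le_trans (cauchy_schwarz hilbH _ _) _.
rewrite -!mulrA ler_wpM2l//; apply: le_trans (jK q') _.
by rewrite ler_wpM2l ?(ltW K0).
Qed.

Lemma norm_Qm1_le g C : 0 <= C -> (forall q, ip g (j q) <= C * N (j q)) ->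
  norm_Qm1 ip j N g <= C.
Proof.
move=> C0 hC; rewrite /norm_Qm1; set A := [set r : R | _].
have [A0|] := pselect (A !=set0); last first.
  by move/set0P/negP; rewrite negbK => /eqP ->; rewrite sup0.
apply: ge_sup => // _ [q q0 ->].
have [K K0 hK] := N_j_ge.
have Nq : 0 < N (j q).
  rewrite lt_neqAle N_ge0 andbT eq_sym; apply: contra_neq q0 => Nq.
  by apply/eqP; rewrite -normr_le0; apply: le_trans (hK q) _; rewrite Nq mulr0.
by rewrite ler_pdivrMr.
Qed.

Lemma norm_Qm1_ge0 g : 0 <= norm_Qm1 ip j N g.
Proof.
(* If [Q] is the zero space, the supremum is over the empty set and equals 0 by convention.
   Otherwise [q] and [- q] give quotients of opposite sign. *)
have [[q q0]|no] := pselect (exists q : Q, q != 0); last first.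
  rewrite /norm_Qm1 (_ : [set r : R | _] = set0) ?sup0//.
  by rewrite -subset0 => r [q q0 _]; apply: no; exists q.
have h1 := norm_Qm1_spec g q; have h2 := norm_Qm1_spec g (- q).
have [C C0 hC] := N_j_ge.
have Nq : 0 < N (j q).
  rewrite lt_neqAle N_ge0 andbT eq_sym; apply: contra_neq q0 => Nq.
  by apply/eqP; rewrite -normr_le0; apply: le_trans (hC q) _; rewrite Nq mulr0.
rewrite -(pmulr_lge0 _ Nq); move: h2.
rewrite linearN ipNr (norm_onN hN); last exact: Qsum_j.
by lra.
Qed.

Lemma norm_Qm1_lipschitz : exists2 C : R, 0 <= C & forall g g',
  `|norm_Qm1 ip j N g - norm_Qm1 ip j N g'| <= C * `|g - g'|.
Proof.
have [C C0 hC] := N_j_ge.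
have [K K0 jK] := continuous_linear_lipschitz jcont.
exists (K * C); first by rewrite mulr_ge0// ltW.
have half g g' : norm_Qm1 ip j N g <= norm_Qm1 ip j N g' + K * C * `|g - g'|.
  apply: norm_Qm1_le => [|q].
    by rewrite addr_ge0 ?norm_Qm1_ge0// !mulr_ge0// ltW.
  rewrite -(subrK g' g) ipDl mulrDl addrC lerD ?norm_Qm1_spec//.
  apply: le_trans (ler_norm _) _; apply: le_trans (cauchy_schwarz hilbH _ _) _.
  rewrite (_ : K * C * _ * _ = `|g - g'| * (K * (C * N (j q)))); last by rewrite subrK; ring.
  rewrite ler_wpM2l//; apply: le_trans (jK q) _.
  by rewrite ler_wpM2l ?(ltW K0).
move=> g g'; rewrite ler_norml; apply/andP; split.
  by have := half g' g; rewrite distrC; lra.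
by have := half g g'; lra.
Qed.

(** Recovers [pc] from [pt - pd]. The vectors expanding the finite dimensional intersection of [Qt]
    with the range of [j] are lifted to [Q] by choice, and [L] lifts the expansion; being given by
    inner products, it is Lipschitz on all of [H]. *)
Lemma conforming_part_lipschitz : exists2 L : H -> Q,
  exists2 C : R, 0 <= C & forall x y, `|L x - L y| <= C * `|x - y| &
  forall q, Qt (j q) -> L (j q) = q.
Proof.
have [vs hvs] := finite_dim_subspace_span hQt.
pose Z := range j `&` Qt.
have sZ : is_subspace Z.
  split; first by split; [exists 0; rewrite ?linear0|exact: subspace0].
  move=> a x y [[q _ <-] Qq] [[q' _ <-] Qq']; split; last exact: sQt.2.
  by exists (a *: q + q'); rewrite ?linearP.
have Zvs : Z `<=` in_span vs by move=> x [_ /hvs].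
have [fs [Sfs fsE]] := frame_exists hilbH sZ Zvs.
have /choice[pre hpre] : forall g : H, exists q : Q, g \in fs -> j q = g.
  move=> g; have [/Sfs[[q _ <-] _]|//] := boolP (g \in fs); first by exists q.
  by move=> _; exists 0.
pose L x := \sum_(g <- fs) ip x g *: pre g.
exists L; first exists (\sum_(g <- fs) `|g| * `|pre g|).
- by rewrite sumr_ge0// => g _; rewrite mulr_ge0.
- move=> x y; rewrite /L -sumrB; apply: le_trans (ler_norm_sum _ _ _) _.
  rewrite mulr_suml; apply: ler_sum => g _.
  rewrite -scalerBl -ipBl normrZ mulrAC ler_wpM2r// mulrC.
  exact: cauchy_schwarz.
move=> q Qq; apply: jinj; have Zq : Z (j q) by split.
rewrite [RHS](fsE _ Zq) /L linear_sum big_seq [RHS]big_seq.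
by apply: eq_bigr => g gfs; rewrite linearZ/= hpre.
Qed.

Variables (f : H) (Pi B : H -> H) (E : H -> Q).
Hypotheses (hPi : is_orthogonal_projection ip Qt Pi).
Hypotheses (hB : is_riesz_representative ip Qt b B).
Hypotheses (hE : is_elliptic_reconstruction ip j Qt b f Pi B E).

(** [E] is affine rather than linear, but the terms in [f] cancel in a difference: [E x - E y] has
    right hand side [B x - B y], and coercivity bounds it. *)
Lemma reconstruction_lipschitz : exists2 C : R, 0 <= C &
  forall x y, Qt x -> Qt y -> `|E x - E y| <= C * `|x - y|.
Proof.
have [M M0 hM] := form_Qt_bounded.
have [K K0 jK] := continuous_linear_lipschitz jcont.
have [alpha a0 ha] := hbcoer.
exists (M * K / alpha); first by rewrite !mulr_ge0 ?invr_ge0// ltW.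
move=> x y Qx Qy.
have [[QBx Bx] [QBy By]] := (hB Qx, hB Qy).
have Qxy : Qt (x - y) by exact: subspaceB.
pose u := B x - B y.
have Qu : Qt u by exact: subspaceB.
have hu : `|u| <= M * `|x - y|.
  have [->|u0] := eqVneq u 0; first by rewrite normr0 mulr_ge0.
  rewrite -(ler_pM2r (_ : 0 < `|u|)) ?normr_gt0// -expr2 hilbH {1}/u ipBl Bx// By//.
  rewrite -(formBl hb); try exact: Qsum_Qt.
  exact: le_trans (ler_norm _) (hM _ _ Qxy Qu).
have he q : b (j (E x - E y)) (j q) = ip u (j q).
  rewrite linearB (formBl hb); try exact: Qsum_j.
  rewrite (hE Qx) (hE Qy) -ipBl /u; congr (ip _ _).
  by rewrite opprD addrACA subrr addr0 opprB addrA subrK.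
have {}he := he (E x - E y); set e := E x - E y in he *.
have [->|e0] := eqVneq e 0; first by rewrite normr0 !mulr_ge0 ?invr_ge0// ltW.
have hle : alpha * `|e| ^+ 2 <= M * `|x - y| * (K * `|e|).
  apply: le_trans (ha e) _; rewrite he; apply: le_trans (ler_norm _) _.
  apply: le_trans (cauchy_schwarz hilbH _ _) _; apply: ler_pM => //.
rewrite mulrAC ler_pdivlMr// mulrC -(ler_pM2r (_ : 0 < `|e|)) ?normr_gt0//.
by rewrite -mulrA -expr2; apply: le_trans hle _; rewrite le_eqVlt; apply/orP; left; apply/eqP; ring.
Qed.

(** The Galerkin equation says that [d + B x - Pi f], an element of [Qt], is orthogonal to [Qt],
    hence zero. So [B x - Pi f + f] is [f - d] as a vector of [H], and may be tested with all of
    [Q]. *)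
Lemma reconstruction_galerkin x d : Qt x -> Qt d ->
  (forall y, Qt y -> ip d y + b x y = ip f y) ->
  forall q, b (j (E x)) (j q) = ip (f - d) (j q).
Proof.
move=> Qx Qd hd q; rewrite (hE Qx); congr (ip _ _).
have [QBx Bx] := hB Qx; have [QPf Pf] := hPi f.
have Qz : Qt (d + B x - Pi f).
  by apply: subspaceB => //; exact: subspaceD.
have hz y : Qt y -> ip (d + B x - Pi f) y = 0.
  move=> Qy; rewrite ipBl ipDl Bx// hd//.
  by have := Pf _ Qy; rewrite ipBl.
have /eqP := ip_eq0 hilbH (hz _ Qz).
by rewrite -addrA addrC addr_eq0 => /eqP ->; rewrite addrC.
Qed.

(** The origin of the constants. Write x, y, D, C for the norms of r, s, g and the continuity
    constant. Half of the available 2 x^2 is spent, in two equal parts, on 2 C x y <= x^2/2 + 2 C^2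
    y^2 and 2 D x <= x^2/2 + 2 D^2; finally 2 D y <= y^2 + D^2. Thus 3 = 2 + 1, and y^2 carries 2
    C^2 + 1. *)
Lemma energy_density_le (g : H) (r s : Q) :
  2 * (ip g (j (r + s)) - b (j r) (j (r + s))) <=
  (2 * continuity_constant j b N ^+ 2 + 1) * N (j s) ^+ 2
    + 3 * norm_Qm1 ip j N g ^+ 2 - N (j r) ^+ 2.
Proof.
have [Cb0 Cb] := continuity_constantP.
have Dr := norm_Qm1_spec g r; have Ds := norm_Qm1_spec g s.
have hb1 : - b (j r) (j s) <= continuity_constant j b N * N (j r) * N (j s).
  by apply: le_trans (Cb r s); rewrite -normrN ler_norm.
rewrite linearD/= ipDr (formDr hb); try exact: Qsum_j.
rewrite -hNb; move: Dr Ds hb1.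
move: (N (j r)) (N (j s)) (norm_Qm1 ip j N g) (continuity_constant j b N) (ip g (j r))
  (ip g (j s)) (b (j r) (j s)) => x y D C u v z Dr Ds hb1.
apply: (@le_trans _ _ (2 * (D * x + D * y - x ^+ 2 + C * x * y))); first by lra.
rewrite -subr_ge0.
have -> : (2 * C ^+ 2 + 1) * y ^+ 2 + 3 * D ^+ 2 - x ^+ 2
    - 2 * (D * x + D * y - x ^+ 2 + C * x * y) =
  (2^-1 * (x - 2 * C * y) ^+ 2) + 2^-1 * (x - 2 * D) ^+ 2 + (y - D) ^+ 2 by field.
by apply: addr_ge0; [apply: addr_ge0; apply: mulr_ge0|]; rewrite ?sqr_ge0 ?invr_ge0.
Qed.

End setting.

(** * Square integrable functions and null sets *)

Section square_integrable.
Context d (X : measurableType d) (R : realType).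
Variables (mu : {measure set X -> \bar R}) (D : set X).
Hypothesis mD : measurable D.

Lemma integrable_le (h k : X -> R) : measurable_fun D h ->
  mu.-integrable D (EFin \o k) -> (forall x, D x -> `|h x| <= k x) ->
  mu.-integrable D (EFin \o h).
Proof.
move=> mh ik hk; apply: (le_integrable mD _ _ ik); first exact/measurable_EFinP.
by move=> x Dx; rewrite /= lee_fin; apply: le_trans (hk x Dx) (ler_norm _).
Qed.

Lemma discriminant_le (a b c : R) : (forall l, 0 <= a + 2 * l * c + l ^+ 2 * b) ->
  0 <= a -> 0 <= b -> c <= Num.sqrt a * Num.sqrt b.
Proof.
move=> h a0 b0; rewrite -sqrtrM//.
apply: le_trans (ler_norm _) _; rewrite -sqrtr_sqr ler_wsqrtr//.
move: b0; rewrite le_eqVlt => /predU1P[b0|b0].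
  have [->|c0] := eqVneq c 0; first by rewrite -b0 expr0n mulr0.
  (* For [b = 0] the quadratic is affine in [l]; this point gives it the value -1, a
     contradiction. *)
  have := h (- (a + 1) / (2 * c)); rewrite -b0 mulr0 addr0.
  have -> : a + 2 * (- (a + 1) / (2 * c)) * c = -1 by field.
  by lra.
have := h (- c / b).
have -> : a + 2 * (- c / b) * c + (- c / b) ^+ 2 * b = a - c ^+ 2 / b.
  by field; rewrite gt_eqF.
by rewrite subr_ge0 ler_pdivrMr.
Qed.

(** Minkowski in L2, through Cauchy-Schwarz: the integral of [(f + l * g) ^+ 2] is a nonnegative
    quadratic in [l]. *)
Lemma sqrt_Rintegral_triangle (f g : X -> R) :
  measurable_fun D f -> measurable_fun D g ->
  mu.-integrable D (EFin \o (fun x => f x ^+ 2)) ->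
  mu.-integrable D (EFin \o (fun x => g x ^+ 2)) ->
  Num.sqrt (\int[mu]_(x in D) (f x + g x) ^+ 2) <=
  Num.sqrt (\int[mu]_(x in D) f x ^+ 2) + Num.sqrt (\int[mu]_(x in D) g x ^+ 2).
Proof.
move=> mf mg if2 ig2.
have ifg : mu.-integrable D (EFin \o (fun x => f x * g x)).
  apply: (@integrable_le _ (fun x => f x ^+ 2 + g x ^+ 2)).
  - exact: measurable_funM.
  - by have := integrableD mD if2 ig2; exact: eq_integrable.
  - move=> x _; rewrite normrM -(real_normK (num_real (f x))) -(real_normK (num_real (g x))).
    have := sqr_ge0 (`|f x| - `|g x|); have := sqr_ge0 `|f x|; have := sqr_ge0 `|g x|.
    by move: `|f x| `|g x| => a b; rewrite sqrrB mulr2n; lra.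
have expand l : \int[mu]_(x in D) (f x + l * g x) ^+ 2 =
    \int[mu]_(x in D) f x ^+ 2 + 2 * l * \int[mu]_(x in D) (f x * g x)
    + l ^+ 2 * \int[mu]_(x in D) g x ^+ 2.
  have i1 : mu.-integrable D (EFin \o (fun x => 2 * l * (f x * g x))).
    exact: (integrableZl mD (2 * l) ifg).
  have i2 : mu.-integrable D (EFin \o (fun x => l ^+ 2 * g x ^+ 2)).
    exact: (integrableZl mD (l ^+ 2) ig2).
  have i12 : mu.-integrable D (EFin \o (fun x => f x ^+ 2 + 2 * l * (f x * g x))).
    by have := integrableD mD if2 i1; exact: eq_integrable.
  rewrite -(RintegralZl _ mD ifg) -(RintegralZl _ mD ig2).
  rewrite -(RintegralD mD if2 i1) -(RintegralD mD i12 i2).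
  by apply: eq_Rintegral => x _; ring.
set A := \int[mu]_(x in D) f x ^+ 2 in expand *.
set B := \int[mu]_(x in D) g x ^+ 2 in expand *.
set C := \int[mu]_(x in D) (f x * g x) in expand.
have A0 : 0 <= A by apply: Rintegral_ge0 => x _; exact: sqr_ge0.
have B0 : 0 <= B by apply: Rintegral_ge0 => x _; exact: sqr_ge0.
have hC : C <= Num.sqrt A * Num.sqrt B.
  apply: discriminant_le => // l; rewrite -expand.
  by apply: Rintegral_ge0 => x _; exact: sqr_ge0.
have -> : \int[mu]_(x in D) (f x + g x) ^+ 2 = A + 2 * C + B.
  have := expand 1; rewrite mulr1 expr1n mul1r => <-.
  by apply: eq_Rintegral => x _; rewrite mul1r.
rewrite -[leRHS]ger0_norm ?addr_ge0 ?sqrtr_ge0// -sqrtr_sqr ler_wsqrtr//.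
have := sqr_sqrtr A0; have := sqr_sqrtr B0.
move: (Num.sqrt A) (Num.sqrt B) hC => a b hC hb ha.
by rewrite -ha -hb; move: hC; rewrite sqrrD mulr2n; lra.
Qed.

Lemma sqrt_Rintegral_le_add (h f g : X -> R) :
  measurable_fun D f -> measurable_fun D g ->
  mu.-integrable D (EFin \o (fun x => h x ^+ 2)) ->
  mu.-integrable D (EFin \o (fun x => f x ^+ 2)) ->
  mu.-integrable D (EFin \o (fun x => g x ^+ 2)) ->
  (forall x, D x -> 0 <= h x <= f x + g x) ->
  Num.sqrt (\int[mu]_(x in D) h x ^+ 2) <=
  Num.sqrt (\int[mu]_(x in D) f x ^+ 2) + Num.sqrt (\int[mu]_(x in D) g x ^+ 2).
Proof.
move=> mf mg ih if2 ig2 hfg.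
apply: le_trans (sqrt_Rintegral_triangle mf mg if2 ig2).
apply: ler_wsqrtr; apply: le_Rintegral => //.
  apply: (@integrable_le _ (fun x => 2 * (f x ^+ 2 + g x ^+ 2))).
  - by apply: measurable_funX; exact: measurable_funD.
  - by have := integrableZl mD 2 (integrableD mD if2 ig2); exact: eq_integrable.
  - move=> x _; rewrite ger0_norm ?sqr_ge0// -subr_ge0.
    rewrite (_ : _ - _ = (f x - g x) ^+ 2) ?sqr_ge0//; ring.
move=> x Dx; have [h0 hle] := andP (hfg x Dx).
by rewrite ler_pXn2r// nnegrE// (le_trans h0).
Qed.

End square_integrable.

Section conull.
Context {R : realType}.
Local Notation mu := (@lebesgue_measure R).

Lemma ae_and (P P' : R -> Prop) : {ae mu, forall t, P t} ->
  {ae mu, forall t, P' t} -> {ae mu, forall t, P t /\ P' t}.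
Proof.
move=> h h'; move: h h'; apply: filterS2 => //.
exact: (ae_filter_ringOfSetsType mu).
Qed.

Lemma ae_conull (T : R) (P : R -> Prop) : {ae mu, forall t, 0 < t < T -> P t} ->
  exists D : set (measurableTypeR R), [/\ measurable D, D `<=` [set` `]0, T[],
    mu ([set` `]0, T[] `\` D) = 0%E & forall t, D t -> P t].
Proof.
move=> [A [mA A0 hA]]; exists ([set` `]0, T[] `\` A); split.
- by apply: measurableD => //; exact: measurable_itv.
- by move=> t [].
- rewrite setDD; apply/eqP; rewrite eq_le measure_ge0 andbT -A0.
  apply: le_measure; rewrite ?inE//.
  by apply: measurableI => //; exact: measurable_itv.
- move=> t [tT nA]; apply: contrapT => nP; apply: nA; apply: hA => /= h; apply: nP.
  by apply: h; move: tT; rewrite /= in_itv.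
Qed.

Lemma conull_ae (T : R) (D : set (measurableTypeR R)) (P : R -> Prop) :
  measurable D -> mu ([set` `]0, T[] `\` D) = 0%E ->
  {ae mu, forall t, D t -> P t} -> {ae mu, forall t, 0 < t < T -> P t}.
Proof.
move=> mD D0 [A [mA A0 hA]].
have mI : measurable ([set` `]0, T[] `\` D : set (measurableTypeR R)).
  by apply: measurableD => //; exact: measurable_itv.
exists (A `|` ([set` `]0, T[] `\` D)); split.
- exact: measurableU.
- by rewrite measureU0.
- move=> t /= /not_implyP[tT nP].
  have [Dt|nD] := pselect (D t); last by right; split => //=; rewrite in_itv.
  by left; apply: hA => /= h; apply: nP; exact: h.
Qed.

(** A nonzero value would persist on a nonempty open interval inside []0, T[], of positive measure.
    The endpoints are included, which is what identifies values at time 0. *)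
Lemma within_continuous_ae_eq0 (T : R) (h : R -> R) : 0 < T ->
  {within `[0, T], continuous h} -> {ae mu, forall t, 0 < t < T -> h t = 0} ->
  forall t, 0 <= t <= T -> h t = 0.
Proof.
move=> T0 ch [A [mA A0 hA]] t tT; apply: contrapT => ht.
have n0 : 0 < `|h t| by rewrite normr_gt0; apply/eqP.
have /subspace_continuousP/(_ t)/= := ch.
rewrite in_itv/= => /(_ tT)/cvgrPdist_lt/(_ _ n0)[r /= r0 hr].
have nz y : 0 <= y <= T -> `|t - y| < r -> h y <> 0.
  move=> yT ty hy; have : `|h t - h y| < `|h t| by apply: hr => //=; rewrite in_itv.
  by rewrite hy subr0 ltxx.
pose a := Num.max 0 (t - r); pose b := Num.min T (t + r).
have [t0 tT'] := andP tT.
have ab : a < b.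
  rewrite /a /b lt_min !gt_max T0/=; apply/and3P; split.
  - by rewrite (lt_le_trans _ tT')// gtrBl.
  - by rewrite ltr_wpDl.
  - by rewrite ltrBlDr -addrA ltrDl addr_gt0.
have JA : [set` `]a, b[] `<=` A.
  move=> y /=; rewrite in_itv/= /a /b gt_max lt_min => /andP[/andP[y0 ty] /andP[yT yt]].
  apply: hA => /= hy; apply: (nz y); last by apply: hy; rewrite y0.
  - by rewrite !ltW.
  - by rewrite ltr_norml; apply/andP; split; lra.
have : (mu [set` `]a, b[] <= mu A)%E by apply: le_measure; rewrite ?inE.
by rewrite A0 lebesgue_measure_itv/= lte_fin ab -EFinB lee_fin subr_le0 leNgt ab.
Qed.

End conull.

(** * Weak derivatives tested by linear functionals, and the dual of [Q] *)

Section weak_linear.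
Context {R : realType} {V : lmodType R}.
Local Notation mu := (@lebesgue_measure R).
Variables (T : R) (D : set (measurableTypeR R)) (S : set V) (N : V -> R).
Let I : set (measurableTypeR R) := `]0, T[.
Hypotheses (mD : measurable D) (DI : D `<=` I) (ID0 : mu (I `\` D) = 0%E).
Hypothesis sS : is_subspace S.
Variables (l : V -> R) (M : R).
Hypothesis lP : forall a x y, l (a *: x + y) = a * l x + l y.
Hypothesis lM : forall x, S x -> `|l x| <= M * N x.
Hypothesis N0 : forall x, S x -> 0 <= N x.
Hypothesis M0 : 0 < M.

Lemma weak_derivative_linear (u v : R -> V) (phi : R -> R) :
  weak_derivative T S N u v -> test_function T phi ->
  measurable_fun D (l \o u) -> measurable_fun D (l \o v) ->
  [/\ mu.-integrable D (EFin \o (fun t => derive1 phi t * l (u t))),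
      mu.-integrable D (EFin \o (fun t => phi t * l (v t)))
    & \int[mu]_(t in D) (derive1 phi t * l (u t)) =
      - \int[mu]_(t in D) (phi t * l (v t))].
Proof.
move=> huv tphi mu_ mv.
have [dphi _ _] := tphi.
have cphi : continuous phi.
  move=> t; apply: differentiable_continuous; apply/derivable1_diffP.
  exact: (dphi 0%N).
have cdphi : continuous (derive1 phi).
  move=> t; apply: differentiable_continuous; apply/derivable1_diffP.
  exact: (dphi 1%N).
have l0 : l 0 = 0 by have := lP 1 0 0; rewrite scaler0 addr0 mul1r => h; lra.
have lZ a x : l (a *: x) = a * l x by rewrite -[a *: x]addr0 lP l0 addr0.
have [x [hx hy]] := huv phi tphi.
have [|i1 e1] := bochner_integral_linear mD DI ID0 sS lP lM N0 M0 hx.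
  rewrite (_ : l \o _ = fun t => derive1 phi t * l (u t)); last first.
    by apply/funext => t /=; rewrite lZ.
  by apply: measurable_funM => //; apply: measurable_funTS; exact: continuous_measurable_fun.
have [|i2 e2] := bochner_integral_linear mD DI ID0 sS lP lM N0 M0 hy.
  rewrite (_ : l \o _ = fun t => phi t * l (v t)); last first.
    by apply/funext => t /=; rewrite lZ.
  by apply: measurable_funM => //; apply: measurable_funTS; exact: continuous_measurable_fun.
split.
- by apply: eq_integrable i1 => // t _ /=; rewrite lZ.
- by apply: eq_integrable i2 => // t _ /=; rewrite lZ.
- transitivity (l x); first by rewrite -e1; apply: eq_Rintegral => t _; rewrite lZ.
  rewrite -[l x]opprK; congr (- _).
  transitivity (l (- x)); first by rewrite -scaleN1r lZ mulN1r.
  by rewrite -e2; apply: eq_Rintegral => t _; rewrite lZ.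
Qed.

End weak_linear.

Section dual_space.
Context {R : realType} {Q : completeNormedModType R}.

Lemma dual_subspace : is_subspace (@dual R Q).
Proof.
split.
  split; last by move=> x; exact: cst_continuous.
  by move=> a x y; rewrite /GRing.scale/= mulr0 addr0.
move=> a l m [hl cl] [hm cm].
have -> : a *: l + m = (fun q => (a * l q + m q : R)) :> (Q -> R^o) by [].
split; last first.
  by move=> x; apply: cvgD; [apply: cvgMr; exact: cl|exact: cm].
move=> c x y; have /= -> := hl c x y; have /= -> := hm c x y.
by rewrite /GRing.scale/=; ring.
Qed.

Lemma dual_norm_spec (l : Q -> R^o) (q : Q) : dual l ->
  `|l q| <= dual_norm l * `|q|.
Proof.
move=> [hl cl].
pose L : {linear Q -> R^o} := HB.pack l (GRing.isLinear.Build R Q R^o *:%R l hl).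
have [K K0 hK] := @continuous_linear_lipschitz R Q R^o L cl.
have [->|q0] := eqVneq q 0.
  by rewrite (_ : l 0 = 0) ?normr0 ?mulr0//; exact: (linear0 L).
rewrite -ler_pdivrMr ?normr_gt0//; apply: ub_le_sup; last by exists q.
exists K => _ [q' q'0 ->]; rewrite ler_pdivrMr ?normr_gt0//; exact: hK.
Qed.

Lemma dual_norm_ge0 (l : Q -> R^o) : dual l -> 0 <= dual_norm l.
Proof.
move=> dl; have [[q q0]|no] := pselect (exists q : Q, q != 0).
  have := dual_norm_spec q dl; rewrite -ler_pdivrMr ?normr_gt0//.
  by apply: le_trans; rewrite divr_ge0.
rewrite /dual_norm (_ : [set r : R | _] = set0) ?sup0//.
by rewrite -subset0 => r [q q0 _]; apply: no; exists q.
Qed.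

End dual_space.

Lemma setT_subspace (R : realType) (V : lmodType R) : @is_subspace R V setT.
Proof. by []. Qed.

(** * L2 norms as integrals over a conull set *)

Section L2_norms.
Context {R : realType}.
Local Notation mu := (@lebesgue_measure R).
Variables (T : R) (D : set (measurableTypeR R)).
Let I : set (measurableTypeR R) := `]0, T[.
Hypotheses (mD : measurable D) (DI : D `<=` I) (ID0 : mu (I `\` D) = 0%E).

Lemma L2norm_Rintegral (V : lmodType R) (N : V -> R) (v : R -> V) :
  measurable_fun D (fun t => N (v t)) ->
  mu.-integrable D (EFin \o (fun t => N (v t) ^+ 2)) ->
  L2norm T N v = (Num.sqrt (\int[mu]_(t in D) N (v t) ^+ 2))%:E.
Proof.
move=> mN iN; rewrite /L2norm.
rewrite (ge0_integral_conull mD DI ID0 (f := fun t => N (v t) ^+ 2)); last 2 first.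
- by move=> t _; exact: sqr_ge0.
- by apply: measurable_funX.
rewrite -(fineK (integrable_fin_num mD iN)) poweR_EFin.
by rewrite powR12_sqrt// Rintegral_ge0// => t _; exact: sqr_ge0.
Qed.

Lemma L2norm_lty_integrable (V : lmodType R) (N : V -> R) (v : R -> V) :
  (L2norm T N v < +oo)%E -> measurable_fun D (fun t => N (v t)) ->
  mu.-integrable D (EFin \o (fun t => N (v t) ^+ 2)).
Proof.
move=> Nv mN; have mN2 : measurable_fun D (fun t => N (v t) ^+ 2).
  exact: measurable_funX.
apply/integrableP; split; first exact/measurable_EFinP.
have -> : (\int[mu]_(t in D) `|(EFin \o (fun t => (N (v t) ^+ 2)%R)) t| =
    \int[mu]_(t in D) (N (v t) ^+ 2)%:E)%E.
  by apply: eq_integral => t _ /=; rewrite ger0_norm ?sqr_ge0.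
rewrite -(ge0_integral_conull mD DI ID0 (f := fun t => N (v t) ^+ 2))//; last first.
  by move=> t _; exact: sqr_ge0.
rewrite ltey; apply: contraTneq Nv => Noo.
by rewrite /L2norm Noo poweRyr ?ltxx// invr_eq0.
Qed.

End L2_norms.

Lemma sqrt_add3_le (R : realType) (a x y : R) : 0 <= a -> 0 <= x -> 0 <= y ->
  Num.sqrt (a ^+ 2 + x + y) <= a + Num.sqrt x + Num.sqrt y.
Proof.
move=> a0 x0 y0.
rewrite -[leRHS]ger0_norm ?addr_ge0 ?sqrtr_ge0// -sqrtr_sqr; apply: ler_wsqrtr.
have := sqr_sqrtr x0; have := sqr_sqrtr y0.
move: (Num.sqrt x) (Num.sqrt y) (sqrtr_ge0 x) (sqrtr_ge0 y) => s t s0 t0 <- <-.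
have := mulr_ge0 a0 s0; have := mulr_ge0 a0 t0; have := mulr_ge0 s0 t0.
by lra.
Qed.

Lemma error_terms_add (R : realType) (n s e d q r : R) : s <= e + d ->
  n + s + q + r <= n + q + (e + r) + d.
Proof. by lra. Qed.

Lemma within_continuous_comp (R : realType) (V : normedModType R) (A : set R)
    (c : R -> V) (g : V -> R) :
  continuous g -> {within A, continuous c} -> {within A, continuous (fun t => g (c t))}.
Proof. by move=> cg cc u; apply: (@continuous_comp (subspace A) V R c g); [exact: cc|exact: cg]. Qed.

(** * The error estimate *)

Section error_estimate.
Context {R : realType} {Q H : completeNormedModType R}.
Local Notation mu := (@lebesgue_measure R).
Variables (ipQ : {dot Q for (@idfun R)}) (ip : {dot H for (@idfun R)}).
Hypotheses (hilbQ : hilbert ipQ) (hilbH : hilbert ip).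
Variables (j : {linear Q -> H}).
Hypotheses (jinj : injective j) (jcont : continuous j).
Variables (Qt : set H) (hQt : finite_dim_subspace Qt).
Variables (T : R) (hT : 0 < T) (f : H).
Variables (b : H -> H -> R) (hb : bilinear_on (Qsum j Qt) b).
Hypotheses (hbcont : continuous_form j b) (hbcoer : coercive_form j b).
Variables (N : H -> R) (hN : norm_on (Qsum j Qt) N).
Hypothesis hNb : forall q : Q, N (j q) ^+ 2 = b (j q) (j q).
Variables (Pi B : H -> H) (E : H -> Q).
Hypothesis hPi : is_orthogonal_projection ip Qt Pi.
Hypothesis hB : is_riesz_representative ip Qt b B.
Hypothesis hE : is_elliptic_reconstruction ip j Qt b f Pi B E.
Variables (p : R -> Q) (dp : R -> Q -> R^o) (pt dpt : R -> H).
Variables (pc : R -> Q) (pd dpd : R -> H).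
Hypothesis hpdp : weak_derivative T (@dual R Q) (@dual_norm R Q)
  (fun t => gelfand ip j (j (p t))) dp.
Hypothesis hptdpt : weak_derivative T Qt (fun x : H => `|x|) pt dpt.
Hypothesis hpddpd : weak_derivative T Qt (fun x : H => `|x|) pd dpd.
Hypothesis hdec : forall t, 0 < t < T -> pt t = j (pc t) + pd t.
Hypothesis p_L2 : (L2norm T (fun q : Q => `|q|)%R p < +oo)%E.
Hypothesis pt_L2 : (L2norm T (fun x : H => `|x|)%R pt < +oo)%E.
Hypothesis dpt_L2 : (L2norm T (fun x : H => `|x|)%R dpt < +oo)%E.
Hypothesis pd_L2 : (L2norm T (fun x : H => `|x|)%R pd < +oo)%E.
Hypothesis dpd_L2 : (L2norm T (fun x : H => `|x|)%R dpd < +oo)%E.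

Variable D : set (measurableTypeR R).
Let I : set (measurableTypeR R) := `]0, T[.
Hypotheses (mD : measurable D) (DI : D `<=` I) (ID0 : mu (I `\` D) = 0%E).
Hypothesis p_meas : smeas D setT (fun q : Q => `|q|) p.
Hypothesis pt_meas : smeas D Qt (fun x : H => `|x|) pt.
Hypothesis dpt_meas : smeas D Qt (fun x : H => `|x|) dpt.
Hypothesis pd_meas : smeas D Qt (fun x : H => `|x|) pd.
Hypothesis dpd_meas : smeas D Qt (fun x : H => `|x|) dpd.
Hypothesis heq : forall t, D t -> forall q : Q,
  dp t q + b (j (p t)) (j q) = ip f (j q).
Hypothesis hgal : forall t, D t -> forall y : H, Qt y ->
  ip (dpt t) y + b (pt t) y = ip f y.

Let sQt : is_subspace Qt := finite_dim_subspace_subspace hQt.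

Let DT t : D t -> 0 < t < T.
Proof. by move=> /DI; rewrite /I/= in_itv. Qed.

Lemma smeas_in (V : lmodType R) (S : set V) (M : V -> R) v t :
  smeas D S M v -> D t -> S (v t).
Proof. by move=> [s [_ h _]]; exact: h. Qed.

Lemma measurable_smeas_continuous (V : normedModType R) (S : set V) (v : R -> V)
    (F : V -> R) : is_subspace S -> smeas D S (fun x => `|x|) v ->
  (forall (u : nat -> V) x, (forall n, S (u n)) -> S x -> u @ \oo --> x ->
    (fun n => F (u n)) @ \oo --> F x) ->
  measurable_fun D (fun t => F (v t)).
Proof.
move=> sS hv cF.
apply: (@measurable_fun_smeas _ _ D S (fun x => `|x|) mD sS (fun _ => F)) => //.
move=> t u x _ Su Sx ux; apply: cF => //; exact: cvg_dist0.
Qed.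

(** The arguments are frozen one after the other, each time by [measurable_fun_smeas]. Continuity in
    the last three is only required along sequences in [Qt], where [E] and [N] are controlled. *)
Lemma measurable_state (Phi : Q -> H -> H -> H -> R) :
  (forall x x0 y y0 z z0 d d0,
    x @ \oo --> x0 ->
    (forall n : nat, Qt (y n)) -> Qt y0 -> y @ \oo --> y0 ->
    (forall n : nat, Qt (z n)) -> Qt z0 -> z @ \oo --> z0 ->
    (forall n : nat, Qt (d n)) -> Qt d0 -> d @ \oo --> d0 ->
    (fun n => Phi (x n) (y n) (z n) (d n)) @ \oo --> Phi x0 y0 z0 d0) ->
  measurable_fun D (fun t => Phi (p t) (pt t) (pd t) (dpd t)).
Proof.
move=> cPhi.
have Qpt t := smeas_in pt_meas (t := t).
have Qpd t := smeas_in pd_meas (t := t).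
have Qdpd t := smeas_in dpd_meas (t := t).
have sT := @setT_subspace R Q.
apply: (@measurable_fun_smeas _ _ D setT _ mD sT
  (fun t x => Phi x (pt t) (pd t) (dpd t)) p p_meas) => [x _|t u x Dt _ _ ux];
  last first.
  apply: cPhi; try (by move=> n; auto); try (by auto); try exact: cvg_cst.
  exact: cvg_dist0.
apply: (@measurable_fun_smeas _ _ D Qt _ mD sQt
  (fun t y => Phi x y (pd t) (dpd t)) pt pt_meas) => [y Qy|t u y Dt Qu Qy uy];
  last first.
  apply: cPhi; try (by move=> n; auto); try (by auto); try exact: cvg_cst.
  exact: cvg_dist0.
apply: (@measurable_fun_smeas _ _ D Qt _ mD sQt
  (fun t z => Phi x y z (dpd t)) pd pd_meas) => [z Qz|t u z Dt Qu Qz uz];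
  last first.
  apply: cPhi; try (by move=> n; auto); try (by auto); try exact: cvg_cst.
  exact: cvg_dist0.
apply: (@measurable_fun_smeas _ _ D Qt _ mD sQt
  (fun t d => Phi x y z d) dpd dpd_meas) => [d Qd|t u d Dt Qu Qd ud].
  exact: measurable_cst.
apply: cPhi; try (by move=> n; auto); try (by auto); try exact: cvg_cst.
exact: cvg_dist0.
Qed.

(** A common majorant: linear quantities are bounded by multiples of [m], products by multiples of
    the integrable [m ^+ 2]. The summand 1 absorbs constants such as [E 0] and gives
    [m <= m ^+ 2]. *)
Let m t := 1 + `|p t| + `|pt t| + `|pd t| + `|dpt t| + `|dpd t|.

Let m_ge t : [/\ 1 <= m t, `|p t| <= m t, `|pt t| <= m t, `|pd t| <= m t &
  `|dpt t| <= m t /\ `|dpd t| <= m t].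
Proof.
rewrite /m; move: (normr_ge0 (p t)) (normr_ge0 (pt t)) (normr_ge0 (pd t)).
move: (normr_ge0 (dpt t)) (normr_ge0 (dpd t)).
by split; [..|split]; lra.
Qed.

Let measurable_norm_smeas (V : normedModType R) (S : set V) (v : R -> V) :
  is_subspace S -> smeas D S (fun x => `|x|) v ->
  measurable_fun D (fun t => `|v t|).
Proof.
move=> sS hv; apply: (measurable_smeas_continuous (F := fun x => `|x|) sS hv).
by move=> u x _ _ ux; exact: cvg_norm.
Qed.

Let mm : measurable_fun D m.
Proof.
rewrite /m; do !apply: measurable_funD => //.
- exact: measurable_norm_smeas (@setT_subspace R Q) p_meas.
- exact: measurable_norm_smeas sQt pt_meas.
- exact: measurable_norm_smeas sQt pd_meas.
- exact: measurable_norm_smeas sQt dpt_meas.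
- exact: measurable_norm_smeas sQt dpd_meas.
Qed.

Let im2 : mu.-integrable D (EFin \o (fun t => m t ^+ 2)).
Proof.
have i1 : mu.-integrable D (EFin \o (fun=> 1)).
  by apply: (bounded_integrable mD DI (M := 1)) => // t _; rewrite normr1.
have i2 := L2norm_lty_integrable mD DI ID0 p_L2
  (measurable_norm_smeas (@setT_subspace R Q) p_meas).
have i3 := L2norm_lty_integrable mD DI ID0 pt_L2 (measurable_norm_smeas sQt pt_meas).
have i4 := L2norm_lty_integrable mD DI ID0 pd_L2 (measurable_norm_smeas sQt pd_meas).
have i5 := L2norm_lty_integrable mD DI ID0 dpt_L2 (measurable_norm_smeas sQt dpt_meas).
have i6 := L2norm_lty_integrable mD DI ID0 dpd_L2 (measurable_norm_smeas sQt dpd_meas).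
have i := integrableZl mD 6 (integrableD mD (integrableD mD (integrableD mD
  (integrableD mD (integrableD mD i1 i2) i3) i4) i5) i6).
(* The square of a sum of six terms is at most six times the sum of the squares; the gap is the sum
   of the fifteen squared pairwise differences. *)
apply: (@integrable_le _ _ _ _ D mD _ (fun t => 6 * (1 + `|p t| ^+ 2 + `|pt t| ^+ 2
  + `|pd t| ^+ 2 + `|dpt t| ^+ 2 + `|dpd t| ^+ 2))).
- exact: measurable_funX.
- exact: i.
- move=> t _; rewrite ger0_norm ?sqr_ge0// /m.
  move: `|p t| `|pt t| `|pd t| `|dpt t| `|dpd t| => x1 x2 x3 x4 x5.
  have : 0 <= (1 - x1) ^+ 2 + (1 - x2) ^+ 2 + (1 - x3) ^+ 2 + (1 - x4) ^+ 2 +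
    (1 - x5) ^+ 2 + (x1 - x2) ^+ 2 + (x1 - x3) ^+ 2 + (x1 - x4) ^+ 2 + (x1 - x5) ^+ 2
    + (x2 - x3) ^+ 2 + (x2 - x4) ^+ 2 + (x2 - x5) ^+ 2 + (x3 - x4) ^+ 2
    + (x3 - x5) ^+ 2 + (x4 - x5) ^+ 2.
    by do !apply: addr_ge0; exact: sqr_ge0.
  by lra.
Qed.

Let idom (h : R -> R) C : measurable_fun D h ->
  (forall t, D t -> `|h t| <= C * m t ^+ 2) -> mu.-integrable D (EFin \o h).
Proof.
move=> mh hC; apply: (integrable_le mD mh _ hC).
exact: (integrableZl mD C im2).
Qed.

Let m_sq t : m t <= m t ^+ 2.
Proof.
by have [m1 _ _ _ _] := m_ge t; rewrite expr2 ler_peMl// (le_trans ler01).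
Qed.

Let measurable_ip (v : R -> H) (z : H) : smeas D Qt (fun x => `|x|) v ->
  measurable_fun D (fun t => ip (v t) z).
Proof.
move=> hv; apply: (measurable_smeas_continuous (F := fun x => ip x z) sQt hv).
move=> x x0 _ _ xx0; apply: cvg_dist0.
apply: (@cvg_squeeze0 _ _ (fun n => `|x n - x0| * `|z|)).
  by move=> n; rewrite normr_id -ipBl; exact: cauchy_schwarz.
by rewrite -(mul0r `|z|); apply: cvgMl; exact: dist_cvg0.
Qed.

Let weak_H (u v : R -> H) (z : H) (phi : R -> R) :
  weak_derivative T Qt (fun x : H => `|x|) u v ->
  smeas D Qt (fun x => `|x|) u -> smeas D Qt (fun x => `|x|) v ->
  test_function T phi ->
  [/\ mu.-integrable D (EFin \o (fun t => derive1 phi t * ip (u t) z)),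
      mu.-integrable D (EFin \o (fun t => phi t * ip (v t) z))
    & \int[mu]_(t in D) (derive1 phi t * ip (u t) z) =
      - \int[mu]_(t in D) (phi t * ip (v t) z)].
Proof.
move=> huv hu hv tphi.
apply: (weak_derivative_linear (l := fun x => ip x z) (M := `|z| + 1) mD DI ID0 sQt _ _ _ _ huv tphi).
- by move=> a x y; exact: ipPl.
- move=> x _; apply: le_trans (cauchy_schwarz hilbH _ _) _.
  by rewrite mulrC ler_wpM2r// lerDl.
- by move=> x _; exact: normr_ge0.
- by rewrite ltr_wpDl.
- exact: measurable_ip.
- exact: measurable_ip.
Qed.

Let ip_dom (v : R -> H) (z : H) : smeas D Qt (fun x => `|x|) v ->
  (forall t, `|v t| <= m t) -> mu.-integrable D (EFin \o (fun t => ip (v t) z)).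
Proof.
move=> hv vm; apply: (@idom _ `|z|); first exact: measurable_ip.
move=> t _; apply: le_trans (cauchy_schwarz hilbH _ _) _.
by rewrite mulrC ler_wpM2l//; exact: le_trans (vm t) (m_sq t).
Qed.

Let component_ae (z : H) : exists k : R,
  mu.-integrable D (EFin \o (fun t => ip (dpt t) z - ip (dpd t) z)) /\
  {ae mu, forall t, D t -> ip (pt t - pd t) z =
    k + primitive D (fun t => ip (dpt t) z - ip (dpd t) z) t}.
Proof.
have i1 : mu.-integrable D (EFin \o (fun t => ip (pt t) z)).
  by apply: ip_dom => // t; have [] := m_ge t.
have i2 : mu.-integrable D (EFin \o (fun t => ip (pd t) z)).
  by apply: ip_dom => // t; have [] := m_ge t.
have i3 : mu.-integrable D (EFin \o (fun t => ip (dpt t) z)).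
  by apply: ip_dom => // t; have [_ _ _ _ []] := m_ge t.
have i4 : mu.-integrable D (EFin \o (fun t => ip (dpd t) z)).
  by apply: ip_dom => // t; have [_ _ _ _ []] := m_ge t.
have i12 : mu.-integrable D (EFin \o (fun t => ip (pt t - pd t) z)).
  have := integrableB mD i1 i2; apply: eq_integrable => // t _ /=.
  by rewrite ipBl.
have i34 : mu.-integrable D (EFin \o (fun t => ip (dpt t) z - ip (dpd t) z)).
  by have := integrableB mD i3 i4; exact: eq_integrable.
have [|k hk] := weak_derivative_ae mD DT i12 i34; last by exists k.
move=> phi tphi.
have [a1 a2 a3] := weak_H z hptdpt pt_meas dpt_meas tphi.
have [b1 b2 b3] := weak_H z hpddpd pd_meas dpd_meas tphi.
transitivity (\int[mu]_(t in D) (derive1 phi t * ip (pt t) z)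
    - \int[mu]_(t in D) (derive1 phi t * ip (pd t) z)).
  rewrite -(RintegralB mD a1 b1); apply: eq_Rintegral => t _.
  by rewrite ipBl mulrBr.
rewrite a3 b3 -opprD; congr (- _); rewrite -(RintegralB mD a2 b2).
by apply: eq_Rintegral => t _; rewrite mulrBr.
Qed.

Lemma conforming_part_continuous : exists z : R -> H,
  {within `[0, T], continuous z} /\ {ae mu, forall t, D t -> z t = j (pc t)}.
Proof.
have [fs [Sfs fsE]] := Qt_frame hilbH hQt.
suff [z [cz hz]] : exists z : R -> H, {within `[0, T], continuous z} /\
    {ae mu, forall t, D t -> z t = \sum_(g <- fs) ip (pt t - pd t) g *: g}.
  exists z; split => //; apply: ae_sub hz => t hz Dt; rewrite hz//.
  have Qd : Qt (pt t - pd t).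
    by apply: subspaceB => //; [exact: smeas_in pt_meas Dt|exact: smeas_in pd_meas Dt].
  by rewrite -(fsE _ Qd) (hdec (DT Dt)) addrK.
elim: fs {Sfs fsE} => [|g fs [z [cz hz]]].
  exists (fun=> 0); split; first by move=> t; exact: cst_continuous.
  by apply: aeW => t _; rewrite big_nil.
have [k [ik hk]] := component_ae g.
have cprim := primitive_continuous mD (ltW hT) ik.
exists (fun t => (k + primitive D (fun t => ip (dpt t) g - ip (dpd t) g) t) *: g + z t).
split.
  move=> t; apply: cvgD; last exact: cz.
  by apply: cvgZr_tmp; apply: cvgD; [exact: cvg_cst|exact: cprim].
apply: ae_sub (ae_and hk hz) => t [h1 h2] Dt.
by rewrite big_cons h1// h2.
Qed.

Section continuous_representative.
Variables (L : H -> Q) (CL : R).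
Hypotheses (CL0 : 0 <= CL) (hCL : forall x y, `|L x - L y| <= CL * `|x - y|).
Hypothesis LQ : forall q, Qt (j q) -> L (j q) = q.
Variable c : R -> H.
Hypothesis cc : {within `[0, T], continuous c}.
Hypothesis cE : forall t, D t -> c t = j (p t) - j (pc t).

(** The functions r, s, w of the overview, with [L (pt t - pd t)] in place of [pc t]: the two agree
    on [D], but only the former is visibly measurable. *)
Let rr t := p t - E (pt t).
Let ss t := E (pt t) - L (pt t - pd t).
Let ww t := p t - L (pt t - pd t).
Let gg t q := ip (dpd t) (j q) - b (j (rr t)) (j q).

Let pcE t : D t -> L (pt t - pd t) = pc t.
Proof.
move=> Dt; have Qd : Qt (pt t - pd t).
  by apply: subspaceB => //; [exact: smeas_in pt_meas Dt|exact: smeas_in pd_meas Dt].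
by move: Qd; rewrite (hdec (DT Dt)) addrK => /LQ.
Qed.

Let rs t : ww t = rr t + ss t.
Proof. by rewrite /ww /rr /ss addrA subrK. Qed.

Let cw t : D t -> c t = j (ww t).
Proof. by move=> Dt; rewrite cE// /ww pcE// linearB. Qed.

Let Qj q : Qsum j Qt (j q). Proof. exact: Qsum_j. Qed.

(** The left side is the time derivative of [ec] tested with [q]. By the parabolic equation and the
    extended Galerkin equation, [f] and [dpt] cancel and the form of [rr] remains. *)
Let ggE t q : D t -> dp t q - ip (dpt t) (j q) + ip (dpd t) (j q) = gg t q.
Proof.
move=> Dt; have Qpt := smeas_in pt_meas Dt; have Qdpt := smeas_in dpt_meas Dt.
have hg := reconstruction_galerkin hilbH hQt hPi hB hE Qpt Qdpt (hgal Dt) q.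
rewrite /gg /rr linearB (formBl hb)// hg ipBl; have := heq Dt q.
move: (ip f (j q)) (b (j (p t)) (j q)) (dp t q : R) (ip (dpt t) (j q)) (ip (dpd t) (j q)).
by move=> x1 x2 x3 x4 x5 <-; ring.
Qed.

Let cvg_E (y : nat -> H) y0 : (forall n, Qt (y n)) -> Qt y0 -> y @ \oo --> y0 ->
  (fun n => E (y n)) @ \oo --> E y0.
Proof.
move=> Qy Qy0 yy0.
have [C C0 hC] := reconstruction_lipschitz hilbH jcont hQt hb hbcoer hB hE.
apply: cvg_dist0; apply: (@cvg_squeeze0 _ _ (fun n => C * `|y n - y0|)).
  by move=> n; rewrite normr_id; exact: hC.
by rewrite -(mulr0 C); apply: cvgMr; exact: dist_cvg0.
Qed.

Let cvg_L (y : nat -> H) y0 : y @ \oo --> y0 -> (fun n => L (y n)) @ \oo --> L y0.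
Proof.
move=> yy0; apply: cvg_dist0; apply: (@cvg_squeeze0 _ _ (fun n => CL * `|y n - y0|)).
  by move=> n; rewrite normr_id; exact: hCL.
by rewrite -(mulr0 CL); apply: cvgMr; exact: dist_cvg0.
Qed.

Let cvg_j (x : nat -> Q) x0 : x @ \oo --> x0 -> (fun n => j (x n)) @ \oo --> j x0.
Proof. by move=> xx0; apply: (cvg_comp _ _ xx0); exact: jcont. Qed.

Let cvg_ip (x y : nat -> H) x0 y0 : x @ \oo --> x0 -> y @ \oo --> y0 ->
  (fun n => ip (x n) (y n)) @ \oo --> ip x0 y0.
Proof.
move=> xx yy; apply: cvg_dist0.
apply: (@cvg_squeeze0 _ _ (fun n => `|x n - x0| * `|y n| + `|x0| * `|y n - y0|)).
  move=> n; rewrite normr_id.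
  have -> : ip (x n) (y n) - ip x0 y0 = ip (x n - x0) (y n) + ip x0 (y n - y0).
    by rewrite ipBl ipBr addrA subrK.
  by apply: le_trans (ler_normD _ _) (lerD _ _); exact: cauchy_schwarz.
rewrite (_ : 0 = 0 * `|y0| + `|x0| * 0); last by rewrite mul0r mulr0 addr0.
apply: cvgD; last by apply: cvgMr; exact: dist_cvg0.
by apply: cvgM; [exact: dist_cvg0|exact: cvg_norm].
Qed.

Let cvg_b (x y : nat -> Q) x0 y0 : x @ \oo --> x0 -> y @ \oo --> y0 ->
  (fun n => b (j (x n)) (j (y n))) @ \oo --> b (j x0) (j y0).
Proof.
move=> xx yy; have [M hM] := hbcont; apply: cvg_dist0.
apply: (@cvg_squeeze0 _ _ (fun n => M * `|x n - x0| * `|y n| + M * `|x0| * `|y n - y0|)).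
  move=> n; rewrite normr_id.
  have -> : b (j (x n)) (j (y n)) - b (j x0) (j y0) =
      b (j (x n - x0)) (j (y n)) + b (j x0) (j (y n - y0)).
    by rewrite !linearB (formBl hb)// (formBr hb)// addrA subrK.
  by apply: le_trans (ler_normD _ _) (lerD _ _); exact: hM.
rewrite (_ : 0 = M * 0 * `|y0| + M * `|x0| * 0); last by rewrite !mulr0 mul0r addr0.
apply: cvgD; last by apply: cvgMr; exact: dist_cvg0.
by apply: cvgM; [apply: cvgMr; exact: dist_cvg0|exact: cvg_norm].
Qed.

Let cvg_N (x : nat -> H) x0 : (forall n, Qsum j Qt (x n)) -> Qsum j Qt x0 ->
  (fun n => N (x n - x0)) @ \oo --> (0 : R) ->
  (fun n => N (x n)) @ \oo --> N x0.
Proof.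
move=> Sx Sx0 xx0; apply: cvg_dist0; apply: cvg_squeeze0 xx0 => n.
by rewrite normr_id; apply: (norm_on_dist (Qsum_subspace j hQt) hN).
Qed.

Let cvg_Nj0 (x : nat -> Q) x0 : x @ \oo --> x0 ->
  (fun n => N (j (x n - x0))) @ \oo --> (0 : R).
Proof.
move=> xx0; have [C C0 hC] := N_j_le hQt hbcont hN hNb.
apply: (@cvg_squeeze0 _ _ (fun n => C * `|x n - x0|)).
  move=> n; rewrite ger0_norm; first exact: hC.
  exact: (N_ge0 hQt hN).
by rewrite -(mulr0 C); apply: cvgMr; exact: dist_cvg0.
Qed.

Let cvg_Nj (x : nat -> Q) x0 : x @ \oo --> x0 ->
  (fun n => N (j (x n))) @ \oo --> N (j x0).
Proof.
move=> xx0; apply: cvg_N => //.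
by have := cvg_Nj0 xx0; under eq_fun do rewrite linearB.
Qed.

Let cvg_NQt0 (y : nat -> H) y0 : (forall n, Qt (y n)) -> Qt y0 -> y @ \oo --> y0 ->
  (fun n => N (y n - y0)) @ \oo --> (0 : R).
Proof.
move=> Qy Qy0 yy0; have [C C0 hC] := N_Qt_le hilbH hQt hN.
apply: (@cvg_squeeze0 _ _ (fun n => C * `|y n - y0|)).
  have [N0 _ _ _] := hN.
  move=> n; have Qd : Qt (y n - y0) by exact: subspaceB.
  rewrite ger0_norm; first exact: hC.
  by apply: N0; exact: Qsum_Qt.
by rewrite -(mulr0 C); apply: cvgMr; exact: dist_cvg0.
Qed.

Let mNr : measurable_fun D (fun t => N (j (rr t))).
Proof.
apply: (measurable_state (Phi := fun x y z d => N (j (x - E y)))).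
move=> x x0 y y0 z z0 d d0 xx Qy Qy0 yy _ _ _ _ _ _.
by apply: cvg_Nj; apply: cvgB => //; exact: cvg_E.
Qed.

Let mNs : measurable_fun D (fun t => N (j (ss t))).
Proof.
apply: (measurable_state (Phi := fun x y z d => N (j (E y - L (y - z))))).
move=> x x0 y y0 z z0 d d0 xx Qy Qy0 yy _ _ zz _ _ _.
by apply: cvg_Nj; apply: cvgB; [exact: cvg_E|apply: cvg_L; exact: cvgB].
Qed.

Let mw : measurable_fun D (fun t => `|ww t|).
Proof.
apply: (measurable_state (Phi := fun x y z d => `|x - L (y - z)|)).
move=> x x0 y y0 z z0 d d0 xx Qy Qy0 yy _ _ zz _ _ _.
by apply: cvg_norm; apply: cvgB => //; apply: cvg_L; exact: cvgB.
Qed.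

Let mr : measurable_fun D (fun t => `|rr t|).
Proof.
apply: (measurable_state (Phi := fun x y z d => `|x - E y|)).
move=> x x0 y y0 z z0 d d0 xx Qy Qy0 yy _ _ _ _ _ _.
by apply: cvg_norm; apply: cvgB => //; exact: cvg_E.
Qed.

Let mgg (u : Q -> Q) : continuous u -> measurable_fun D (fun t => gg t (u (ww t))).
Proof.
move=> cu; apply: (measurable_state (Phi := fun x y z d =>
  ip d (j (u (x - L (y - z)))) - b (j (x - E y)) (j (u (x - L (y - z)))))).
move=> x x0 y y0 z z0 d d0 xx Qy Qy0 yy _ _ zz _ _ dd.
have cuw : (fun n => u (x n - L (y n - z n))) @ \oo --> u (x0 - L (y0 - z0)).
  apply: continuous_cvg; first exact: cu.
  by apply: cvgB => //; apply: cvg_L; exact: cvgB.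
apply: cvgB; first by apply: cvg_ip => //; exact: cvg_j.
by apply: cvg_b => //; apply: cvgB => //; exact: cvg_E.
Qed.

Let cvg_Ndiff (x : nat -> Q) x0 (y : nat -> H) y0 : x @ \oo --> x0 ->
  (forall n, Qt (y n)) -> Qt y0 -> y @ \oo --> y0 ->
  (fun n => N (j (x n) - y n)) @ \oo --> N (j x0 - y0).
Proof.
move=> xx Qy Qy0 yy.
have SS := Qsum_subspace j hQt.
have SQ v : Qt v -> Qsum j Qt v by exact: Qsum_Qt.
apply: cvg_N.
- by move=> n; apply: subspaceB => //; exact: SQ.
- by apply: subspaceB => //; exact: SQ.
apply: (@cvg_squeeze0 _ _ (fun n => N (j (x n - x0)) + N (y n - y0))).
  have [N0 _ _ ND] := hN.
  move=> n; have Sd : Qsum j Qt (y n - y0) by apply: subspaceB => //; exact: SQ.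
  rewrite ger0_norm; last by apply: N0; do !apply: subspaceB => //; exact: SQ.
  rewrite (_ : _ - _ = j (x n - x0) - (y n - y0)).
    by apply: le_trans (ND _ _ _ _) _ => //; rewrite ?(norm_onN hN)// -scaleN1r; exact: subspaceZ.
  by rewrite (linearB j) !opprB [LHS]addrACA [RHS]addrACA; congr (_ + _); rewrite addrC.
by rewrite -[0]addr0; apply: cvgD; [exact: cvg_Nj0|exact: cvg_NQt0].
Qed.

Let meps : measurable_fun D (fun t => N (j (E (pt t)) - pt t)).
Proof.
apply: (measurable_state (Phi := fun x y z d => N (j (E y) - y))).
move=> x x0 y y0 z z0 d d0 xx Qy Qy0 yy _ _ _ _ _ _.
by apply: cvg_Ndiff => //; exact: cvg_E.
Qed.

Let me : measurable_fun D (fun t => N (j (p t) - pt t)).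
Proof.
apply: (measurable_state (Phi := fun x y z d => N (j x - y))).
by move=> x x0 y y0 z z0 d d0 xx Qy Qy0 yy _ _ _ _ _ _; exact: cvg_Ndiff.
Qed.

Let mNpd : measurable_fun D (fun t => N (pd t)).
Proof.
apply: (measurable_smeas_continuous (F := N) sQt pd_meas) => u x Qu Qx ux.
apply: cvg_N; [by move=> n; exact: Qsum_Qt|exact: Qsum_Qt|exact: cvg_NQt0].
Qed.

Let mDd : measurable_fun D (fun t => norm_Qm1 ip j N (dpd t)).
Proof.
apply: (measurable_smeas_continuous (F := norm_Qm1 ip j N) sQt dpd_meas) => u x Qu Qx ux.
have [C C0 hC] := norm_Qm1_lipschitz hilbH jcont hQt hbcoer hN hNb.
apply: cvg_dist0; apply: (@cvg_squeeze0 _ _ (fun n => C * `|u n - x|)).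
  by move=> n; rewrite normr_id.
by rewrite -(mulr0 C); apply: cvgMr; exact: dist_cvg0.
Qed.

Let Epm : exists2 C : R, 0 <= C & forall t, D t -> `|E (pt t)| <= C * m t.
Proof.
have [C C0 hC] := reconstruction_lipschitz hilbH jcont hQt hb hbcoer hB hE.
exists (`|E 0| + C); first by rewrite addr_ge0.
move=> t Dt; have [m1 _ ptm _ _] := m_ge t.
have := hC _ _ (smeas_in pt_meas Dt) (subspace0 sQt); rewrite subr0 => h.
rewrite -[E (pt t)](subrK (E 0)); apply: le_trans (ler_normD _ _) _.
rewrite addrC mulrDl; apply: lerD; first by rewrite ler_peMr.
by apply: le_trans h _; rewrite ler_wpM2l.
Qed.

Let Lm : exists2 C : R, 0 <= C & forall t, `|L (pt t - pd t)| <= C * m t.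
Proof.
exists (`|L 0| + CL * 2); first by rewrite addr_ge0// mulr_ge0.
move=> t; have [m1 _ ptm pdm _] := m_ge t.
have := hCL (pt t - pd t) 0; rewrite subr0 => h.
rewrite -[L (_ - _)](subrK (L 0)); apply: le_trans (ler_normD _ _) _.
rewrite addrC mulrDl; apply: lerD; first by rewrite ler_peMr.
apply: le_trans h _; rewrite -mulrA ler_wpM2l//.
apply: le_trans (ler_normB _ _) _.
by move: ptm pdm; move: (m t) `|pt t| `|pd t| => m0 a a'; lra.
Qed.

Let state_bound : exists2 C : R, 0 <= C & forall t, D t ->
  [/\ `|rr t| <= C * m t, `|ss t| <= C * m t & `|ww t| <= C * m t].
Proof.
have [C1 C10 h1] := Epm; have [C2 C20 h2] := Lm.
exists (1 + C1 + C2); first by rewrite !addr_ge0.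
move=> t Dt; have [m1 pm _ _ _] := m_ge t.
have h1t := h1 t Dt; have h2t := h2 t.
have m0 : 0 <= m t by apply: le_trans m1.
have c1 : 0 <= C1 * m t by exact: mulr_ge0.
have c2 : 0 <= C2 * m t by exact: mulr_ge0.
rewrite !mulrDl mul1r; split; apply: le_trans (ler_normB _ _) _.
- by apply: le_trans (lerD pm h1t) _; rewrite lerDl.
- by apply: le_trans (lerD h1t h2t) _; rewrite lerD2r lerDr.
- by apply: le_trans (lerD pm h2t) _; rewrite lerD2r lerDl.
Qed.

Let sqdom (h : R -> R) C : measurable_fun D h ->
  (forall t, D t -> `|h t| <= C * m t) ->
  mu.-integrable D (EFin \o (fun t => h t ^+ 2)).
Proof.
move=> mh hC; apply: (@idom _ (C ^+ 2)); first exact: measurable_funX.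
move=> t Dt; rewrite normrX -exprMn ler_pXn2r ?nnegrE ?hC//.
exact: le_trans (normr_ge0 _) (hC t Dt).
Qed.

Let iNr : mu.-integrable D (EFin \o (fun t => N (j (rr t)) ^+ 2)).
Proof.
have [C C0 hC] := state_bound; have [CN CN0 hCN] := N_j_le hQt hbcont hN hNb.
apply: (sqdom (C := CN * C) mNr) => t Dt; have [hr _ _] := hC t Dt.
rewrite ger0_norm; last exact: (N_ge0 hQt hN).
by apply: le_trans (hCN _) _; rewrite -mulrA ler_wpM2l.
Qed.

Let iNs : mu.-integrable D (EFin \o (fun t => N (j (ss t)) ^+ 2)).
Proof.
have [C C0 hC] := state_bound; have [CN CN0 hCN] := N_j_le hQt hbcont hN hNb.
apply: (sqdom (C := CN * C) mNs) => t Dt; have [_ hs _] := hC t Dt.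
rewrite ger0_norm; last exact: (N_ge0 hQt hN).
by apply: le_trans (hCN _) _; rewrite -mulrA ler_wpM2l.
Qed.

Let iNpd : mu.-integrable D (EFin \o (fun t => N (pd t) ^+ 2)).
Proof.
have [CQ CQ0 hCQ] := N_Qt_le hilbH hQt hN; have [N0 _ _ _] := hN.
apply: (sqdom (C := CQ) mNpd) => t Dt; have [_ _ _ pdm _] := m_ge t.
have Qpd := smeas_in pd_meas Dt.
rewrite ger0_norm; last by apply: N0; exact: Qsum_Qt.
by apply: le_trans (hCQ _ Qpd) _; rewrite ler_wpM2l.
Qed.

Let iDd : mu.-integrable D (EFin \o (fun t => norm_Qm1 ip j N (dpd t) ^+ 2)).
Proof.
have [C C0 hC] := norm_Qm1_lipschitz hilbH jcont hQt hbcoer hN hNb.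
apply: (sqdom (C := `|norm_Qm1 ip j N 0| + C) mDd) => t Dt.
have [m1 _ _ _ [_ dpdm]] := m_ge t.
rewrite -[norm_Qm1 _ _ _ (dpd t)](subrK (norm_Qm1 ip j N 0)).
apply: le_trans (ler_normD _ _) _.
rewrite addrC mulrDl; apply: lerD; first by rewrite ler_peMr.
by apply: le_trans (hC _ _) _; rewrite subr0 ler_wpM2l.
Qed.

Let eps_le t : D t -> 0 <= N (j (E (pt t)) - pt t) <= N (j (E (pt t))) + N (pt t).
Proof.
move=> Dt; have Qpt := smeas_in pt_meas Dt; have [N0 _ _ ND] := hN.
have SS := Qsum_subspace j hQt.
have Sp : Qsum j Qt (pt t) by exact: Qsum_Qt.
apply/andP; split; first by apply: N0; exact: subspaceB.
rewrite -(norm_onN hN Sp); apply: ND => //.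
by rewrite -scaleN1r; exact: subspaceZ.
Qed.

Let ieps : mu.-integrable D (EFin \o (fun t => N (j (E (pt t)) - pt t) ^+ 2)).
Proof.
have [C C0 hC] := Epm; have [CN CN0 hCN] := N_j_le hQt hbcont hN hNb.
have [CQ CQ0 hCQ] := N_Qt_le hilbH hQt hN.
apply: (sqdom (C := CN * C + CQ) meps) => t Dt.
have Qpt := smeas_in pt_meas Dt; have [_ _ ptm _ _] := m_ge t.
have [n0 nle] := andP (eps_le Dt).
rewrite ger0_norm// mulrDl; apply: le_trans nle _; apply: lerD.
  by apply: le_trans (hCN _) _; rewrite -mulrA ler_wpM2l// hC.
by apply: le_trans (hCQ _ Qpt) _; rewrite ler_wpM2l.
Qed.

Let e_le t : D t -> 0 <= N (j (p t) - pt t) <=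
  N (j (rr t)) + N (j (E (pt t)) - pt t).
Proof.
move=> Dt; have Qpt := smeas_in pt_meas Dt; have [N0 _ _ ND] := hN.
have SS := Qsum_subspace j hQt.
have Sp : Qsum j Qt (pt t) by exact: Qsum_Qt.
apply/andP; split; first by apply: N0; exact: subspaceB.
have -> : j (p t) - pt t = j (rr t) + (j (E (pt t)) - pt t).
  by rewrite /rr linearB addrA subrK.
by apply: ND => //; exact: subspaceB.
Qed.

Let ie : mu.-integrable D (EFin \o (fun t => N (j (p t) - pt t) ^+ 2)).
Proof.
apply: (integrable_le (k := fun t => 2 * (N (j (rr t)) ^+ 2 +
    N (j (E (pt t)) - pt t) ^+ 2)) mD).
- exact: measurable_funX.
- by have := integrableZl mD 2 (integrableD mD iNr ieps); exact: eq_integrable.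
- move=> t Dt; have [n0 nle] := andP (e_le Dt).
  rewrite ger0_norm ?sqr_ge0//.
  move: (N (j (p t) - pt t)) (N (j (rr t))) (N (j (E (pt t)) - pt t)) n0 nle => a a1 a2 a0 ale.
  apply: (@le_trans _ _ ((a1 + a2) ^+ 2)).
    have a12 := le_trans a0 ale.
    rewrite -subr_ge0 subr_sqr; apply: mulr_ge0; first by rewrite subr_ge0.
    exact: (addr_ge0 a12 a0).
  rewrite -subr_ge0 (_ : _ - _ = (a1 - a2) ^+ 2) ?sqr_ge0//; ring.
Qed.

Let s_le t : D t -> 0 <= N (j (ss t)) <= N (j (E (pt t)) - pt t) + N (pd t).
Proof.
move=> Dt; have Qpt := smeas_in pt_meas Dt; have [N0 _ _ ND] := hN.
have Qpd := smeas_in pd_meas Dt.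
have SS := Qsum_subspace j hQt.
have Sp : Qsum j Qt (pt t) by exact: Qsum_Qt.
rewrite (N_ge0 hQt hN)/=.
have -> : j (ss t) = (j (E (pt t)) - pt t) + pd t.
  by rewrite /ss (pcE Dt) linearB {3}(hdec (DT Dt)) opprD addrA subrK.
by apply: ND; [exact: subspaceB|exact: Qsum_Qt].
Qed.

Let cont_ip (z : H) : continuous (fun x => ip x z : R).
Proof.
move=> x; apply/cvgrPdist_lt => e e0.
have z0 : 0 < `|z| + 1 by rewrite ltr_wpDl.
have e1 : 0 < e / (`|z| + 1) by rewrite divr_gt0.
have : \forall y \near x, `|x - y| < e / (`|z| + 1) by exact: cvgr_dist_lt.
apply: filterS => y xy; rewrite -ipBl.
apply: le_lt_trans (cauchy_schwarz hilbH _ _) _.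
apply: (@le_lt_trans _ _ (`|x - y| * (`|z| + 1))); first by rewrite ler_wpM2l// lerDl.
by rewrite -ltr_pdivlMr.
Qed.

Let gg_bound : exists2 C : R, 0 <= C & forall t q, D t -> `|gg t q| <= C * m t * `|q|.
Proof.
have [M hM] := hbcont; have [K K0 jK] := continuous_linear_lipschitz jcont.
have [C C0 hC] := state_bound.
exists (K + `|M| * C); first by rewrite addr_ge0 ?(ltW K0)// mulr_ge0.
move=> t q Dt; have [hr _ _] := hC t Dt; have [_ _ _ _ [_ dpdm]] := m_ge t.
apply: le_trans (ler_normB _ _) _; rewrite 2!mulrDl; apply: lerD.
  apply: le_trans (cauchy_schwarz hilbH _ _) _.
  rewrite (_ : K * m t * `|q| = m t * (K * `|q|)); last by ring.
  by apply: ler_pM.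
apply: le_trans (hM _ _) _; rewrite ler_wpM2r//.
apply: (@le_trans _ _ (`|M| * `|rr t|)); first by rewrite ler_wpM2r// ler_norm.
by rewrite -mulrA ler_wpM2l.
Qed.

Let mgq q : measurable_fun D (fun t => gg t q).
Proof. by apply: (@mgg (fun=> q)) => x; exact: cst_continuous. Qed.

Let igg q : mu.-integrable D (EFin \o (fun t => gg t q)).
Proof.
have [C C0 hC] := gg_bound; apply: (idom (C := C * `|q|) (mgq q)) => t Dt.
apply: le_trans (hC t q Dt) _; rewrite mulrAC ler_wpM2l ?mulr_ge0//.
Qed.

Let mjp q : measurable_fun D (fun t => ip (j (p t)) (j q)).
Proof.
apply: (measurable_state (Phi := fun x y z d => ip (j x) (j q))).
by move=> *; apply: cvg_ip; [exact: cvg_j|exact: cvg_cst].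
Qed.

(** Read off from the equation, whose other terms depend continuously on [p]. *)
Let mdp q : measurable_fun D (fun t => dp t q).
Proof.
have h : measurable_fun D (fun t => ip f (j q) - b (j (p t)) (j q)).
  apply: (measurable_state (Phi := fun x y z d => ip f (j q) - b (j x) (j q))).
  by move=> *; apply: cvgB; [exact: cvg_cst|apply: cvg_b => //; exact: cvg_cst].
apply: eq_measurable_fun h => t /set_mem Dt.
by rewrite -(heq Dt q) addrK.
Qed.

Let weak_p q (phi : R -> R) : test_function T phi ->
  [/\ mu.-integrable D (EFin \o (fun t => derive1 phi t * ip (j (p t)) (j q))),
      mu.-integrable D (EFin \o (fun t => phi t * (dp t q : R)))
    & \int[mu]_(t in D) (derive1 phi t * ip (j (p t)) (j q)) =
      - \int[mu]_(t in D) (phi t * (dp t q : R))].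
Proof.
move=> tphi.
apply: (weak_derivative_linear (V := Q -> R^o) (l := fun x => x q) (M := `|q| + 1)
  mD DI ID0 (@dual_subspace R Q) _ _ _ _ hpdp tphi).
- by [].
- move=> x dx; apply: le_trans (dual_norm_spec q dx) _.
  by rewrite mulrC ler_wpM2r ?dual_norm_ge0// lerDl.
- by move=> x dx; exact: dual_norm_ge0.
- by rewrite ltr_wpDl.
- exact: mjp.
- exact: mdp.
Qed.

(** On [D], [al] coincides with [ip (c t) (j q)] and has weak derivative [gg], so it is almost
    everywhere a constant plus the primitive of [gg]. Both sides being continuous, equality holds on
    the whole of [[0, T]], including time 0. *)
Let gg_increment q s t : 0 <= s -> s <= t -> t <= T ->
  ip (c t - c s) (j q) = \int[mu]_(x in D `&` [set` `]s, t]]) gg x q.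
Proof.
move=> s0 st tT.
have [K K0 jK] := continuous_linear_lipschitz jcont.
pose al t := ip (j (p t)) (j q) - ip (pt t) (j q) + ip (pd t) (j q).
have i1 : mu.-integrable D (EFin \o (fun t => ip (j (p t)) (j q))).
  apply: (idom (C := K * `|j q|) (mjp q)) => u Du.
  have [_ pm _ _ _] := m_ge u.
  apply: le_trans (cauchy_schwarz hilbH _ _) _; rewrite mulrAC ler_wpM2r//.
  apply: le_trans (jK _) _; rewrite ler_wpM2l ?(ltW K0)//.
  exact: le_trans pm (m_sq u).
have i2 : mu.-integrable D (EFin \o (fun t => ip (pt t) (j q))).
  by apply: ip_dom => // u; have [] := m_ge u.
have i3 : mu.-integrable D (EFin \o (fun t => ip (pd t) (j q))).
  by apply: ip_dom => // u; have [] := m_ge u.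
have ial : mu.-integrable D (EFin \o al).
  by have := integrableD mD (integrableB mD i1 i2) i3; exact: eq_integrable.
have [|k hk] := weak_derivative_ae mD DT ial (igg q).
  move=> phi tphi.
  have [a1 a2 a3] := weak_p q tphi.
  have [b1 b2 b3] := weak_H (j q) hptdpt pt_meas dpt_meas tphi.
  have [d1 d2 d3] := weak_H (j q) hpddpd pd_meas dpd_meas tphi.
  have ab1 : mu.-integrable D (EFin \o (fun t => derive1 phi t * ip (j (p t)) (j q)
      - derive1 phi t * ip (pt t) (j q))).
    by have := integrableB mD a1 b1; exact: eq_integrable.
  have ab2 : mu.-integrable D (EFin \o (fun t => phi t * (dp t q : R)
      - phi t * ip (dpt t) (j q))).
    by have := integrableB mD a2 b2; exact: eq_integrable.
  have -> : \int[mu]_(t in D) (derive1 phi t * al t) =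
      \int[mu]_(t in D) (derive1 phi t * ip (j (p t)) (j q))
      - \int[mu]_(t in D) (derive1 phi t * ip (pt t) (j q))
      + \int[mu]_(t in D) (derive1 phi t * ip (pd t) (j q)).
    rewrite -(RintegralB mD a1 b1) -(RintegralD mD ab1 d1).
    by apply: eq_Rintegral => u _; rewrite /al mulrDr mulrBr.
  have -> : \int[mu]_(t in D) (phi t * gg t q) =
      \int[mu]_(t in D) (phi t * (dp t q : R))
      - \int[mu]_(t in D) (phi t * ip (dpt t) (j q))
      + \int[mu]_(t in D) (phi t * ip (dpd t) (j q)).
    rewrite -(RintegralB mD a2 b2) -(RintegralD mD ab2 d2).
    apply: eq_Rintegral => u /set_mem Du; rewrite -(ggE q Du).
    by rewrite mulrDr mulrBr.
  by rewrite a3 b3 d3 !opprD !opprK.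
pose h t := ip (c t) (j q) - (k + primitive D (fun t => gg t q) t).
have cprim := primitive_continuous mD (ltW hT) (igg q).
have ch : {within `[0, T], continuous h}.
  move=> u; apply: cvgB; last by apply: cvgD; [exact: cvg_cst|exact: cprim].
  exact: (within_continuous_comp (cont_ip (z := j q)) cc).
have h0 : {ae mu, forall t, 0 < t < T -> h t = 0}.
  apply: (conull_ae mD ID0); apply: ae_sub hk => u hu Du.
  rewrite /h -hu// cE// /al ipBl.
  have -> : j (pc u) = pt u - pd u by rewrite (hdec (DT Du)) addrK.
  by rewrite ipBl opprB addrA addrAC subrr.
have hz := within_continuous_ae_eq0 hT ch h0.
have ht : h t = 0 by apply: hz; rewrite (le_trans s0 st).
have hs : h s = 0 by apply: hz; rewrite s0 (le_trans st tT).
rewrite ipBl -(primitiveB mD (igg q) s0 st).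
move: ht hs; rewrite /h => /eqP; rewrite subr_eq0 => /eqP ->.
by move=> /eqP; rewrite subr_eq0 => /eqP ->; rewrite opprD addrACA subrr add0r.
Qed.

Let energy_estimate : \int[mu]_(t in D) N (j (rr t)) ^+ 2 <=
  `|c 0| ^+ 2 + (2 * continuity_constant j b N ^+ 2 + 1) *
     (\int[mu]_(t in D) N (j (ss t)) ^+ 2)
   + 3 * \int[mu]_(t in D) norm_Qm1 ip j N (dpd t) ^+ 2.
Proof.
have [C C0 hC] := state_bound.
have [M hM] := hbcont; have [K K0 jK] := continuous_linear_lipschitz jcont.
(* The Lipschitz constant of [gg t] in [q]. The absolute value of [M] is taken because the
   continuity hypothesis does not fix its sign. *)
pose G t := `|dpd t| * K + `|M| * `|rr t|.
have mG : measurable_fun D G.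
  apply: measurable_funD; apply: measurable_funM => //.
  exact: measurable_norm_smeas sQt dpd_meas.
have G0 t : 0 <= G t by rewrite addr_ge0// mulr_ge0// ltW.
have Gm t : D t -> G t <= (K + `|M| * C) * m t.
  move=> Dt; have [hr _ _] := hC t Dt; have [_ _ _ _ [_ dpdm]] := m_ge t.
  rewrite /G mulrDl; apply: lerD; first by rewrite mulrC ler_wpM2l ?(ltW K0).
  by rewrite -mulrA ler_wpM2l.
have KC0 : 0 <= K + `|M| * C by rewrite addr_ge0 ?(ltW K0)// mulr_ge0.
have iG : mu.-integrable D (EFin \o G).
  apply: (idom mG (C := K + `|M| * C)) => t Dt; rewrite ger0_norm//.
  by apply: le_trans (Gm t Dt) _; rewrite ler_wpM2l// m_sq.
have iGw : mu.-integrable D (EFin \o (fun t => G t * `|ww t|)).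
  apply: (@idom _ ((K + `|M| * C) * C)); first exact: measurable_funM.
  move=> t Dt; have [_ _ hw] := hC t Dt.
  rewrite ger0_norm ?mulr_ge0// expr2 mulrACA.
  by apply: ler_pM => //; exact: Gm.
have gG t q q' : D t -> `|gg t q - gg t q'| <= G t * `|q - q'|.
  move=> Dt.
  have -> : gg t q - gg t q' = ip (dpd t) (j (q - q')) - b (j (rr t)) (j (q - q')).
    have jB : j (q - q') = j q - j q' by exact: linearB.
    have iB := ipBr ip (j q) (j q') (dpd t).
    have bB := formBr hb (Qj q) (Qj q') (Qj (rr t)).
    by rewrite /gg jB iB bB; move: (ip _ _) (ip _ _) (b _ _) (b _ _) => x1 x2 x3 x4; ring.
  apply: le_trans (ler_normB _ _) _; rewrite /G mulrDl; apply: lerD.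
    apply: le_trans (cauchy_schwarz hilbH _ _) _.
    by rewrite -mulrA ler_wpM2l.
  apply: le_trans (hM _ _) _; rewrite ler_wpM2r// ler_wpM2r//.
  exact: ler_norm.
have g0 t : D t -> gg t 0 = 0.
  by move=> Dt; rewrite /gg linear0 ip0r (form0r (Qsum_subspace j hQt) hb)// subrr.
have [iw hw] := energy_inequality hilbQ hilbH jinj jcont hT mD DT cc cw gG g0
  (fun t _ => G0 t) iG iGw mgg gg_increment.
set C2 := 2 * continuity_constant j b N ^+ 2 + 1.
have iS : mu.-integrable D (EFin \o (fun t => C2 * N (j (ss t)) ^+ 2)).
  exact: (integrableZl mD C2 iNs).
have iDd3 : mu.-integrable D (EFin \o (fun t => 3 * norm_Qm1 ip j N (dpd t) ^+ 2)).
  exact: (integrableZl mD 3 iDd).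
have iSD : mu.-integrable D (EFin \o (fun t => C2 * N (j (ss t)) ^+ 2
    + 3 * norm_Qm1 ip j N (dpd t) ^+ 2)).
  by have := integrableD mD iS iDd3; exact: eq_integrable.
have iSDr : mu.-integrable D (EFin \o (fun t => C2 * N (j (ss t)) ^+ 2
    + 3 * norm_Qm1 ip j N (dpd t) ^+ 2 - N (j (rr t)) ^+ 2)).
  by have := integrableB mD iSD iNr; exact: eq_integrable.
have i2w : mu.-integrable D (EFin \o (fun t => 2 * gg t (ww t))).
  exact: (integrableZl mD 2 iw).
have : 2 * \int[mu]_(t in D) gg t (ww t) <=
    C2 * (\int[mu]_(t in D) N (j (ss t)) ^+ 2)
    + 3 * \int[mu]_(t in D) norm_Qm1 ip j N (dpd t) ^+ 2
    - \int[mu]_(t in D) N (j (rr t)) ^+ 2.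
  rewrite -(RintegralZl _ mD iNs) -(RintegralZl _ mD iDd) -(RintegralZl _ mD iw).
  rewrite -(RintegralD mD iS iDd3) -(RintegralB mD iSD iNr).
  apply: le_Rintegral => // t Dt; rewrite rs.
  exact: (energy_density_le hilbH jcont hQt hb hbcont hbcoer hN hNb).
move: hw; set x1 := \int[mu]_(t in D) gg t _; set x2 := \int[mu]_(t in D) N (j (rr t)) ^+ 2.
rewrite -/C2; set x3 := C2 * _; set x4 := 3 * _ => h1 h2.
rewrite -subr_ge0; apply: le_trans h1 _.
rewrite -[leRHS]addrA -[leRHS]addrA lerD2l addrA.
exact: h2.
Qed.

(** The square root of the energy estimate is subadditive in its three terms, whence [Num.sqrt 3]
    and C. The factor C + 1 of the reconstruction error collects C from [ss], split into this error
    and [pd], and 1 from splitting the total error into [rr] and this error. *)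
Lemma error_estimate_representative :
  (L2norm T N (fun t => j (p t) - pt t)%R <=
     `|c 0|%:E
     + (Num.sqrt 3)%:E * L2norm T (norm_Qm1 ip j N) dpd
     + (Num.sqrt (2 * continuity_constant j b N ^+ 2 + 1) + 1)%:E
        * L2norm T N (fun t => j (E (pt t)) - pt t)%R
     + (Num.sqrt (2 * continuity_constant j b N ^+ 2 + 1))%:E * L2norm T N pd)%E.
Proof.
rewrite (L2norm_Rintegral mD DI ID0 me ie) (L2norm_Rintegral mD DI ID0 mDd iDd).
rewrite (L2norm_Rintegral mD DI ID0 meps ieps) (L2norm_Rintegral mD DI ID0 mNpd iNpd).
rewrite -!EFinM -!EFinD lee_fin.
have he := sqrt_Rintegral_le_add mD mNr meps ie iNr ieps e_le.
have hs := sqrt_Rintegral_le_add mD meps mNpd iNs ieps iNpd s_le.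
set C2 := 2 * continuity_constant j b N ^+ 2 + 1.
have C20 : 0 <= C2 by rewrite addr_ge0// mulr_ge0// sqr_ge0.
have hr : Num.sqrt (\int[mu]_(t in D) N (j (rr t)) ^+ 2) <= `|c 0|
    + Num.sqrt C2 * Num.sqrt (\int[mu]_(t in D) N (j (ss t)) ^+ 2)
    + Num.sqrt 3 * Num.sqrt (\int[mu]_(t in D) norm_Qm1 ip j N (dpd t) ^+ 2).
  rewrite -!sqrtrM//; apply: le_trans (ler_wsqrtr energy_estimate) _.
  rewrite -/C2; set x := C2 * _; set y := 3 * _.
  have x0 : 0 <= x by rewrite mulr_ge0// Rintegral_ge0// => t _; exact: sqr_ge0.
  have y0 : 0 <= y by rewrite mulr_ge0// Rintegral_ge0// => t _; exact: sqr_ge0.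
  exact: sqrt_add3_le.
have C0 := sqrtr_ge0 C2.
apply: le_trans he _; apply: le_trans (lerD hr (lexx _)) _.
have hs' := ler_wpM2l C0 hs.
move: hs'; rewrite mulrDr mulrDl mul1r.
set a1 := Num.sqrt C2 * _; set a2 := Num.sqrt C2 * _; set a3 := Num.sqrt C2 * _.
set a4 := Num.sqrt 3 * _; set a5 := Num.sqrt _.
exact: error_terms_add.
Qed.

End continuous_representative.

End error_estimate.

(** * The initial value and a common conull set *)

Lemma ae_implyI (R : realType) (T : R) (P P' : R -> Prop) :
  {ae @lebesgue_measure R, forall t, 0 < t < T -> P t} ->
  {ae @lebesgue_measure R, forall t, 0 < t < T -> P' t} ->
  {ae @lebesgue_measure R, forall t, 0 < t < T -> P t /\ P' t}.
Proof.
by move=> h h'; apply: ae_sub (ae_and h h') => t [a a'] tT; split; auto.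
Qed.

Lemma is_initial_value_initial_value (R : realType) (H : completeNormedModType R)
    (T : R) (u : R -> H) h : is_initial_value T u h ->
  is_initial_value T u (initial_value T u).
Proof. by move=> hu; exact: (@xgetPex _ 0 [set h | is_initial_value T u h] (ex_intro _ h hu)). Qed.

Theorem theorem2p4 (R : realType) (Q H : completeNormedModType R)
  (ipQ : {dot Q for (@idfun R)}) (ip : {dot H for (@idfun R)})
  (hilbQ : hilbert ipQ) (hilbH : hilbert ip)
  (j : {linear Q -> H}) (hj : dense_embedding j)
  (Qt : set H) (hQt : finite_dim_subspace Qt)
  (T : R) (hT : 0 < T) (f : H) (p0 : Q)
  (b : H -> H -> R) (hb : bilinear_on (Qsum j Qt) b)
  (hbcont : continuous_form j b) (hbcoer : coercive_form j b)
  (N : H -> R) (hN : norm_on (Qsum j Qt) N)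
  (hNb : forall q : Q, N (j q) ^+ 2 = b (j q) (j q))
  (* elliptic reconstruction *)
  (Pi B : H -> H) (E : H -> Q)
  (hPi : is_orthogonal_projection ip Qt Pi)
  (hB : is_riesz_representative ip Qt b B)
  (hE : is_elliptic_reconstruction ip j Qt b f Pi B E)
  (* exact solution *)
  (p : R -> Q) (dp : R -> Q -> R^o)
  (hp : in_L2 T setT (fun q : Q => `|q|) p)
  (hdp : in_L2 T (@dual R Q) (@dual_norm R Q) dp)
  (hpdp : weak_derivative T (@dual R Q) (@dual_norm R Q)
            (fun t => gelfand ip j (j (p t))) dp)
  (heq : {ae @lebesgue_measure R, forall t, 0 < t < T ->
            forall q : Q, dp t q + b (j (p t)) (j q) = ip f (j q)})
  (hp0 : is_initial_value T (fun t => j (p t)) (j p0))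
  (* Galerkin approximation *)
  (pt dpt : R -> H)
  (hpt : in_L2 T Qt (fun x : H => `|x|) pt)
  (hdpt : in_L2 T Qt (fun x : H => `|x|) dpt)
  (hptdpt : weak_derivative T Qt (fun x : H => `|x|) pt dpt)
  (hgal : {ae @lebesgue_measure R, forall t, 0 < t < T ->
            forall y : H, Qt y -> ip (dpt t) y + b (pt t) y = ip f y})
  (* decomposition *)
  (pc : R -> Q) (pd dpd : R -> H)
  (hdec : forall t, 0 < t < T -> pt t = j (pc t) + pd t)
  (hpd : in_L2 T Qt (fun x : H => `|x|) pd)
  (hdpd : in_L2 T Qt (fun x : H => `|x|) dpd)
  (hpddpd : weak_derivative T Qt (fun x : H => `|x|) pd dpd) :
  let e := fun t : R => j (p t) - pt t in
  let ec := fun t : R => j (p t) - j (pc t) in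
  let eps := fun t : R => j (E (pt t)) - pt t in
  let C := Num.sqrt (2 * continuity_constant j b N ^+ 2 + 1) in
  (L2norm T N e <=
     `|initial_value T ec|%:E
     + (Num.sqrt 3)%:E * L2norm T (norm_Qm1 ip j N) dpd
     + (C + 1)%:E * L2norm T N eps
     + C%:E * L2norm T N pd)%E.
Proof.
set ec := (fun t => j (p t) - j (pc t)); cbv zeta.
have [_ jcont _] := hj; have [jinj _ _] := hj.
have [[sp [_ sSp spE]] p_L2] := hp.
have [[spt [Spt sSpt sptE]] pt_L2] := hpt.
have [[sdpt [Sdpt sSdpt sdptE]] dpt_L2] := hdpt.
have [[spd [Spd sSpd spdE]] pd_L2] := hpd.
have [[sdpd [Sdpd sSdpd sdpdE]] dpd_L2] := hdpd.
have good := ae_implyI spE (ae_implyI sptE (ae_implyI sdptE (ae_implyI spdE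
  (ae_implyI sdpdE (ae_implyI heq hgal))))).
have smeas_restrict (V : lmodType R) (S : set V) (M : V -> R) v s (D : set R) :
    D `<=` [set` `]0, T[] -> (forall t, 0 < t < T -> S (v t)) ->
    (forall n, simple_in S (s n)) ->
    (forall t, D t -> (fun n => M (simple_val (s n) t - v t)) @ \oo --> (0 : R)) ->
    smeas D S M v.
  move=> DI Sv Ss sv; exists s; split => // t /DI /=.
  by rewrite in_itv; exact: Sv.
(* [initial_value] falls back to 0 when there is no continuous representative, so one must be
   exhibited: the one of [p] minus the one built for [pc]. *)
have ec_initial : exists h, is_initial_value T ec h.
  have [D [mD DI D0 hD]] := ae_conull good.
  have [z [cz zE]] : exists z : R -> H, {within `[0, T], continuous z} /\
      {ae @lebesgue_measure R, forall t, D t -> z t = j (pc t)}.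
    apply: (conforming_part_continuous hilbH hQt hT hptdpt hpddpd hdec p_L2 pt_L2
      dpt_L2 pd_L2 dpd_L2 mD DI D0).
    - by apply: (smeas_restrict _ _ _ _ sp) => // t /hD[].
    - by apply: (smeas_restrict _ _ _ _ spt) => // t /hD[_ []].
    - by apply: (smeas_restrict _ _ _ _ sdpt) => // t /hD[_ [_ []]].
    - by apply: (smeas_restrict _ _ _ _ spd) => // t /hD[_ [_ [_ []]]].
    - by apply: (smeas_restrict _ _ _ _ sdpd) => // t /hD[_ [_ [_ [_ []]]]].
  have [cp [ccp cpE _]] := hp0.
  exists (cp 0 - z 0), (fun t => cp t - z t); split => //.
    by move=> t; apply: cvgB; [exact: ccp|exact: cz].
  apply: ae_sub (ae_and cpE (conull_ae mD D0 zE)) => t [h1 h2] tT.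
  by rewrite /ec h1// h2.
have [h0 hh0] := ec_initial.
have [c [cc cE <-]] := is_initial_value_initial_value hh0.
(* A new conull set is needed: [c] is the representative behind [initial_value], and [D] must also
   avoid the times where [c] differs from [ec]. *)
have [D [mD DI D0 hD]] := ae_conull (ae_implyI cE good).
have [L [CL CL0 hCL] LQ] := conforming_part_lipschitz hilbH jinj hQt.
apply: (error_estimate_representative hilbQ hilbH jinj jcont hQt hT hb hbcont hbcoer
  hN hNb hPi hB hE hpdp hptdpt hpddpd hdec p_L2 pt_L2 dpt_L2 pd_L2 dpd_L2 mD DI D0
  _ _ _ _ _ _ _ CL0 hCL LQ cc).
- by apply: (smeas_restrict _ _ _ _ sp) => // t /hD[_ []].
- by apply: (smeas_restrict _ _ _ _ spt) => // t /hD[_ [_ []]].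
- by apply: (smeas_restrict _ _ _ _ sdpt) => // t /hD[_ [_ [_ []]]].
- by apply: (smeas_restrict _ _ _ _ spd) => // t /hD[_ [_ [_ [_ []]]]].
- by apply: (smeas_restrict _ _ _ _ sdpd) => // t /hD[_ [_ [_ [_ [_ []]]]]].
- by move=> t /hD[_ [_ [_ [_ [_ [_ []]]]]]].
- by move=> t /hD[_ [_ [_ [_ [_ [_ []]]]]]].
- by move=> t /hD[].
Qed.
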